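(* Let $K$ be a field, $d\ge 1$, and let $\Delta$ be a $d$-dimensional simplicial complex on the vertices $1,\dots,n$, labeled by a labeling that makes $\Delta$ semi-closed. Then the determinantal facet ideal $J_\Delta\subset S$ is radical. Indeed, for any diagonal term order $<$ on $S$, the initial ideal $\mathrm{in}_<(J_\Delta)$ is a square-free monomial ideal. Moreover, if $K$ has characteristic $p>0$, then $S/J_\Delta$ is $F$-pure.
   Context: A pure $d$-dimensional simplicial complex $\Delta$ with vertices labeled $1,\dots,n$ is semi-closed (with respect to this labeling) if for every $d$-face $\{a_0<a_1<\dots<a_d\}$ of $\Delta$ at least one of the following holds: (i) all sets $\{a_0<i_1<\dots<i_d\}\subset\{1,\dots,n\}$ with $i_1\le a_1,\dots,i_d\le a_d$ are faces of $\Delta$; (ii) all sets $\{i_0<\dots<i_{d-1}<a_d\}\subset\{1,\dots,n\}$ with $i_0\ge a_0,\dots,i_{d-1}\ge a_{d-1}$ are faces of $\Delta$. Let $S=K[x_{ij}: 0\le i\le d,\ 1\le j\le n]$ and let $X=(x_{ij})$ be the $(d+1)\times n$ matrix of variables (rows indexed $0,\dots,d$, columns $1,\dots,n$). For $0\le a_0<\dots<a_r\le d$ and $1\le b_0<\dots<b_r\le n$, $[a_0\ldots a_r|b_0\ldots b_r]$ is the minor of $X$ with rows $a_0,\dots,a_r$ and columns $b_0,\dots,b_r$; when $r=d$ it is written $[b_0\ldots b_d]$. The determinantal facet ideal is $J_\Delta=([a_0\ldots a_d]: \{a_0<\dots<a_d\}\in\Delta)\subset S$. A term order on $S$ is diagonal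 if the initial term of every minor $[a_0\ldots a_r|b_0\ldots b_r]$ is $x_{a_0b_0}x_{a_1b_1}\cdots x_{a_rb_r}$. For a ring $R$ of prime characteristic $p$, let $F_*R$ be $R$ as an additive group with $R$-module structure $r\cdot x=r^px$, and $F:R\to F_*R$, $r\mapsto r^p$. $R$ is $F$-pure if $F\otimes 1_M: M\to F_*R\otimes_R M$ is injective for every $R$-module $M$. *)

(* Defs.v *)
From HB Require Import structures.
From mathcomp Require Import all_boot all_order all_algebra.
From mathcomp Require Import boolp.
From mathcomp Require monalg.
From mathcomp Require Import mpoly.

Set Implicit Arguments.
Unset Strict Implicit.
Unset Printing Implicit Defensive.

Import GRing.Theory.
Local Open Scope ring_scope.
Local Open Scope quotient_scope.

(* monalg reuses the notations of mpoly, so it is imported only locally. *)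
Module Export FreeModule.
Import monalg.

Definition free_module (R : nzRingType) (T : choiceType) : lmodType R :=
  {malg R[T]}.
Definition free_gen (R : nzRingType) (T : choiceType) (t : T) :
  free_module R T := mkmalgU t 1.

End FreeModule.

(* The R-linear combinations of elements of G. The boolean reflection of the
   proposition is what the quotient constructions of ring_quotient expect. *)
Definition gen_submod (R : nzRingType) (V : lmodType R) (G : V -> Prop) :
    {pred V} :=
  fun v => `[< exists s : seq (R * V),
     (forall x, x \in s -> G x.2) /\ v = \sum_(x <- s) x.1 *: x.2 >].

Lemma gen_submod_closed (R : nzRingType) (V : lmodType R) (G : V -> Prop) :
  submod_closed (gen_submod G).
Proof.
split; first by apply/asboolP; exists [::]; rewrite big_nil.
move=> a u v /asboolP[s [Gs ->]] /asboolP[t [Gt ->]]; apply/asboolP.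
exists ([seq (a * x.1, x.2) | x <- s] ++ t); split.
  by move=> x; rewrite mem_cat => /orP[/mapP[y /Gs Gy ->]|/Gt].
rewrite big_cat big_map scaler_sumr; congr (_ + _).
by apply: eq_bigr => x _; rewrite scalerA.
Qed.

HB.instance Definition _ (R : nzRingType) (V : lmodType R) (G : V -> Prop) :=
  GRing.isSubmodClosed.Build R V (gen_submod G) (gen_submod_closed G).

Definition gen_ideal (R : comNzRingType) (G : R -> Prop) : {pred R} :=
  gen_submod (G : R^o -> Prop).

Lemma gen_idealMr (R : comNzRingType) (G : R -> Prop) (a u : R) :
  u \in gen_ideal G -> a * u \in gen_ideal G.
Proof. exact: (@rpredZ R R^o (gen_submod _)). Qed.

Definition is_radical (R : comNzRingType) (I : {pred R}) : Prop :=
  forall (f : R) (k : nat), f ^+ k \in I -> f \in I.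

(* A tensor B over R: the free R-module on A * B modulo the bilinearity
   relations. *)
Section Tensor.
Variables (R : comNzRingType) (A B : lmodType R).

Definition free_tensor : lmodType R := free_module R (A * B)%type.
Definition free_pair (a : A) (b : B) : free_tensor := free_gen R (a, b).

Variant bilinear_relation : free_tensor -> Prop :=
| bilinDl a a' b : bilinear_relation
    (free_pair (a + a') b - (free_pair a b + free_pair a' b))
| bilinDr a b b' : bilinear_relation
    (free_pair a (b + b') - (free_pair a b + free_pair a b'))
| bilinZl r a b : bilinear_relation
    (free_pair (r *: a) b - r *: free_pair a b)
| bilinZr r a b : bilinear_relation
    (free_pair a (r *: b) - r *: free_pair a b).

Definition tensor : Type := {ideal_quot (gen_submod bilinear_relation)}.
HB.instance Definition _ := GRing.Zmodule.on tensor.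

Definition tensor_pi (x : free_tensor) : tensor :=
  \pi_({ideal_quot (gen_submod bilinear_relation)}) x.

Definition tensor_scale (r : R) (x : tensor) : tensor :=
  tensor_pi (r *: (repr x : free_tensor)).

Lemma tensor_piE x y :
  (tensor_pi x == tensor_pi y) = (x - y \in gen_submod bilinear_relation).
Proof. by rewrite /tensor_pi -Quotient.idealrBE. Qed.

Lemma tensor_reprK x : tensor_pi (repr x) = x.
Proof. exact: reprK. Qed.

Lemma tensor_piD x y : tensor_pi (x + y) = tensor_pi x + tensor_pi y.
Proof. by rewrite /tensor_pi raddfD. Qed.

Lemma tensor_scale_pi r x : tensor_scale r (tensor_pi x) = tensor_pi (r *: x).
Proof.
apply/eqP; rewrite tensor_piE -scalerBr; apply: rpredZ.
by rewrite -tensor_piE tensor_reprK.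
Qed.

Lemma tensor_scaleA a b v :
  tensor_scale a (tensor_scale b v) = tensor_scale (a * b) v.
Proof. by rewrite -[v]tensor_reprK !tensor_scale_pi scalerA. Qed.

Lemma tensor_scale1 : left_id 1 tensor_scale.
Proof. by move=> v; rewrite -[v]tensor_reprK tensor_scale_pi scale1r. Qed.

Lemma tensor_scaleDr : right_distributive tensor_scale +%R.
Proof.
move=> a u v; rewrite -[u]tensor_reprK -[v]tensor_reprK -tensor_piD.
by rewrite !tensor_scale_pi scalerDr tensor_piD.
Qed.

Lemma tensor_scaleDl v : {morph tensor_scale^~ v : a b / a + b}.
Proof.
move=> a b; rewrite /= -[v]tensor_reprK !tensor_scale_pi scalerDl.
exact: tensor_piD.
Qed.

HB.instance Definition _ := GRing.Zmodule_isLmodule.Build R tensor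
  tensor_scaleA tensor_scale1 tensor_scaleDr tensor_scaleDl.

Lemma tensor_piZ r x : tensor_pi (r *: x) = r *: tensor_pi x.
Proof. exact: esym (tensor_scale_pi r x). Qed.

Definition tens (a : A) (b : B) : tensor := tensor_pi (free_pair a b).

End Tensor.

Section Frobenius.
Variables (R : comNzRingType) (p : nat) (pcharR : p \in [pchar R]).

(* The additive group of R, with the R-module structure r *: x = r ^+ p * x;
   the proof argument makes the structure below well defined. *)
Definition Fstar & p \in [pchar R] : Type := R.
HB.instance Definition _ := GRing.Zmodule.on (Fstar pcharR).

Definition Fstar_scale (r : R) (x : Fstar pcharR) : Fstar pcharR :=
  r ^+ p * (x : R).

Lemma Fstar_scaleA a b v :
  Fstar_scale a (Fstar_scale b v) = Fstar_scale (a * b) v.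
Proof. by rewrite /Fstar_scale mulrA exprMn. Qed.

Lemma Fstar_scale1 : left_id 1 Fstar_scale.
Proof. by move=> v; rewrite /Fstar_scale expr1n mul1r. Qed.

Lemma Fstar_scaleDr : right_distributive Fstar_scale +%R.
Proof. by move=> a u v; apply: mulrDr. Qed.

Lemma Fstar_scaleDl v : {morph Fstar_scale^~ v : a b / a + b}.
Proof.
move=> a b; rewrite /Fstar_scale /= -!(pFrobenius_autE pcharR).
by rewrite pFrobenius_autD_comm ?mulrDl //; apply: mulrC.
Qed.

HB.instance Definition _ := GRing.Zmodule_isLmodule.Build R (Fstar pcharR)
  Fstar_scaleA Fstar_scale1 Fstar_scaleDr Fstar_scaleDl.

Definition frob (r : R) : Fstar pcharR := r ^+ p.

(* F tensor 1_M precomposed with the isomorphism m |-> 1 tensor m from M to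
   R tensor M. *)
Definition frob_tensor (M : lmodType R) (m : M) : tensor (Fstar pcharR) M :=
  tens (frob 1) m.

End Frobenius.

(* R has characteristic p, and F tensor 1_M is injective for all M. *)
Definition F_pure (p : nat) (R : comNzRingType) : Prop :=
  exists pcharR : p \in [pchar R],
    forall M : lmodType R, injective (@frob_tensor R p pcharR M).

(* The vertices 1, ..., n and the rows 0, ..., d are represented by 'I_n (so
   that labels are shifted by one) and 'I_d.+1. A set a_0 < ... < a_d is
   given by its increasing enumeration. *)
Section Complexes.
Variable n : nat.
Implicit Types (Delta : {set {set 'I_n}}) (d : nat).

Definition increasing k m (a : 'I_k -> 'I_m) : Prop :=
  forall i j : 'I_k, (i < j)%N -> (a i < a j)%N.

Definition vset k (a : 'I_k -> 'I_n) : {set 'I_n} := [set a i | i : 'I_k].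

Definition simplicial_complex Delta : Prop :=
  (forall v : 'I_n, [set v] \in Delta) /\
  (forall F G : {set 'I_n}, G \subset F -> F \in Delta -> G \in Delta).

Definition facet Delta (F : {set 'I_n}) : bool :=
  maxset (fun G : {set 'I_n} => G \in Delta) F.

Definition pure_of_dim d Delta : Prop :=
  \max_(F in Delta) #|F| = d.+1 /\
  (forall F, facet Delta F -> #|F| = d.+1).

Definition semi_closed d Delta : Prop :=
  forall a : 'I_d.+1 -> 'I_n, increasing a -> vset a \in Delta ->
    (forall i : 'I_d.+1 -> 'I_n, increasing i -> i ord0 = a ord0 ->
       (forall k, (i k <= a k)%N) -> vset i \in Delta)
    \/
    (forall i : 'I_d.+1 -> 'I_n, increasing i -> i ord_max = a ord_max ->
       (forall k, (a k <= i k)%N) -> vset i \in Delta).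

End Complexes.

Section TermOrders.
Variables (K : fieldType) (N : nat).
Implicit Types (le : rel 'X_{1..N}) (I : {pred {mpoly K[N]}}).

Definition term_order le : Prop :=
  [/\ reflexive le, antisymmetric le, transitive le & total le] /\
  [/\ forall m, le 0%MM m
    & forall m m1 m2, le m1 m2 -> le (m + m1)%MM (m + m2)%MM].

(* The le-largest monomial of the support of f; a default value when f = 0,
   for which init_term le f = 0. *)
Definition init_mon le (f : {mpoly K[N]}) : 'X_{1..N} :=
  last 0%MM (sort le (msupp f)).

Definition init_term le (f : {mpoly K[N]}) : {mpoly K[N]} :=
  f@_(init_mon le f) *: 'X_[init_mon le f].

Definition init_ideal le I : {pred {mpoly K[N]}} :=
  gen_ideal (fun g => exists2 f, f \in I & g = init_term le f).

Definition squarefree_monomial_ideal I : Prop :=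
  exists2 A : 'X_{1..N} -> Prop,
    (forall m, A m -> forall i, (m i <= 1)%N) &
    I =i gen_ideal (fun g => exists2 m, A m & g = 'X_[m]).

End TermOrders.

Section FacetIdeal.
Variables (K : fieldType) (d n : nat).

Local Notation S := {mpoly K[d.+1 * n]}.

Definition xvar (i : 'I_d.+1) (j : 'I_n) : S := 'X_(mxvec_index i j).

Definition Xmx : 'M[S]_(d.+1, n) := \matrix_(i, j) xvar i j.

Definition minor k (a : 'I_k -> 'I_d.+1) (b : 'I_k -> 'I_n) : S :=
  \det (mxsub a b Xmx).

Definition diagonal (le : rel 'X_{1..d.+1 * n}) : Prop :=
  forall r (a : 'I_r.+1 -> 'I_d.+1) (b : 'I_r.+1 -> 'I_n),
    increasing a -> increasing b ->
    init_term le (minor a b) = \prod_k xvar (a k) (b k).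

Definition facet_ideal (Delta : {set {set 'I_n}}) : {pred S} :=
  gen_ideal (fun f => exists a : 'I_d.+1 -> 'I_n,
    [/\ increasing a, vset a \in Delta & f = minor id a]).

(* The generators vanish at the origin, so the ideal is proper; this is what
   {ideal_quot _} requires. *)
Lemma facet_ideal_closed Delta : idealr_closed (facet_ideal Delta).
Proof.
split; first exact: (rpred0 (gen_submod _)).
  apply/negP => /asboolP[s [Gs]].
  move=> /(congr1 (meval (fun=> 0))); rewrite meval1 raddf_sum /= big_seq.
  rewrite big1 => [/eqP|[c f] /Gs[a [_ _ /= ->]]]; first by rewrite oner_eq0.
  apply: etrans (mevalM _ c (minor id a)) _.
  rewrite /minor (expand_det_row _ ord0) raddf_sum big1 ?mulr0 // => j _.
  by rewrite /= mevalM !mxE mevalXU mul0r.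
move=> a u v uI vI.
exact: (rpredD (gen_idealMr a uI : _ \in gen_submod _) vI).
Qed.

HB.instance Definition _ (Delta : {set {set 'I_n}}) :=
  isIdealr.Build S (facet_ideal Delta) (facet_ideal_closed Delta).

End FacetIdeal.

Arguments facet_ideal K d {n} Delta.

(* Main.v *)
(* In characteristic p, let f be the product of the maximal minors of adjacent
   columns of a matrix of variables, times the variables on none of their
   diagonals, and let psi(h) = Tr(f^(p-1) h), where Tr extracts p-th roots of
   the terms of h with exponents congruent to -1. Since the initial monomial of
   f is the product of all variables, psi(1) = 1 and psi sends a monic
   polynomial with initial monomial m^p to one with initial monomial m. Hence,
   if psi(J) is contained in J, then in(J) is closed under p-th roots, that is,
   square-free, and psi induces a splitting of the Frobenius of S/J, which is
   thus F-pure.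

   Sums, intersections and colons of psi-stable ideals are psi-stable, and so
   are the principal ideals of the factors of f. From these one reaches, by
   sums, colons and intersections, psi-stable ideals with all t-minors of given
   consecutive columns and having only initial monomials divisible by the
   diagonal term of such a minor. The ideal of the [tau] with c <= tau_0 and
   tau <= a is an intersection of those, and psi-stable. Semi-closedness makes
   J_Delta a sum of such ideals and of their images under a half-turn of the
   matrix. The matrix is first padded with columns on both sides, so that all
   of the minors at hand avoid the boundary.

   In characteristic zero, m being an initial monomial of J_Delta is the
   solvability of an integer linear system, which by the Smith normal form is
   the same over K and over F_p for all large p. Radicality follows from the
   square-freeness of the initial ideal for a well-founded order. *)
Require Import Defs.
From mathcomp Require Import all_boot all_order all_algebra.
From mathcomp Require Import boolp perm mpoly zify.
From mathcomp Require classical_sets.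

Set Implicit Arguments.
Unset Strict Implicit.
Unset Printing Implicit Defensive.

Import GRing.Theory.
Local Open Scope ring_scope.

(** * Leading monomials and ideals *)

(** The map psi depends on no term order. Any diagonal order serves to read off the initial monomial
    of psi(h), but the psi-stability of J can be proved with an order of one's choice. The one taken
    is well-founded and gives x_{iy} the weight y B^i for a large B, so that the rows of largest
    index decide first; certain truncated determinants then have their diagonal as initial term.

    The delicate point is that the intersection of the rank ideals is no larger than the ideal of
    the [tau]. A monomial with a chain of every length within the bounds need not be divisible by
    the diagonal of one admissible [tau], since the short chains may have to use boxes outside the
    long ones. The required element of the ideal is therefore a determinant indexed by the union of
    suitable chains, one for each length. Its entries are truncated so that each term of a Laplace
    expansion carries a maximal minor with admissible columns.

    The psi-stable ideals in between are never identified: it is enough to know some minors that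
    they contain and a bound on their initial monomials. *)

Definition monic_at (K : fieldType) (N : nat) (le : rel 'X_{1..N})
    (f : {mpoly K[N]}) (m : 'X_{1..N}) : Prop :=
  f@_m = 1 /\ forall m', f@_m' != 0 -> le m' m.

Section Leading.
Variables (K : fieldType) (N : nat) (le : rel 'X_{1..N}).
Hypothesis Hle : term_order le.
Implicit Types (f g h : {mpoly K[N]}) (m u v : 'X_{1..N}).

Local Notation monic := (monic_at le).

Lemma tle_refl : reflexive le. Proof. by case: Hle => [[]]. Qed.
Lemma tle_anti : antisymmetric le. Proof. by case: Hle => [[]]. Qed.
Lemma tle_trans : transitive le. Proof. by case: Hle => [[]]. Qed.
Lemma tle_total : total le. Proof. by case: Hle => [[]]. Qed.
Lemma tle0 m : le 0%MM m. Proof. by case: Hle => [_ []]. Qed.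

Lemma tle_add2l m u v : le u v -> le (m + u)%MM (m + v)%MM.
Proof. by case: Hle => [_ [_ H]]; apply: H. Qed.

Lemma tle_add2r m u v : le u v -> le (u + m)%MM (v + m)%MM.
Proof. by rewrite ![(_ + m)%MM]addmC; apply: tle_add2l. Qed.

Lemma tle_eq u v : le u v -> le v u -> u = v.
Proof. by move=> a b; apply: tle_anti; rewrite a b. Qed.

Lemma tle_add2lI m u v : le (m + u)%MM (m + v)%MM -> le u v.
Proof.
case/orP: (tle_total u v) => // /(tle_add2l m) vu uv.
by rewrite (addmI (tle_eq uv vu)) tle_refl.
Qed.

Lemma tle_add u v u' v' : le u v -> le u' v' -> le (u + u')%MM (v + v')%MM.
Proof.
by move=> /(tle_add2r u') a /(tle_add2l v) b; apply: tle_trans a b.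
Qed.

Lemma tle_add_eq u v u' v' : le u v -> le u' v' ->
  (u + u' = v + v')%MM -> u = v /\ u' = v'.
Proof.
move=> a b e; suff e1 : u = v by split=> //; move: e; rewrite e1 => /addmI.
apply: tle_eq => //; apply: (@tle_add2lI u').
by rewrite ![(u' + _)%MM]addmC e; apply: tle_add2l.
Qed.

Lemma mcoeffM_lead f g u v :
  (forall m, f@_m != 0 -> le m u) -> (forall m, g@_m != 0 -> le m v) ->
  (f * g)@_(u + v) = f@_u * g@_v.
Proof.
move=> fu gv; rewrite mcoeffM.
have bd (a b : 'X_{1..N}) : (mdeg a < (mdeg (a + b)%MM).+1)%N.
  by rewrite mdegD ltnS leq_addr.
have bd' (a b : 'X_{1..N}) : (mdeg b < (mdeg (a + b)%MM).+1)%N.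
  by rewrite mdegD ltnS leq_addl.
rewrite (bigD1 (BMultinom (bd u v), BMultinom (bd' u v))) //=.
rewrite big1 ?addr0 // => -[[a pa] [b pb]] /= /andP[/eqP e].
rewrite xpair_eqE /= !bmeqP /= => ne.
have [->|na] := eqVneq (f@_a) 0; first by rewrite mul0r.
have [->|nb] := eqVneq (g@_b) 0; first by rewrite mulr0.
have [ea eb] := tle_add_eq (fu _ na) (gv _ nb) (esym e).
by rewrite ea eb !eqxx in ne.
Qed.

Lemma mcoeffM_neq0 f g m : (f * g)@_m != 0 ->
  exists u v, [/\ f@_u != 0, g@_v != 0 & m = (u + v)%MM].
Proof.
rewrite -mcoeff_msupp => /msuppM_le /allpairsP[[u v] /= [a b ->]].
by exists u, v; rewrite -!mcoeff_msupp.
Qed.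

Lemma monic_atM f g u v : monic f u -> monic g v -> monic (f * g) (u + v)%MM.
Proof.
move=> [fu fle] [gv gle]; split.
  by rewrite mcoeffM_lead ?fu ?gv ?mulr1 //.
move=> m /mcoeffM_neq0[a [b [/fle au /gle bv ->]]].
exact: tle_add.
Qed.

Lemma monic_atX u : monic ('X_[u] : {mpoly K[N]}) u.
Proof.
split=> [|m]; first by rewrite mcoeffX eqxx.
by rewrite mcoeffX; case: (u =P m) => [-> _|]; [apply: tle_refl|rewrite eqxx].
Qed.

Lemma monic_at1 : monic (1 : {mpoly K[N]}) 0%MM.
Proof. by rewrite -mpolyX0; apply: monic_atX. Qed.

Lemma monic_at_prod (I : Type) (r : seq I) (F : I -> {mpoly K[N]}) (U : I -> 'X_{1..N}) :
  (forall i, monic (F i) (U i)) ->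
  monic (\prod_(i <- r) F i) (\big[mnm_add/0%MM]_(i <- r) U i).
Proof.
move=> H; elim: r => [|i r IH]; first by rewrite !big_nil; apply: monic_at1.
by rewrite !big_cons; apply: monic_atM.
Qed.

Lemma monic_at_exp f u n : monic f u -> monic (f ^+ n) (u *+ n)%MM.
Proof.
move=> fu; elim: n => [|n IH]; first by rewrite expr0 mulm0n; apply: monic_at1.
by rewrite exprS mulmS; apply: monic_atM.
Qed.

Lemma monic_at_neq0 f u : monic f u -> f != 0.
Proof. by case=> H _; apply: contraTneq (oner_neq0 K) => e; rewrite -H e mcoeff0 eqxx. Qed.

Lemma tle_sorted_last (x : 'X_{1..N}) s : x \in s -> le x (last 0%MM (sort le s)).
Proof.
have srt := sort_sorted tle_total s; move: srt.
rewrite -(mem_sort le); case: (sort le s) => // y t /= p.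
elim: t y p x => [|z t IH] y /= p x; first by rewrite inE => /eqP->; apply: tle_refl.
case/andP: p => yz p; rewrite inE => /orP[/eqP->|]; last exact: IH.
by apply: tle_trans yz _; apply: IH p _ (mem_head _ _).
Qed.

Lemma init_mon_max f m : f@_m != 0 -> le m (init_mon le f).
Proof. by rewrite -mcoeff_msupp => /tle_sorted_last. Qed.

Lemma init_mon_supp f : f != 0 -> f@_(init_mon le f) != 0.
Proof.
rewrite -msupp_eq0 -mcoeff_msupp /init_mon -(mem_sort le) -size_eq0 -(size_sort le).
by case: (sort le _) => //= y t _; apply: mem_last.
Qed.

Lemma monic_at_scale f : f != 0 -> monic ((f@_(init_mon le f))^-1 *: f) (init_mon le f).
Proof.
move=> f0; have n0 := init_mon_supp f0; split; first by rewrite mcoeffZ mulVf.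
by move=> m; rewrite mcoeffZ mulf_eq0 negb_or => /andP[_ /init_mon_max].
Qed.

Lemma init_monE f u : f@_u != 0 -> (forall m, f@_m != 0 -> le m u) -> init_mon le f = u.
Proof.
move=> fu H; apply: tle_eq; last exact: init_mon_max.
by apply/H/init_mon_supp; apply: contraNneq fu => ->; rewrite mcoeff0.
Qed.

Lemma monic_at_init f u : monic f u -> init_mon le f = u.
Proof. by case=> fu H; apply: init_monE => //; rewrite fu oner_neq0. Qed.

End Leading.

Section Ideals.
Variable R : comNzRingType.
Implicit Types (I J : R -> Prop) (a u v : R).

Definition is_ideal I : Prop :=
  [/\ I 0, forall u v, I u -> I v -> I (u + v) & forall a u, I u -> I (a * u)].

Definition ideal_add I J : R -> Prop := fun h => exists i j, [/\ I i, J j & h = i + j].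
Definition ideal_principal (f : R) : R -> Prop := fun h => exists q, h = q * f.

Section One.
Variable I : R -> Prop.
Hypothesis HI : is_ideal I.

Lemma ideal0 : I 0. Proof. by case: HI. Qed.
Lemma idealD u v : I u -> I v -> I (u + v). Proof. by case: HI => _ H _; apply: H. Qed.
Lemma idealM a u : I u -> I (a * u). Proof. by case: HI => _ _ H; apply: H. Qed.
Lemma idealMr a u : I u -> I (u * a). Proof. by rewrite mulrC; apply: idealM. Qed.
Lemma idealN u : I u -> I (- u). Proof. by move=> H; rewrite -mulN1r; apply: idealM. Qed.
Lemma idealB u v : I u -> I v -> I (u - v).
Proof. by move=> a /idealN; apply: idealD. Qed.

Lemma ideal_sum (T : Type) (r : seq T) (P : pred T) (F : T -> R) :
  (forall i, P i -> I (F i)) -> I (\sum_(i <- r | P i) F i).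
Proof. by move=> H; elim/big_ind: _ => //; [exact: ideal0|exact: idealD]. Qed.

Lemma ideal_cong_prod (T : Type) (r : seq T) (F G : T -> R) :
  (forall i, I (F i - G i)) -> I (\prod_(i <- r) F i - \prod_(i <- r) G i).
Proof.
move=> H; elim: r => [|i r IH]; first by rewrite !big_nil subrr; apply: ideal0.
rewrite !big_cons.
rewrite (_ : _ - _ = F i * (\prod_(j <- r) F j - \prod_(j <- r) G j)
  + (F i - G i) * \prod_(j <- r) G j); last by rewrite mulrBr mulrBl addrA subrK.
by apply: idealD; [apply: idealM|apply: idealMr].
Qed.

Lemma ideal_cong_det n (A B : 'M[R]_n) :
  (forall i j, I (A i j - B i j)) -> I (\det A - \det B).
Proof.
move=> H; rewrite /determinant -sumrB; apply: ideal_sum => s _.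
by rewrite -mulrBr; apply: idealM; apply: ideal_cong_prod.
Qed.

End One.

Lemma ideal_principal_ideal f : is_ideal (ideal_principal f).
Proof.
split; first by exists 0; rewrite mul0r.
  by move=> u v [q ->] [q' ->]; exists (q + q'); rewrite mulrDl.
by move=> a u [q ->]; exists (a * q); rewrite mulrA.
Qed.

Lemma ideal_add_ideal I J : is_ideal I -> is_ideal J -> is_ideal (ideal_add I J).
Proof.
move=> HI HJ; split.
- by exists 0, 0; rewrite addr0; split=> //; apply: ideal0.
- move=> u v [i [j [Ii Jj ->]]] [i' [j' [Ii' Jj' ->]]]; exists (i + i'), (j + j').
  by split; [exact: idealD|exact: idealD|rewrite addrACA].
- move=> a u [i [j [Ii Jj ->]]]; exists (a * i), (a * j).
  by split; [exact: idealM|exact: idealM|rewrite mulrDr].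
Qed.

End Ideals.

(** * Ideals stable under a trace map *)

Lemma mcoeffXM (K : fieldType) (N : nat) (v u : 'X_{1..N}) (g : {mpoly K[N]}) :
  ('X_[v] * g)@_u = if (v <= u)%MM then g@_(u - v) else 0.
Proof.
case: ifP => [vu|nvu]; first by rewrite -{1}(submK vu) addmC mulrC mcoeffMX.
apply/eqP; apply: contraFT nvu => /mcoeffM_neq0[a [b []]].
rewrite mcoeffX; case: (v =P a) => [-> _ _ ->|_]; last by rewrite eqxx.
exact: lem_addr.
Qed.

Definition initial_in (K : fieldType) (N : nat) (le : rel 'X_{1..N})
  (I : {mpoly K[N]} -> Prop) (m : 'X_{1..N}) : Prop :=
  exists2 f, I f & monic_at le f m.

(** For a perfect field this is the p-th root. In general it is a linear projection of [K] onto its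
    subfield of p-th powers, followed by the p-th root. *)
Record frob_retract (K : fieldType) (p : nat) (piK : K -> K) : Prop := FrobRetract {
  frob_retractD : forall a b, piK (a + b) = piK a + piK b;
  frob_retractM : forall a b, piK (a ^+ p * b) = a * piK b;
  frob_retract1 : piK 1 = 1 }.

Section Trace.
Variables (K : fieldType) (p : nat) (piK : K -> K) (N : nat).
Hypotheses (pK : p \in [pchar K]) (HpiK : frob_retract p piK).
Local Notation S := {mpoly K[N]}.
Implicit Types (f g h : S) (m u v : 'X_{1..N}).

Definition top_mnm : 'X_{1..N} := [multinom p.-1 | _ < N].
Definition ones_mnm : 'X_{1..N} := [multinom 1%N | _ < N].

Definition trace_index u : 'X_{1..N} := (u *+ p + top_mnm)%MM.

(** The bound [msize h] only makes the sum finite: [trace_index u] has at least the degree of [u],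
    so the omitted coefficients vanish. *)
Definition trace h : S :=
  \sum_(u : 'X_{1..N < msize h}) piK h@_(trace_index u) *: 'X_[u].

Let p_gt1 : (1 < p)%N. Proof. by case/andP: pK => /prime_gt1. Qed.

Lemma frob_retract0 : piK 0 = 0.
Proof. by apply: (addIr (piK 0)); rewrite -(frob_retractD HpiK) !add0r. Qed.

Lemma mcoeff_trace h u : (trace h)@_u = piK h@_(trace_index u).
Proof.
have [lt|ge] := ltnP (mdeg u) (msize h); first by rewrite (mcoeff_mpoly (fun u => piK h@_(trace_index u))).
rewrite [in RHS]memN_msupp_eq0 ?frob_retract0; last first.
  apply: msize_mdeg_ge; apply: leq_trans ge _.
  rewrite mdegD mdegMn; nia.
rewrite raddf_sum big1 // => -[v lt] _ /=.
rewrite mcoeffZ mcoeffX; case: eqP => [e|_]; last by rewrite mulr0.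
by move: lt; rewrite /= e ltnNge ge.
Qed.

Lemma traceD f g : trace (f + g) = trace f + trace g.
Proof.
by apply/mpolyP => u; rewrite mcoeffD !mcoeff_trace mcoeffD (frob_retractD HpiK).
Qed.

Lemma trace0 : trace 0 = 0.
Proof. by apply: (addIr (trace 0)); rewrite -traceD !add0r. Qed.

Lemma pchar_mpoly : p \in [pchar S].
Proof. exact: (rmorph_pchar (mpolyC N (R:=K)) pK). Qed.

Lemma mpoly_exp_pchar f : f ^+ p = \sum_(m <- msupp f) f@_m ^+ p *: 'X_[m *+ p].
Proof.
rewrite -(pFrobenius_autE pchar_mpoly) {1}(mpolyE f) raddf_sum.
by apply: eq_bigr => m _; rewrite /= pFrobenius_autE exprZn mpolyXn.
Qed.

Lemma lepm_trace_index v u : (v *+ p <= trace_index u)%MM = (v <= u)%MM.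
Proof.
apply/mnm_lepP/mnm_lepP => H i; move: (H i); rewrite mnmDE !mulmnE mnmE; nia.
Qed.

Lemma trace_indexB u v : (v <= u)%MM -> (trace_index u - v *+ p)%MM = trace_index (u - v).
Proof.
move/mnm_lepP => H; apply/mnmP => i; move: (H i).
rewrite mnmBE !mnmDE !mulmnE mnmBE; nia.
Qed.

Lemma traceM f h : trace (f ^+ p * h) = f * trace h.
Proof.
apply/mpolyP => u; rewrite mcoeff_trace mpoly_exp_pchar [in RHS](mpolyE f).
rewrite !mulr_suml !raddf_sum /= (big_morph piK (frob_retractD HpiK) frob_retract0).
apply: eq_bigr => m _; rewrite -!scalerAl !mcoeffZ !mcoeffXM lepm_trace_index.
case: ifP => [mu|_]; last by rewrite mulr0 frob_retract0 mulr0.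
by rewrite (frob_retractM HpiK) mcoeff_trace trace_indexB.
Qed.

Section Compat.
Variable F : S.
Definition psi h := trace (F * h).

Lemma psiD f g : psi (f + g) = psi f + psi g.
Proof. by rewrite /psi mulrDr traceD. Qed.

Lemma psiM f h : psi (f ^+ p * h) = f * psi h.
Proof. by rewrite /psi mulrCA traceM. Qed.

Lemma psi0 : psi 0 = 0. Proof. by rewrite /psi mulr0 trace0. Qed.

Definition compat (I : S -> Prop) := is_ideal I /\ forall h, I h -> I (psi h).

Lemma compat0 : compat (fun h => h = 0).
Proof.
split; last by move=> h ->; apply: psi0.
by split=> // [u v -> ->|a u ->]; rewrite ?addr0 ?mulr0.
Qed.

Lemma compat_add I J : compat I -> compat J -> compat (ideal_add I J).
Proof.
move=> [iI cI] [iJ cJ]; split; first exact: ideal_add_ideal.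
move=> _ [i [j [Ii Jj ->]]]; exists (psi i), (psi j).
by rewrite psiD; split=> //; [apply: cI|apply: cJ].
Qed.

Lemma compat_and I J : compat I -> compat J -> compat (fun h => I h /\ J h).
Proof.
move=> [iI cI] [iJ cJ]; split; last by move=> h [/cI ? /cJ ?].
split; first by split; apply: ideal0.
  by move=> u v [? ?] [? ?]; split; apply: idealD.
by move=> a u [? ?]; split; apply: idealM.
Qed.

(** g psi(h) = psi(g^p h), and g^p h = g^(p-1) (h g) lies in [I] when h g does. *)
Lemma compat_colon I (G : S -> Prop) : compat I ->
  compat (fun h => forall g, G g -> I (h * g)).
Proof.
move=> [iI cI]; split.
  split; first by move=> g _; rewrite mul0r; apply: ideal0.
    by move=> u v Hu Hv g Gg; rewrite mulrDl; apply: idealD; [|exact: Hu|exact: Hv].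
  by move=> a u Hu g Gg; rewrite -mulrA; apply: idealM => //; apply: Hu.
move=> h Hh g Gg; rewrite mulrC -psiM; apply: cI.
rewrite (_ : g ^+ p * h = g ^+ p.-1 * (h * g)); first by apply: idealM => //; apply: Hh.
by rewrite -{1}(prednK (ltnW p_gt1)) exprSr -mulrA [g * h]mulrC.
Qed.

End Compat.

Section Order.
Variables (le : rel 'X_{1..N}) (f : S).
Hypotheses (Hle : term_order le) (Hf : monic_at le f ones_mnm).
Let F := f ^+ p.-1.
Local Notation psi := (psi F).
Local Notation compat := (compat F).
Local Notation monic := (monic_at le).
Local Notation inI := (@initial_in K N le).

Lemma monic_at_top : monic F top_mnm.
Proof.
suff -> : top_mnm = (ones_mnm *+ p.-1)%MM by apply: monic_at_exp.
by apply/mnmP => i; rewrite mulmnE !mnmE mul1n.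
Qed.

Lemma tle_mulm u v : le u v -> le (u *+ p)%MM (v *+ p)%MM.
Proof.
move=> uv; elim: p => [|n IH]; first by rewrite !mulm0n tle_refl.
by rewrite !mulmS; apply: tle_add.
Qed.

Lemma trace_index_le u v : le (trace_index u) (trace_index v) -> le u v.
Proof.
rewrite /trace_index ![(_ + top_mnm)%MM]addmC => /(tle_add2lI Hle) H.
case/orP: (tle_total Hle u v) => // vu; have /(tle_eq Hle H) e := tle_mulm vu.
suff -> : u = v by apply: tle_refl.
by apply/mnmP => i; move/mnmP/(_ i): e; rewrite !mulmnE; nia.
Qed.

Lemma monic_at_psi h w : monic h (w *+ p)%MM -> monic (psi h) w.
Proof.
move=> Hh; have [c H] := monic_atM Hle monic_at_top Hh.
have e : (top_mnm + w *+ p)%MM = trace_index w by rewrite addmC.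
rewrite e in c H; split; first by rewrite mcoeff_trace c (frob_retract1 HpiK).
move=> m; rewrite mcoeff_trace => nz; apply: trace_index_le; apply: H.
by apply: contraNneq nz => ->; rewrite frob_retract0.
Qed.

Lemma psi1 : psi 1 = 1.
Proof.
have H : monic (1 : S) (0 *+ p)%MM.
  suff -> : (0 *+ p = 0 :> 'X_{1..N})%MM by apply: monic_at1.
  by apply/mnmP => i; rewrite mulmnE mnm0E.
have [c l] := monic_at_psi H; apply/mpolyP => m; rewrite mcoeff1.
case: eqP => [->|ne] //; apply/eqP; apply/negPn/negP => /l.
by move=> /(tle_eq Hle) /(_ (tle0 Hle m)).
Qed.

Lemma psi_exp g : psi (g ^+ p) = g.
Proof. by rewrite -[g ^+ p]mulr1 psiM psi1 mulr1. Qed.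

(** Since psi(g^p) = g, stability removes p-th powers one at a time; the exponent is first raised to
    a power of p. *)
Lemma compat_radical I : compat I -> forall g n, I (g ^+ n) -> I g.
Proof.
move=> [iI cI] g n; have [k lt] : exists k, (n <= p ^ k)%N.
  by exists n; apply/ltnW/ltn_expl.
move=> Ig; have {Ig lt} : I (g ^+ (p ^ k)).
  by rewrite -(subnK lt) exprD; apply: idealM.
elim: k => [|k IH]; first by rewrite expn0 expr1.
by rewrite expnSr exprM => /cI; rewrite psi_exp.
Qed.

Lemma initial_in_up I m u : is_ideal I -> inI I m -> inI I (m + u)%MM.
Proof.
move=> iI [h Ih hm]; exists (h * 'X_[u]); first exact: idealMr.
by apply: monic_atM => //; apply: monic_atX.
Qed.

Lemma initial_in_le I m u : is_ideal I -> inI I m -> (m <= u)%MM -> inI I u.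
Proof. by move=> iI H /submK <-; rewrite addmC; apply: initial_in_up. Qed.

Lemma initial_in_root I m : compat I -> inI I (m *+ p)%MM -> inI I m.
Proof. by move=> [iI cI] [h Ih /monic_at_psi hm]; exists (psi h) => //; apply: cI. Qed.

(** If i and j have the initial monomial m, then i j^(p-1) lies in both ideals and has the initial
    monomial m^p, of which psi takes the root. *)
Lemma initial_in_and I J m : compat I -> compat J -> inI I m -> inI J m ->
  inI (fun h => I h /\ J h) m.
Proof.
move=> cI cJ [i Ii im] [j Jj jm].
apply: (initial_in_root (compat_and cI cJ)).
have [iI _] := cI; have [iJ _] := cJ.
exists (i * j ^+ p.-1).
  split; first exact: idealMr.
  apply: idealM => //; rewrite (_ : p.-1 = (p.-2).+1); last by move: p_gt1; lia.
  by rewrite exprS; apply: idealMr.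
have -> : (m *+ p = m + m *+ p.-1)%MM by rewrite -mulmS prednK // ltnW.
by apply: monic_atM => //; apply: monic_at_exp.
Qed.

Hypothesis wf_le : well_founded (fun u v => le u v && (u != v)).

Lemma initial_in_scale (I : S -> Prop) h u : is_ideal I -> I h -> h@_u != 0 ->
  (forall m, h@_m != 0 -> le m u) -> inI I u.
Proof.
move=> iI Ih hu H; exists ((h@_u)^-1 *: h); first by rewrite -mul_mpolyC; apply: idealM.
split; first by rewrite mcoeffZ mulVf.
by move=> m; rewrite mcoeffZ mulf_eq0 negb_or => /andP[_ /H].
Qed.

(** The bound [M] is the larger of the two initial monomials; the hypothesis only excludes that both
    polynomials vanish. *)
Lemma exists_common_lead (i j : S) m : (i + j)@_m != 0 -> exists M,
  [/\ i@_M != 0 \/ j@_M != 0, forall u, i@_u != 0 -> le u M & forall u, j@_u != 0 -> le u M].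
Proof.
move=> nz; have [i0|i0] := eqVneq i 0.
  have j0 : j != 0 by apply: contraNneq nz => ->; rewrite i0 addr0 mcoeff0.
  exists (init_mon le j); split; [by right; apply: init_mon_supp| |by apply: init_mon_max].
  by move=> u; rewrite i0 mcoeff0 eqxx.
have [j0|j0] := eqVneq j 0.
  exists (init_mon le i); split; [by left; apply: init_mon_supp|by apply: init_mon_max|].
  by move=> u; rewrite j0 mcoeff0 eqxx.
case/orP: (tle_total Hle (init_mon le i) (init_mon le j)) => l.
  exists (init_mon le j); split=> [|u /(init_mon_max Hle) H|u /(init_mon_max Hle)] //.
    by right; apply: init_mon_supp.
  by apply: (tle_trans Hle) l.
exists (init_mon le i); split=> [|u /(init_mon_max Hle)|u /(init_mon_max Hle) H] //.
  by left; apply: init_mon_supp.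
by apply: (tle_trans Hle) l.
Qed.

(** Induction on a common bound M of the two summands. If their terms at M cancel, M is initial in
    both ideals, hence in their intersection by [initial_in_and]. A multiple of an element q of the
    intersection, moved from one summand to the other, removes M from both without changing the
    sum. *)
Lemma initial_in_add I J m : compat I -> compat J ->
  inI (ideal_add I J) m -> inI I m \/ inI J m.
Proof.
move=> cI cJ [h [i [j [Ii Jj ->]]] hm]; have [iI _] := cI; have [iJ _] := cJ.
have nz : (i + j)@_m != 0 by rewrite hm.1 oner_neq0.
have [M HM] := exists_common_lead nz.
move: i j Ii Jj hm nz HM; elim/(well_founded_ind wf_le): M => M IH i j Ii Jj hm nz [nM iM jM].
have mM : le m M.
  move: nz; rewrite mcoeffD; have [->|/iM //] := eqVneq (i@_m) 0.
  by rewrite add0r => /jM.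
have [e|n] := eqVneq ((i + j)@_M) 0; last first.
  rewrite (tle_eq Hle mM (hm.2 _ n)).
  by case: nM => nM; [left; apply: initial_in_scale Ii nM iM|right; apply: initial_in_scale Jj nM jM].
have ej : j@_M = - i@_M by apply/eqP; rewrite eq_sym eqr_oppLR -subr_eq0 opprK -mcoeffD e.
have ni : i@_M != 0 by case: nM => //; rewrite ej oppr_eq0.
have nj : j@_M != 0 by rewrite ej oppr_eq0.
have [q [Iq Jq] qM] : inI (fun h => I h /\ J h) M.
  by apply: initial_in_and => //; [apply: initial_in_scale Ii ni iM|apply: initial_in_scale Jj nj jM].
pose c := (i@_M)%:MP : S.
have hE : (i - c * q) + (j + c * q) = i + j by rewrite addrACA addNr addr0.
have iq u : (i - c * q)@_u != 0 -> le u M /\ u <> M.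
  move=> H; split; last by move=> eu; move: H; rewrite eu mcoeffB mcoeffCM qM.1 mulr1 subrr eqxx.
  have [e'|/iM //] := eqVneq (i@_u) 0.
  apply: qM.2; apply: contraNneq H => e2.
  by rewrite mcoeffB mcoeffCM e' e2 mulr0 subr0.
have jq u : (j + c * q)@_u != 0 -> le u M /\ u <> M.
  move=> H; split; last by move=> eu; move: H; rewrite eu mcoeffD mcoeffCM qM.1 mulr1 ej addNr eqxx.
  have [e'|/jM //] := eqVneq (j@_u) 0.
  apply: qM.2; apply: contraNneq H => e2.
  by rewrite mcoeffD mcoeffCM e' e2 mulr0 addr0.
rewrite -hE in hm nz.
have [M' HM'] := exists_common_lead nz.
apply: (IH M' _ (i - c * q) (j + c * q)) => //.
- have [l n] : le M' M /\ M' <> M by case: HM' => [[/iq|/jq]].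
  by rewrite l; apply/eqP.
- by apply: idealB => //; apply: idealM.
- by apply: idealD => //; apply: idealM.
Qed.

Lemma initial_in_principal g u m : monic g u -> inI (ideal_principal g) m -> (u <= m)%MM.
Proof.
move=> gu [_ [q ->] hm].
have q0 : q != 0 by apply: contraTneq (monic_at_neq0 hm) => ->; rewrite mul0r eqxx.
have nq := init_mon_supp le q0.
have : (q * g)@_(init_mon le q + u) != 0.
  by rewrite (mcoeffM_lead Hle (init_mon_max Hle (f:=q)) gu.2) gu.1 mulr1.
move/hm.2 => l; have : (q * g)@_m != 0 by rewrite hm.1 oner_neq0.
move/mcoeffM_neq0 => [a [b [/(init_mon_max Hle) la /gu.2 lb e]]].
have /(tle_eq Hle l) <- : le m (init_mon le q + u)%MM by rewrite e; apply: tle_add.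
exact: lem_addl.
Qed.

(** With f = q g, the product f^(p-1) h g equals g^p q^(p-1) h, and the factor g^p leaves the trace
    as g. *)
Lemma compat_principal g q : f = q * g -> compat (ideal_principal g).
Proof.
move=> fE; split; first exact: ideal_principal_ideal.
move=> _ [h ->]; exists (trace (q ^+ p.-1 * h)).
rewrite [RHS]mulrC -traceM; congr trace.
by rewrite /F fE exprMn -{3}(prednK (ltnW p_gt1)) exprSr mulrACA mulrC.
Qed.

End Order.
End Trace.

(** * Minors *)

(** A zero column and a zero row make the factors square without changing their product. *)
Lemma det_mulmx_thin (R : comNzRingType) t (P : 'M[R]_(t.+1, t)) (Q : 'M[R]_(t, t.+1)) :
  \det (P *m Q) = 0.
Proof.
have -> : P *m Q = (row_mx (0 : 'cV_t.+1) P : 'M_(1 + t)) *m col_mx (0 : 'rV_t.+1) Q.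
  by rewrite mul_row_col mul0mx add0r.
have z : \det (row_mx (0 : 'cV_t.+1) P : 'M_(1 + t)) = 0.
  rewrite (expand_det_col _ (lshift t ord0)) big1 // => i _.
  by rewrite row_mxEl mxE mul0r.
by rewrite (det_mulmx (row_mx (0 : 'cV_t.+1) P : 'M_(1 + t))) z mul0r.
Qed.

Section Minors.
Variables (R : comNzRingType) (X : nat -> nat -> R).
Implicit Types a b : nat -> nat.

Definition gminor t a b : R := \det (\matrix_(i < t, j < t) X (a i) (b j)).

Lemma eq_gminor t a b a' b' :
  (forall k, (k < t)%N -> a k = a' k) -> (forall k, (k < t)%N -> b k = b' k) ->
  gminor t a b = gminor t a' b'.
Proof.
by move=> Ha Hb; congr determinant; apply/matrixP => i j; rewrite !mxE Ha ?Hb.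
Qed.

Lemma gminor_eq_rows t a b i j : (i < j < t)%N -> a i = a j -> gminor t a b = 0.
Proof.
case/andP=> ij jt e.
have it := ltn_trans ij jt.
apply: (@determinant_alternate _ _ _ (Ordinal it) (Ordinal jt)).
  by rewrite -val_eqE /=; lia.
by move=> k; rewrite !mxE /= e.
Qed.

Lemma gminor_eq_cols t a b i j : (i < j < t)%N -> b i = b j -> gminor t a b = 0.
Proof.
case/andP=> ij jt e; rewrite /gminor -det_tr.
have it := ltn_trans ij jt.
apply: (@determinant_alternate _ _ _ (Ordinal it) (Ordinal jt)).
  by rewrite -val_eqE /=; lia.
by move=> k; rewrite !mxE /= e.
Qed.

Lemma gminor_narrow t a b c e : (0 < t)%N -> (e < c + t)%N ->
  (forall k, (k < t)%N -> (c <= b k < e)%N) -> gminor t a b = 0.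
Proof.
move=> t0 lt H; have /injectivePn[x [y ne exy]] : ~~ injectiveb (fun k : 'I_t => inord (b k - c) : 'I_(e - c).-1.+1).
  apply/negP => /injectiveP /leq_card; rewrite !card_ord.
  by move: (H 0%N t0); lia.
have {}exy : b x = b y.
  move/(congr1 (@nat_of_ord _)): exy; move: (H x (ltn_ord x)) (H y (ltn_ord y)) => hx hy.
  by rewrite !inordK; lia.
have ne' : nat_of_ord x != y by [].
case: (ltngtP x y) ne' => // l _.
  by apply: (@gminor_eq_cols _ _ _ x y) => //; rewrite l ltn_ord.
by apply: (@gminor_eq_cols _ _ _ y x) => //; rewrite l ltn_ord.
Qed.

Definition scons (x : nat) a : nat -> nat := fun k => if k is k'.+1 then a k' else x.

(** The cofactors along the first row do not involve that row, so one family [c] serves every [i'];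
    the argument [i] only fixes the matrix they are read from. *)
Lemma gminor_cons t a b (i v : nat) : exists c : 'I_t -> R,
  forall i', gminor t.+1 (scons i' a) (scons v b) =
    X i' v * gminor t a b + \sum_(j < t) X i' (b j) * c j.
Proof.
pose M i' := \matrix_(k < t.+1, l < t.+1) X (scons i' a k) (scons v b l).
exists (fun j => cofactor (M i) ord0 (lift ord0 j)) => i'.
rewrite /gminor (expand_det_row _ ord0) big_ord_recl !mxE /=; congr (_ * _ + _).
  rewrite /cofactor expr0 mul1r; congr determinant.
  by apply/matrixP => k l; rewrite !mxE.
apply: eq_bigr => j _; rewrite !mxE /=; congr (_ * _).
rewrite /cofactor; congr (_ * \det _); apply/matrixP => k l.
by rewrite !mxE.
Qed.

(** Modulo [I], the vanishing of the bordered minors writes g X_{iv} as a combination of the t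
    entries X_{i,b_j}, with coefficients independent of i. Hence g times the larger matrix factors,
    modulo [I], through dimension t, and its determinant vanishes there. *)
Lemma gminor_ideal_rank (I : R -> Prop) (Q V : nat -> Prop) t a b a' b' :
  is_ideal I ->
  (forall i v, Q i -> V v -> I (gminor t.+1 (scons i a) (scons v b))) ->
  (forall k, (k <= t)%N -> Q (a' k)) -> (forall k, (k <= t)%N -> V (b' k)) ->
  I (gminor t a b ^+ t.+1 * gminor t.+1 a' b').
Proof.
move=> iI H Ha Hb; set g := gminor t a b.
have /choice[c Hc] : forall v, exists c : 'I_t -> R,
  forall i', gminor t.+1 (scons i' a) (scons v b) =
    X i' v * g + \sum_(j < t) X i' (b j) * c j.
  by move=> v; apply: gminor_cons.
pose P : 'M_(t.+1, t) := \matrix_(i, j) X (a' i) (b j).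
pose C : 'M_(t, t.+1) := \matrix_(j, k) - c (b' k) j.
have -> : g ^+ t.+1 * gminor t.+1 a' b' =
    \det (g *: \matrix_(i < t.+1, j < t.+1) X (a' i) (b' j)) - \det (P *m C).
  by rewrite detZ det_mulmx_thin subr0.
apply: ideal_cong_det => // i j; rewrite !mxE.
rewrite (_ : \sum_k _ = - \sum_(k < t) X (a' i) (b k) * c (b' j) k); last first.
  by rewrite -sumrN; apply: eq_bigr => k _; rewrite !mxE mulrN.
rewrite opprK mulrC -Hc.
by apply: H; [apply: Ha|apply: Hb]; rewrite -ltnS.
Qed.

(** The Laplace expansion removes the last column each time, so that only the first [t] columns have
    to satisfy [V]. *)
Lemma gminor_ideal_up (I : R -> Prop) (Q V : nat -> Prop) t s a b :
  is_ideal I ->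
  (forall a b, (forall k, (k < t)%N -> Q (a k)) ->
    (forall k, (k < t)%N -> V (b k)) -> I (gminor t a b)) ->
  (t <= s)%N -> (forall k, (k < s)%N -> Q (a k)) ->
  (forall k, (k < t)%N -> V (b k)) -> I (gminor s a b).
Proof.
move=> iI H; elim: s a => [|s IH] a ts Ha Hb.
  by move: ts; rewrite leqn0 => /eqP t0; rewrite -t0 in H *; apply: H => k; rewrite t0.
move: ts; rewrite leq_eqVlt => /orP[/eqP e|ts]; first by rewrite -e in Ha *; apply: H.
rewrite /gminor (expand_det_col _ ord_max); apply: ideal_sum => // i _.
apply: idealM => //; rewrite /cofactor; apply: idealM => //.
rewrite (_ : \det _ = gminor s (fun k => a (bump i k)) b); last first.
  congr determinant; apply/matrixP => k l; rewrite !mxE /=.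
  by congr (X _ (b _)); rewrite /bump leqNgt ltn_ord.
by apply: IH => // k ks; apply: Ha; rewrite ltnS /bump; case: (leqP i k) => _; rewrite ?add1n ?add0n //; apply: ltnW.
Qed.

Lemma gminor_perm_rows t (s : 'S_t) a b a' :
  (forall k : 'I_t, a' k = a (s k)) -> gminor t a' b = (-1) ^+ s * gminor t a b.
Proof.
move=> H; rewrite /gminor; set M := \matrix_(i, j) _.
set M' := \matrix_(i, j) X (a i) _.
have -> : M = row_perm s M' by apply/matrixP => i j; rewrite !mxE H.
by rewrite row_permE det_mulmx det_perm.
Qed.

Lemma gminor_perm_cols t (s : 'S_t) a b b' :
  (forall k : 'I_t, b' k = b (s k)) -> gminor t a b' = (-1) ^+ s * gminor t a b.
Proof.
move=> H; rewrite /gminor; set M := \matrix_(i, j) _.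
set M' := \matrix_(i, j) X _ (b j).
have -> : M = col_perm s M' by apply/matrixP => i j; rewrite !mxE H.
by rewrite col_permE det_mulmx det_perm odd_permV mulrC.
Qed.

End Minors.

(** * Chains of boxes *)

Ltac blia := simpl Equality.sort in *; lia.

Section Boxes.
Local Open Scope nat_scope.

(** A box is a pair (row, column). Chains for this relation are exactly the diagonals of minors. *)
Definition box_lt (x y : nat * nat) : bool := (x.1 < y.1) && (x.2 < y.2).

Definition is_chain (B : pred (nat * nat)) (t c e : nat) (s : seq (nat * nat)) : Prop :=
  [/\ size s = t, pairwise box_lt s & all (fun x => B x && (c <= x.2 < e)) s].

Definition has_chain B t c e : Prop := exists s, is_chain B t c e s.

Lemma last_or_none (P : pred nat) n :
  (forall i, i < n -> ~~ P i) \/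
  exists i, [/\ i < n, P i & forall j, i < j < n -> ~~ P j].
Proof.
elim: n => [|n [IH|[i [lt Pi H]]]]; first by left.
  have [Pn|nPn] := boolP (P n); last first.
    by left=> i; rewrite ltnS leq_eqVlt => /orP[/eqP->|/IH].
  by right; exists n; split=> // j; blia.
have [Pn|nPn] := boolP (P n).
  by right; exists n; split=> // j; blia.
right; exists i; split=> // [|j /andP[ij]]; first by blia.
by rewrite ltnS leq_eqVlt => /orP[/eqP->|jn] //; apply: H; rewrite ij.
Qed.

Lemma exists_min_nat (P : nat -> Prop) n : P n ->
  exists m, P m /\ forall k, P k -> m <= k.
Proof.
move=> Pn; have ex : exists n, `[< P n >] by exists n; apply/asboolP.
exists (ex_minn ex); case: ex_minnP => m /asboolP Pm H.
by split=> // k /asboolP /H.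
Qed.

Section Chains.
Implicit Types (s : seq (nat * nat)) (B : pred (nat * nat)).
Local Notation nths s k := (nth (0, 0) s k).

Lemma box_lt_pairwise s i j : pairwise box_lt s -> i < j < size s ->
  box_lt (nths s i) (nths s j).
Proof.
move=> /(pairwiseP (0, 0)) H /andP[ij js].
by apply: H => //; rewrite inE //; apply: ltn_trans js.
Qed.

Lemma chain_gap s i j : pairwise box_lt s -> i <= j < size s ->
  (nths s i).1 + (j - i) <= (nths s j).1 /\ (nths s i).2 + (j - i) <= (nths s j).2.
Proof.
move=> H; elim: j => [|j IH] /andP[ij js].
  by have -> : i = 0%N by [blia]; rewrite subnn !addn0.
move: ij; rewrite leq_eqVlt => /orP[/eqP->|ij]; first by rewrite subnn !addn0.
have /IH[a b] : i <= j < size s by blia.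
have /(box_lt_pairwise H) /andP[] : j < j.+1 < size s by blia.
by blia.
Qed.

Lemma has_chain_take B t t' c e s : t' <= t -> is_chain B t c e s -> has_chain B t' c e.
Proof.
move=> le [sz pw al]; exists (take t' s); split.
- by rewrite size_take sz; case: ltnP => //; blia.
- by move: pw; rewrite -{1}(cat_take_drop t' s) pairwise_cat => /and3P[].
- by move: al; rewrite -{1}(cat_take_drop t' s) all_cat => /andP[].
Qed.

Lemma is_chain_nth B t c e s k : is_chain B t c e s -> k < t ->
  B (nths s k) && (c <= (nths s k).2 < e).
Proof. by case=> sz _ /allP H kt; apply: H; apply: mem_nth; rewrite sz. Qed.

Lemma pairwise_splice s1 s2 n : pairwise box_lt s1 -> pairwise box_lt s2 ->
  (forall x k, x \in s1 -> n <= k < size s2 -> box_lt x (nths s2 k)) ->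
  pairwise box_lt (s1 ++ drop n s2).
Proof.
move=> p1 p2 H; rewrite pairwise_cat p1 /=; apply/andP; split; last first.
  by move: p2; rewrite -{1}(cat_take_drop n s2) pairwise_cat => /and3P[].
apply/allrelP => x y xs /(nthP (0, 0))[k]; rewrite size_drop => ks <-.
rewrite nth_drop; apply: H => //; rewrite leq_addr -ltn_subRL; exact: ks.
Qed.

(* The position of the added box in row [k] is the leftmost one that either
   already carries a [k]-chain of [B] up to row [k] or leaves no room to its
   right for a longer chain. *)
Lemma chain_free_extension B d t c e : 0 < t <= d -> c + t <= e ->
  ~ has_chain B t c e ->
  exists s0, [/\ size s0 = t.-1, pairwise box_lt s0,
    all (fun x => (0 < x.1 < d) && (c <= x.2 < e)) s0 &
    ~ has_chain (fun x => B x || (x \in s0)) t c e].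
Proof.
move=> /andP[t0 td] cte noB.
pose hc k j := exists s, [/\ size s = k, pairwise box_lt s &
   all (fun x => [&& B x, x.1 <= k & c <= x.2 <= j]) s].
have /choice[l Hl] : forall k, exists m, (m = e - t + k \/ hc k m) /\
    forall j, (j = e - t + k \/ hc k j) -> m <= j.
  by move=> k; apply: (@exists_min_nat _ (e - t + k)); left.
have lmax k : l k <= e - t + k by apply: (Hl k).2; left.
have lge k : 0 < k -> c <= l k.
  move=> k0; case: (Hl k).1 => [->|[s [sz _ al]]]; first blia.
  by move: sz al; case: s => [|x s] //=; [blia|move=> _ /andP[/and3P[_ _ ?] _]; blia].
have linc k : 0 < k -> l k < l k.+1.
  move=> k0; case: (Hl k.+1).1 => [->|[s [sz pw al]]]; first by move: (lmax k); blia.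
  case/lastP: s sz pw al => // s x; rewrite size_rcons => -[sz].
  rewrite pairwise_rcons all_rcons => /andP[/allP sx pw] /andP[/and3P[Bx x1 x2] al].
  have x0 : 0 < x.2.
    by move: sz sx; case: s {pw al} => [|y s] /=; [by move=> e0; move: k0; rewrite -e0|move=> _ /(_ y (mem_head _ _)) /andP[]; blia].
  suff : l k <= x.2.-1 by blia.
  apply: (Hl k).2; right; exists s; split=> //.
  apply/allP => y ys; move/allP: al => /(_ y ys) /and3P[-> _ cy] /=.
  by have /andP[] := sx y ys; blia.
have lmono i j : 0 < i -> i < j -> l i < l j.
  move=> i0; elim: j => // j IH; rewrite ltnS leq_eqVlt => /orP[/eqP<-|/[dup] ij /IH H].
    exact: linc.
  by apply: ltn_trans H _; apply: linc; blia.
pose s0 := [seq (k, l k) | k <- iota 1 t.-1].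
have s0P x : x \in s0 -> x = (x.1, l x.1) /\ 0 < x.1 < t.
  by move=> /mapP[k]; rewrite mem_iota => H -> /=; split=> //; blia.
exists s0; split.
- by rewrite size_map size_iota.
- apply/(pairwiseP (0, 0)) => i j; rewrite !inE size_map size_iota => it jt ij.
  rewrite !(nth_map 0) ?size_iota // !nth_iota //; rewrite /box_lt /=.
  by rewrite lmono ?andbT; blia.
- apply/allP => x /s0P[-> /= /andP[x0 xt]].
  by have := lmax x.1; have := lge _ x0; blia.
case=> s hs; have [sz pw _] := hs.
have nz q : q < t -> ~~ B (nths s q) -> nths s q \in s0.
  by move=> /(is_chain_nth hs) /andP[/orP[->|]].
(* If no added box precedes it, an added box in a row k <= q comes after k boxes of [B] in columns
   smaller than [l k], against the minimality of [l k]. If an added box i precedes it, its row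
   exceeds i by induction, and rows grow along the chain. *)
have Bq q : q < t -> nths s q \in s0 -> q < (nths s q).1.
  elim/ltn_ind: q => q IH qt qs0; have [qE /andP[k0 kt]] := s0P _ qs0.
  case: (last_or_none (fun i => ~~ B (nths s i)) q) => [H|[i [iq nB _]]]; last first.
    have it : i < t by blia.
    have := IH i iq it (nz i it nB); have [] := @chain_gap s i q pw; first by rewrite sz; blia.
    blia.
  rewrite ltnNge; apply/negP => kq; set k := (nths s q).1 in qE k0 kt kq.
  have lq : (nths s q).2 = l k by rewrite qE.
  have l0 : 0 < l k.
    have /andP[_] : box_lt (nths s 0) (nths s q) by apply: box_lt_pairwise => //; rewrite sz; blia.
    by rewrite lq; blia.
  suff : l k <= (l k).-1 by blia.
  apply: (Hl k).2; right; exists (take k s); split.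
  - by rewrite size_takel ?sz //; blia.
  - by move: pw; rewrite -{1}(cat_take_drop k s) pairwise_cat => /and3P[].
  - apply/(all_nthP (0, 0)) => i; rewrite size_takel ?sz => [ik|]; last blia.
    rewrite nth_take //.
    have /negPn -> /= : ~~ ~~ B (nths s i) by apply: H; blia.
    have /andP[a b] : box_lt (nths s i) (nths s q) by apply: box_lt_pairwise => //; blia.
    have /(is_chain_nth hs) /andP[_ c1] : i < t by blia.
    have := @chain_gap s i q pw; rewrite sz lq => /(_ _)[]; first blia.
    move: b; rewrite lq => b e1 e2.
    by rewrite -/k in a e1 *; blia.
case: (last_or_none (fun i => ~~ B (nths s i)) t) => [H|[q [qt nB H]]].
  apply: noB; exists s; split=> //; apply/(all_nthP (0, 0)) => i; rewrite sz => it.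
  by have /negPn -> := H i it; have /andP[_] := is_chain_nth hs it.
have qs0 := nz q qt nB; have [qE /andP[k0 kt]] := s0P _ qs0.
have := Bq q qt qs0; set k := (nths s q).1 in qE k0 kt *; move=> qk.
have lq : (nths s q).2 = l k by rewrite qE.
(* The last added box is at position q, in row k > q. Either too few columns remain for the boxes
   that follow it, or a k-chain of [B] can replace the first q+1 boxes, which leaves a chain of at
   least t boxes of [B]. *)
case: (Hl k).1 => [lE|[s1 [sz1 pw1 al1]]].
  have := @chain_gap s q t.-1 pw; rewrite sz lq => /(_ _)[]; first blia.
  have /(is_chain_nth hs) /andP[_ c1] : t.-1 < t by blia.
  blia.
have /has_chain_take : t <= k + (t - q.+1) by blia.
move=> /(_ B c e (s1 ++ drop q.+1 s)) []; last by move=> s2 hs2; apply: noB; exists s2.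
split.
- by rewrite size_cat sz1 size_drop sz.
- apply: pairwise_splice => // x j xs1 /andP[qj js].
  have /and3P[_ x1 x2] := allP al1 x xs1.
  have /andP[a b] : box_lt (nths s q) (nths s j) by apply: box_lt_pairwise => //; rewrite qj.
  by rewrite -/k in a; rewrite lq in b; rewrite /box_lt; blia.
- rewrite all_cat; apply/andP; split.
    apply/allP => x xs1; have /and3P[-> _ x2] := allP al1 x xs1 => /=.
    by have := is_chain_nth hs qt; rewrite lq; blia.
  apply/(all_nthP (0, 0)) => i; rewrite size_drop sz nth_drop => it.
  have it' : q.+1 + i < t by blia.
  have /negPn -> /= : ~~ ~~ B (nths s (q.+1 + i)) by apply: H; blia.
  by have /andP[_] := is_chain_nth hs it'.
Qed.

(** The diagonal of the d-minor with all rows but [r] and the columns e-d, ..., e-1. *)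
Definition gap_diagonal d e r (x : nat * nat) : bool :=
  [&& x.1 <= d, x.1 != r & x.2 == if x.1 < r then e - d + x.1 else (e - d + x.1).-1].

(* [r] is the first row in which [B] has no chain of full length up to the
   diagonal ending at [(d, e)]. *)
Lemma chain_free_gap B d c e : c + d <= e -> (forall x, B x -> x.1 <= d) ->
  ~ has_chain B d.+1 c e.+1 ->
  exists r, r <= d /\ ~ (exists s,
    [/\ size s = d.+1, pairwise box_lt s,
        all (fun x => (B x || gap_diagonal d e r x) && (c <= x.2)) s &
        forall i, i <= d -> (nths s i).2 <= e - d + i]).
Proof.
move=> cde Bd noB.
pose Q r := exists s, [/\ size s = r.+1, pairwise box_lt s &
   all (fun x => [&& B x, x.1 <= r & c <= x.2 <= e - d + r]) s].
have nQd : ~ Q d.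
  case=> s [sz pw al]; apply: noB; exists s; split=> //.
  by apply/allP => x /(allP al) /and3P[-> _]; blia.
have [r [nQr minr]] := @exists_min_nat (fun r => ~ Q r) d nQd.
exists r; split; first exact: minr.
case=> s [sz pw al bd]; apply: nQr.
have rd : r <= d by apply: minr.
have al' i : i <= d -> (B (nths s i) || gap_diagonal d e r (nths s i)) && (c <= (nths s i).2).
  by move=> id; apply: (allP al); apply: mem_nth; rewrite sz.
have rowd i : i <= d -> (nths s i).1 <= d.
  by move=> /al' /andP[/orP[/Bd|/and3P[]]].
(* A chain of d+1 boxes in rows at most d meets every row. *)
have row i : i <= d -> (nths s i).1 = i.
  move=> id; have [a _] := @chain_gap s 0 i pw ltac:(rewrite sz; blia).
  have [b _] := @chain_gap s i d pw ltac:(rewrite sz; blia).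
  by have := rowd d (leqnn d); blia.
have Br : B (nths s r).
  have /al' /andP[/orP[//|]] := rd.
  by rewrite /gap_diagonal row // eqxx andbF.
case: (last_or_none (fun i => ~~ B (nths s i)) r) => [H|[i [ir nB H]]].
  exists (take r.+1 s); split.
  - by rewrite size_takel ?sz //; blia.
  - by move: pw; rewrite -{1}(cat_take_drop r.+1 s) pairwise_cat => /and3P[].
  apply/(all_nthP (0, 0)) => i; rewrite size_takel ?sz // ltnS => ik.
  rewrite nth_take // row; last blia.
  have -> : B (nths s i).
    by move: ik; rewrite leq_eqVlt => /orP[/eqP->|/H /negPn].
  by have /al' /andP[_ ->] : i <= d by [blia]; have := bd i; blia.
(* By the minimality of [r], row i has a full chain of [B] up to the diagonal. It replaces the part
   of [s] that ends at its last box outside [B] before row [r]. *)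
have Qi : Q i.
  by apply: contrapT => /minr; blia.
have [s1 [sz1 pw1 al1]] := Qi.
have iE : (nths s i).2 = e - d + i.
  have id : i <= d by blia.
  have /al' /andP[] := id; rewrite (negPf nB) /= /gap_diagonal row // ir => /and3P[_ _ /eqP] //.
exists (s1 ++ drop i.+1 (take r.+1 s)).
have szt : size (take r.+1 s) = r.+1 by rewrite size_takel ?sz //; blia.
split.
- rewrite size_cat size_drop szt sz1; blia.
- apply: pairwise_splice => //.
    by move: pw; rewrite -{1}(cat_take_drop r.+1 s) pairwise_cat => /and3P[].
  move=> x k xs1; rewrite szt => /andP[ik kr]; rewrite nth_take //.
  have /and3P[_ x1 x2] := allP al1 x xs1.
  have /andP[a b] : box_lt (nths s i) (nths s k) by apply: box_lt_pairwise => //; rewrite sz; blia.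
  by rewrite row in a; [rewrite /box_lt; blia|blia].
- rewrite all_cat; apply/andP; split.
    by apply/allP => x /(allP al1) /and3P[-> x1 x2] /=; blia.
  apply/(all_nthP (0, 0)) => k; rewrite size_drop szt nth_drop => kr.
  rewrite nth_take; last blia.
  have kd : i.+1 + k <= d by blia.
  rewrite row //; have -> /= : B (nths s (i.+1 + k)).
    have [->//|nr] := eqVneq (i.+1 + k) r.
    by apply/negPn/H; blia.
  by have /al' /andP[_ ->] := kd; have := bd _ kd; blia.
Qed.

End Chains.

End Boxes.

(** * Initial monomials of determinants *)

Section DetLead.
Variables (K : fieldType) (N : nat) (le : rel 'X_{1..N}).
Hypothesis Hle : term_order le.

Lemma monic_at_det t (c : 'I_t -> 'I_t -> bool) (U : 'I_t -> 'I_t -> 'X_{1..N}) :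
  (forall i, c i i) ->
  (forall s : 'S_t, s != 1%g -> (forall i, c i (s i)) ->
     le ((\sum_i U i (s i))%MM) ((\sum_i U i i)%MM) /\
     (\sum_i U i (s i))%MM <> (\sum_i U i i)%MM) ->
  monic_at le (\det (\matrix_(i, j) ((c i j)%:R *: 'X_[U i j] : {mpoly K[N]})))
    ((\sum_i U i i)%MM).
Proof.
move=> c1 H; set M := (\sum_i U i i)%MM.
have term (s : 'S_t) : \prod_i (\matrix_(i, j) ((c i j)%:R *: 'X_[U i j] : {mpoly K[N]})) i (s i) =
   [forall i, c i (s i)]%:R *: 'X_[(\sum_i U i (s i))%MM].
  case: forallP => [cs|/forallP].
    by rewrite scale1r -mprodXE; apply: eq_bigr => i _; rewrite mxE cs scale1r.
  rewrite negb_forall => /existsP[i ci].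
  by rewrite (bigD1 i) //= mxE (negPf ci) !scale0r mul0r.
have coefE m : (\det (\matrix_(i, j) ((c i j)%:R *: 'X_[U i j] : {mpoly K[N]})))@_m =
   \sum_(s : 'S_t) (-1) ^+ s * ([forall i, c i (s i)] && ((\sum_i U i (s i))%MM == m))%:R.
  rewrite /determinant raddf_sum; apply: eq_bigr => s _; rewrite /= term.
  rewrite -[(-1) ^+ s]/(((-1) ^+ s)) -(rmorph_sign (mpolyC N (R:=K))) mcoeffCM mcoeffZ mcoeffX.
  by rewrite -mulnb natrM.
split.
  rewrite coefE (bigD1 (1%g : 'S_t)) //= [X in _ + X]big1 ?addr0.
    rewrite odd_perm1 expr0 mul1r.
    have -> : [forall i, c i ((1%g : 'S_t) i)] by apply/forallP => i; rewrite perm1.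
    by rewrite (eq_bigr (fun i => U i i)) ?eqxx // => i _; rewrite perm1.
  move=> s s1; case: forallP => [cs|]; last by rewrite mulr0.
  by have [_ /eqP/negPf ->] := H s s1 cs; rewrite mulr0.
move=> m; rewrite coefE => nz.
have [s ns] : exists s : 'S_t, [forall i, c i (s i)] && ((\sum_i U i (s i))%MM == m).
  apply/existsP; apply: contraNT nz; rewrite negb_exists => /forallP ns.
  by rewrite big1 // => s _; rewrite (negPf (ns s)) mulr0.
case/andP: ns => /forallP cs /eqP <-.
have [->|s1] := eqVneq s 1%g; last by case: (H s s1 cs).
by rewrite (eq_bigr (fun i => U i i)) ?(tle_refl Hle) // => i _; rewrite perm1.
Qed.

End DetLead.

Section Grid.
Variables (K : fieldType) (N : nat) (le : rel 'X_{1..N}).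
Hypothesis Hle : term_order le.
Variables (d n : nat) (vx : nat -> nat -> 'I_N).
Hypothesis vx_inj : forall i y i' y', (i <= d)%N -> (y < n)%N -> (i' <= d)%N -> (y' < n)%N ->
  vx i y = vx i' y' -> i = i' /\ y = y'.
Local Notation S := {mpoly K[N]}.

Definition diagonal_pairs : Prop := forall i i' y y', (i < i' <= d)%N -> (y < y' < n)%N ->
  le (U_(vx i y') + U_(vx i' y))%MM (U_(vx i y) + U_(vx i' y'))%MM.
Hypothesis Hdiag : diagonal_pairs.

Definition gridX (i y : nat) : S := 'X_(vx i y).
Local Notation gm := (gminor gridX).

Definition diag_mnm t (a b : nat -> nat) : 'X_{1..N} :=
  (\sum_(k < t) U_(vx (a k) (b k)))%MM.

Definition increasing_below t m (a : nat -> nat) : Prop :=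
  (forall k, (k < t)%N -> (a k < m)%N) /\ (forall i j, (i < j < t)%N -> (a i < a j)%N).

(** Let i be the least moved index and j its preimage. Then i < s i and i < j, so the 2-minor
    condition allows the columns of rows i and j to be exchanged; this fixes i and moves fewer
    indices. *)
Lemma perm_uncross t (a b : nat -> nat) (s : 'S_t) :
  increasing_below t d.+1 a -> increasing_below t n b ->
  le (\sum_(i < t) U_(vx (a i) (b (s i))))%MM (diag_mnm t a b).
Proof.
move=> [ad ai] [bn bi]; have [k] := ubnP #|[pred i | s i != i]|.
elim: k s => // k IH s lt.
have [->|s1] := eqVneq s 1%g.
  by rewrite (eq_bigr (fun i : 'I_t => U_(vx (a i) (b i))%MM)) ?(tle_refl Hle) // => i _; rewrite perm1.
have [i0 ni0] : exists i, s i != i.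
  apply/existsP; apply: contraNT s1; rewrite negb_exists => /forallP H.
  by apply/eqP/permP => i; rewrite perm1; apply/eqP/negPn/H.
have [i ni imin] := @arg_minnP _ i0 (fun i => s i != i) (fun i : 'I_t => nat_of_ord i) ni0.
have lti : (i < s i)%N.
  rewrite ltn_neqAle eq_sym ni /= leqNgt; apply/negP => l.
  have e : s (s i) = s i by apply/eqP/negPn/negP => /imin; rewrite leqNgt l.
  by move/perm_inj: e => e; rewrite e eqxx in ni.
pose j := (s^-1)%g i.
have sj : s j = i by rewrite permKV.
have nji : j != i by apply: contraNneq ni => e; rewrite -{1}e sj.
have ltj : (i < j)%N.
  rewrite ltn_neqAle eq_sym nji /=; apply: imin; rewrite sj eq_sym //.
pose s' := (tperm i j * s)%g.
have s'i : s' i = i by rewrite permM tpermL.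
have s'j : s' j = s i by rewrite permM tpermR.
have s'k l : l != i -> l != j -> s' l = s l.
  by move=> li lj; rewrite permM tpermD // eq_sym.
apply: (tle_trans Hle) (IH s' _).
  rewrite (bigD1 i) //= (bigD1 j) //= [X in le _ X](bigD1 i) //= [X in le _ (_ + X)%MM](bigD1 j) //=.
  rewrite s'i s'j sj !addmA; apply: tle_add => //; last first.
    rewrite [X in le _ X](eq_bigr (fun l : 'I_t => U_(vx (a l) (b (s l)))%MM)) ?(tle_refl Hle) //.
    by move=> l /andP[li lj]; rewrite s'k.
  by apply: Hdiag; [rewrite ai ?ltj ?ltn_ord //= -ltnS ad|rewrite bi ?lti ?ltn_ord //= bn].
have : [pred l | s' l != l] \proper [pred l | s l != l].
  apply/properP; split.
    apply/subsetP => l; rewrite !inE; have [->|li] := eqVneq l i; first by rewrite s'i eqxx.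
    by have [->|lj] := eqVneq l j; [move=> _; rewrite sj eq_sym|rewrite s'k].
  by exists i; rewrite !inE ?s'i ?eqxx.
by move/proper_card => l; apply: leq_trans l _.
Qed.

Lemma diag_mnm_neq0 t a b i y : diag_mnm t a b (vx i y) != 0%N ->
  exists2 k, (k < t)%N & vx (a k) (b k) = vx i y.
Proof.
rewrite mnm_sumE sum_nat_eq0 negb_forall => /existsP[k /=].
by rewrite mnm1E eqb0 negbK => /eqP e; exists k.
Qed.

Lemma monic_at_gminor t a b : increasing_below t d.+1 a -> increasing_below t n b ->
  monic_at le (gm t a b) (diag_mnm t a b).
Proof.
move=> Ha Hb; have [ad ai] := Ha; have [bn bi] := Hb.
have -> : gm t a b = \det (\matrix_(i < t, j < t) ((true)%:R *: 'X_[U_(vx (a i) (b j))])).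
  by congr determinant; apply/matrixP => i j; rewrite !mxE scale1r.
apply: monic_at_det => // s s1 _; split; first exact: perm_uncross.
move=> e; move/negP: s1; apply; apply/eqP/permP => i; rewrite perm1.
have : diag_mnm t a b (vx (a i) (b (s i))) != 0%N.
  by rewrite /diag_mnm -e mnm_sumE sum_nat_eq0 negb_forall; apply/existsP; exists i; rewrite /= mnm1E eqxx.
case/diag_mnm_neq0 => k kt; have it := ltn_ord i; have st := ltn_ord (s i).
have inja x y : (x < t)%N -> (y < t)%N -> a x = a y -> x = y.
  by move=> xt yt; case: (ltngtP x y) => // l; [move: (ai x y)|move: (ai y x)]; rewrite l ?xt ?yt => /(_ isT); lia.
have injb x y : (x < t)%N -> (y < t)%N -> b x = b y -> x = y.
  by move=> xt yt; case: (ltngtP x y) => // l; [move: (bi x y)|move: (bi y x)]; rewrite l ?xt ?yt => /(_ isT); lia.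
case/(vx_inj (ad _ kt) (bn _ kt) (ad _ it) (bn _ st)) => /(inja _ _ kt it) -> /(injb _ _ it st) e'.
by apply: val_inj.
Qed.

End Grid.

(** * Ideals of minors of consecutive columns *)

Section FullMinors.
Variables (R : comNzRingType) (X : nat -> nat -> R).

Lemma perm_of_inj t (j : nat) (a : nat -> nat) :
  (forall k, (k < t)%N -> (j <= a k < j + t)%N) ->
  (exists x y, (x < y < t)%N /\ a x = a y) \/
  exists s : 'S_t, forall k : 'I_t, a k = (j + s k)%N.
Proof.
move=> H; case: t H => [|t] H; first by right; exists 1%g => -[].
pose f (k : 'I_t.+1) : 'I_t.+1 := inord (a k - j).
have fE (k : 'I_t.+1) : a k = (j + f k)%N.
  have /andP[h1 h2] := H k (ltn_ord k); rewrite /f inordK; first by rewrite subnKC.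
  by rewrite ltn_subLR.
have [/injectiveP fi|/injectivePn[x [y ne e]]] := boolP (injectiveb f).
  by right; exists (perm fi) => k; rewrite permE.
left; have e' : a x = a y by rewrite !fE e.
have ne' : nat_of_ord x != y by [].
by case: (ltngtP x y) ne' => // l _; [exists x, y|exists y, x]; rewrite l ltn_ord.
Qed.

Lemma gminor_full d j a b :
  (forall k, (k <= d)%N -> (a k <= d)%N) ->
  (forall k, (k <= d)%N -> (j <= b k <= j + d)%N) ->
  exists q, gminor X d.+1 a b = q * gminor X d.+1 id (addn j).
Proof.
move=> Ha Hb.
have [|[x [y [xy e]]]|[s sE]] := @perm_of_inj d.+1 0 a.
- by move=> k kd; rewrite add0n ltnS Ha.
- by exists 0; rewrite mul0r (gminor_eq_rows _ _ xy e).
have [|[x [y [xy e]]]|[s' sE']] := @perm_of_inj d.+1 j b.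
- by move=> k kd; rewrite addnS ltnS Hb.
- by exists 0; rewrite mul0r (gminor_eq_cols _ _ xy e).
exists ((-1) ^+ s * (-1) ^+ s').
by rewrite (@gminor_perm_rows _ _ _ s id) // (@gminor_perm_cols _ _ _ s' _ (addn j)) // mulrA.
Qed.

End FullMinors.

Section RankIdeals.
Variables (K : fieldType) (p : nat) (piK : K -> K) (N : nat).
Hypotheses (pK : p \in [pchar K]) (HpiK : frob_retract p piK).
Variables (le : rel 'X_{1..N}) (d n : nat) (vx : nat -> nat -> 'I_N).
Hypothesis Hle : term_order le.
Hypothesis wf_le : well_founded (fun u v => le u v && (u != v)).
Hypothesis vx_inj : forall i y i' y', (i <= d)%N -> (y < n)%N -> (i' <= d)%N -> (y' < n)%N ->
  vx i y = vx i' y' -> i = i' /\ y = y'.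
Hypothesis Hdiag : diagonal_pairs le d n vx.
Local Notation S := {mpoly K[N]}.
Local Notation gm := (gminor (gridX K vx)).
Variable f : S.
Hypothesis Hf : monic_at le f (ones_mnm N).
Hypothesis f_div : forall j, (j + d < n)%N -> exists q, f = q * gm d.+1 id (addn j).
Local Notation compat := (compat p piK (f ^+ p.-1)).
Local Notation monic := (monic_at le).
Local Notation inI := (@initial_in K N le).

Definition mnm_boxes (m : 'X_{1..N}) : pred (nat * nat) :=
  fun x => [&& x.1 <= d, x.2 < n & m (vx x.1 x.2) != 0%N]%N.

Lemma mnm_boxes_add m t a b x :
  (forall k, (k < t)%N -> (a k <= d)%N) -> (forall k, (k < t)%N -> (b k < n)%N) ->
  mnm_boxes (m + diag_mnm vx t a b)%MM x ->
  mnm_boxes m x \/ exists2 k, (k < t)%N & x = (a k, b k).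
Proof.
move=> Ha Hb /and3P[x1 x2]; rewrite mnmDE addn_eq0 negb_and => /orP[H|].
  by left; rewrite /mnm_boxes x1 x2.
case/diag_mnm_neq0 => k kt e; right; exists k => //.
by have [-> ->] := vx_inj (Ha k kt) (Hb k kt) x1 x2 e; case: x {x1 x2 e}.
Qed.

(** These properties take the place of a description by generators: they are what survives sums and
    colons, and what the final comparison of ideals uses. *)
Definition rank_ideal t c e (P : S -> Prop) : Prop :=
  [/\ compat P,
      forall a b, (forall k, (k < t)%N -> (a k <= d)%N) ->
        (forall k, (k < t)%N -> (c <= b k < e)%N) -> P (gm t a b)
    & forall m, inI P m -> has_chain (mnm_boxes m) t c e].

Lemma rank_ideal_narrow t c e : (0 < t)%N -> (e < c + t)%N -> rank_ideal t c e (fun h => h = 0).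
Proof.
move=> t0 ect; split; first exact: compat0.
  by move=> a b _ Hb; apply: (gminor_narrow _ _ t0 ect).
by move=> m [h -> /monic_at_neq0]; rewrite eqxx.
Qed.

Lemma ideal_expM_radical (I : S -> Prop) g h k : compat I -> I (g ^+ k.+1 * h) -> I (g * h).
Proof.
move=> cI; have [iI _] := cI => H; apply: (compat_radical pK HpiK Hle Hf cI (n := k.+1)).
by rewrite exprMn [h ^+ _]exprSr mulrCA; apply: idealM.
Qed.

(** The new ideal is the colon of [P1 + P2] by the (t+1)-minors of the columns c-1, ..., e. A
    t-minor of the inner columns, bordered by any row and by one of these columns, lies in [P1] or
    in [P2]. By [gminor_ideal_rank], a power of it multiplies all the (t+1)-minors into the sum,
    which is radical. *)
Lemma rank_ideal_step t c e P1 P2 : (0 < t <= d)%N -> (0 < c)%N -> (e < n)%N ->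
  rank_ideal t.+1 c.-1 e P1 -> rank_ideal t.+1 c e.+1 P2 ->
  exists P, rank_ideal t c e P.
Proof.
move=> t0d c0 en [cP1 mP1 lP1] [cP2 mP2 lP2].
have [ect|cte] := ltnP e (c + t)%N.
  by exists (fun h => h = 0); apply: rank_ideal_narrow => //; case/andP: t0d.
pose A := ideal_add P1 P2.
have cA : compat A by apply: compat_add.
have [iP1 _] := cP1; have [iP2 _] := cP2; have [iA _] := cA.
have P1A h : P1 h -> A h by exists h, 0; rewrite addr0; split=> //; apply: ideal0.
have P2A h : P2 h -> A h by exists 0, h; rewrite add0r; split=> //; apply: ideal0.
pose G (g : S) := exists a b, [/\ forall k, (k <= t)%N -> (a k <= d)%N,
  forall k, (k <= t)%N -> (c.-1 <= b k < e.+1)%N & g = gm t.+1 a b].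
exists (fun h => forall g, G g -> A (h * g)); split; first exact: compat_colon.
  move=> a b Ha Hb _ [a' [b' [Ha' Hb' ->]]].
  apply: (@ideal_expM_radical _ _ _ t) => //.
  apply: (gminor_ideal_rank (Q := fun i => (i <= d)%N) (V := fun v => (c.-1 <= v < e.+1)%N)) => //.
  move=> i v id /andP[cv]; rewrite ltnS leq_eqVlt => /orP[/eqP->|ve].
    apply/P2A/mP2; first by case=> // k kt; apply: Ha.
    by case=> [_|k kt] /=; [lia|have := Hb k kt; lia].
  apply/P1A/mP1; first by case=> // k kt; apply: Ha.
  by case=> [_|k kt] /=; [lia|have := Hb k kt; lia].
move=> m [h Hh hm]; apply: contrapT => noB.
have [s0 [sz0 pw0 al0 no0]] := chain_free_extension t0d cte noB.
case/andP: t0d => t0 td.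
(* The test minor adds a corner box on each side of the window. A (t+1)-chain in the product loses
   its first box in the case of [P1], its last one in the case of [P2], and leaves a forbidden
   t-chain of boxes of [m] and [s0]. *)
pose s := (0%N, c.-1) :: rcons s0 (d, e).
have szs : size s = t.+1 by rewrite /= size_rcons sz0; lia.
have pws : pairwise box_lt s.
  rewrite /= all_rcons pairwise_rcons pw0 andbT /box_lt /=; apply/andP; split; [apply/andP; split; first lia|].
    by apply/allP => x /(allP al0) /=; blia.
  by apply/allP => x /(allP al0) /=; blia.
pose a k := (nth (0, 0)%N s k).1; pose b k := (nth (0, 0)%N s k).2.
have inr k : (k < t.+1)%N -> (a k <= d)%N /\ (c.-1 <= b k < e.+1)%N.
  move=> kt; have : nth (0, 0)%N s k \in s by apply: mem_nth; rewrite szs.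
  rewrite inE mem_rcons inE => /or3P[/eqP E|/eqP E|/(allP al0)]; rewrite /a /b ?E /=; last by blia.
    lia.
  lia.
have Ha k : (k < t.+1)%N -> (a k <= d)%N by move/inr => [].
have Hb k : (k < t.+1)%N -> (b k < n)%N by move/inr => [_]; lia.
have inc i j : (i < j < t.+1)%N -> (a i < a j)%N /\ (b i < b j)%N.
  by rewrite -szs => /(box_lt_pairwise pws) /andP[].
have mg : monic (gm t.+1 a b) (diag_mnm vx t.+1 a b).
  by apply: (monic_at_gminor _ _ vx_inj) => //; split=> [k /inr[]|i j /inc[]] //; lia.
have Gg : G (gm t.+1 a b) by exists a, b; split=> // k kt; have [] := inr k kt.
have box x : mnm_boxes (m + diag_mnm vx t.+1 a b)%MM x -> mnm_boxes m x || (x \in s).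
  case/mnm_boxes_add => // [->//|[k kt ->]].
  apply/orP; right; rewrite /a /b -surjective_pairing; apply: mem_nth; by rewrite szs.
have s_in x : x \in s -> (c <= x.2 < e)%N -> x \in s0.
  rewrite inE mem_rcons inE => /or3P[/eqP->|/eqP->|//] /=; lia.
have : inI A (m + diag_mnm vx t.+1 a b)%MM.
  by exists (h * gm t.+1 a b); [apply: Hh|apply: monic_atM].
case/(initial_in_add pK HpiK Hle Hf wf_le cP1 cP2) => [/lP1|/lP2] [s' hs'].
  have [sz' pw' al'] := hs'; apply: no0; exists (behead s'); split.
  - by rewrite size_behead sz'.
  - by case: (s') pw' => //= x q /andP[].
  apply/(all_nthP (0, 0)%N) => k; rewrite size_behead sz' /= => kt.
  rewrite nth_behead; have /(is_chain_nth hs') /andP[/box B1 /andP[_ e1]] : (k.+1 < t.+1)%N by [].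
  have /(is_chain_nth hs') /andP[_ /andP[c1 _]] : (0 < t.+1)%N by [].
  have := @chain_gap s' 0 k.+1 pw'; rewrite sz' => /(_ kt) [_] => H.
  have ce : (c <= (nth (0, 0)%N s' k.+1).2 < e)%N by lia.
  rewrite ce andbT; case/orP: B1 => [->//|/s_in H1]; by rewrite H1 ?orbT.
have [sz' pw' al'] := hs'; apply: no0; exists (take t s'); split.
- by rewrite size_takel ?sz'.
- by move: pw'; rewrite -{1}(cat_take_drop t s') pairwise_cat => /and3P[].
apply/(all_nthP (0, 0)%N) => k; rewrite size_takel ?sz' // => kt; rewrite nth_take //.
have kt' : (k < t.+1)%N by lia.
have /andP[/box B1 /andP[c1 _]] := is_chain_nth hs' kt'.
have /(is_chain_nth hs') /andP[_ /andP[_ e1]] : (t < t.+1)%N by [].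
have := @chain_gap s' k t pw'; rewrite sz' ltnSn andbT => /(_ (ltnW kt)) [_] => H.
have ce : (c <= (nth (0, 0)%N s' k).2 < e)%N by lia.
rewrite ce andbT; case/orP: B1 => [->//|/s_in H1]; by rewrite H1 ?orbT.
Qed.

(** Column e is adjoined by a colon with the d-minors of the columns e-d, ..., e-1. Bordered by
    column e, such a minor is a multiple of [g0], a factor of [f]; bordered by an earlier column of
    the window, it is in the ideal already built. *)
Lemma rank_ideal_base c e : (e <= n)%N -> exists P, rank_ideal d.+1 c e P.
Proof.
elim: e => [|e IH] en; first by exists (fun h => h = 0); apply: rank_ideal_narrow => //; lia.
have [ec|ce] := ltnP e (c + d)%N.
  by exists (fun h => h = 0); apply: rank_ideal_narrow => //; lia.
have [P [cP mP lP]] := IH (ltnW en).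
have ed : (e - d + d = e)%N by lia.
pose g0 := gm d.+1 id (addn (e - d)).
pose A := ideal_add P (ideal_principal g0).
have cF : compat (ideal_principal g0).
  by have [|q fE] := f_div (j := e - d); [rewrite ed|apply: compat_principal fE].
have cA : compat A by apply: compat_add.
have [iP _] := cP; have [iF _] := cF; have [iA _] := cA.
have PA h : P h -> A h by exists h, 0; rewrite addr0; split=> //; apply: ideal0.
have FA q : A (q * g0).
  by exists 0, (q * g0); rewrite add0r; split=> //; [apply: ideal0|exists q].
pose G (g : S) := exists2 r, (r <= d)%N & g = gm d (bump r) (addn (e - d)).
have bumpd r k : (k < d)%N -> (bump r k <= d)%N by rewrite /bump; case: (leqP r k); lia.
exists (fun h => forall g, G g -> A (h * g)); split; first exact: compat_colon.
  move=> a b Ha Hb _ [r rd ->]; rewrite mulrC.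
  apply: (@ideal_expM_radical _ _ _ d) => //.
  apply: (gminor_ideal_rank (Q := fun i => (i <= d)%N) (V := fun v => (c <= v < e.+1)%N)) => //.
  move=> i v id /andP[cv]; rewrite ltnS leq_eqVlt => /orP[/eqP->|ve].
    have [||q ->] := @gminor_full _ (gridX K vx) d (e - d) (scons i (bump r)) (scons e (addn (e - d))).
    - by case=> // k kd; apply: bumpd.
    - by case=> [_|k kd] /=; lia.
    exact: FA.
  apply/PA/mP; first by case=> // k kd; apply: bumpd.
  by case=> [_|k kd] /=; lia.
move=> m [h Hh hm]; apply: contrapT => noB.
have Bd x : mnm_boxes m x -> (x.1 <= d)%N by case/and3P.
have [r [rd nor]] := chain_free_gap ce Bd noB.
pose u := diag_mnm vx d (bump r) (addn (e - d)).
have mg : monic (gm d (bump r) (addn (e - d))) u.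
  apply: (monic_at_gminor _ _ vx_inj) => //.
    split=> [k kd|i j /andP[ij jd]]; first by rewrite ltnS; apply: bumpd.
    by rewrite /bump; case: (leqP r i); case: (leqP r j); lia.
  by split=> [k kd|i j ij]; lia.
have box x : mnm_boxes (m + u)%MM x -> mnm_boxes m x || gap_diagonal d e r x.
  case/mnm_boxes_add => [k kd|k kd|->//|[k kd ->]]; [exact: bumpd|lia|].
  apply/orP; right; rewrite /gap_diagonal /= bumpd //=.
  by rewrite /bump; case: (leqP r k) => H; case: ifP => ?; lia.
have : inI A (m + u)%MM.
  by exists (h * gm d (bump r) (addn (e - d))); [apply: Hh; exists r|apply: monic_atM].
case/(initial_in_add pK HpiK Hle Hf wf_le cP cF) => [/lP[s hs]|].
  have [sz pw al] := hs; apply: nor; exists s; split=> //.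
    by apply/allP => x /(allP al) /and3P[/box -> ->].
  move=> i id; have := @chain_gap s i d pw; rewrite sz => /(_ _) [|_]; first lia.
  have /(is_chain_nth hs) /andP[_ /andP[_ H]] : (d < d.+1)%N by [].
  lia.
have mg0 : monic g0 (diag_mnm vx d.+1 id (addn (e - d))).
  by apply: (monic_at_gminor _ _ vx_inj) => //; split=> [k kd|i j ij]; lia.
move/(initial_in_principal Hle mg0)/mnm_lepP => dv; apply: nor.
exists [seq (k, e - d + k)%N | k <- iota 0 d.+1]; split.
- by rewrite size_map size_iota.
- apply/(pairwiseP (0, 0)%N) => i j; rewrite !inE size_map size_iota => it jt ij.
  by rewrite !(nth_map 0%N) ?size_iota // !nth_iota // /box_lt /=; lia.
- apply/allP => x /mapP[k]; rewrite mem_iota add0n => /andP[_ kd] -> /=.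
  apply/andP; split; last lia.
  apply: box; rewrite /mnm_boxes /=; apply/and3P; split; [by []|lia|].
  apply: lt0n_neq0; apply: leq_trans (dv _); rewrite lt0n mnm_sumE sum_nat_eq0 negb_forall.
  by apply/existsP; exists (Ordinal kd); rewrite /= mnm1E eqxx.
- by move=> i id; rewrite (nth_map 0%N) ?size_iota // nth_iota.
Qed.

(** Lowering [t] by one uses up a column on each side of the window, whence the margins of width
    d+1-t. *)
Lemma exists_rank_ideal t c e : (0 < t <= d.+1)%N -> (d.+1 - t <= c)%N -> (e + (d.+1 - t) <= n)%N ->
  exists P, rank_ideal t c e P.
Proof.
move=> td; have [k tk] : exists k, (t + k = d.+1)%N by exists (d.+1 - t)%N; lia.
elim: k t tk td c e => [|k IH] t tk td c e Hc He.
  have -> : t = d.+1 by lia.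
  by apply: rank_ideal_base; lia.
have [||||P1 H1] := IH t.+1 _ _ c.-1 e; try lia.
have [||||P2 H2] := IH t.+1 _ _ c e.+1; try lia.
by apply: rank_ideal_step H1 H2; lia.
Qed.

End RankIdeals.

(** * Ideals of the maximal minors bounded by a facet *)

Section BlockDeterminant.
Variables (R : comNzRingType) (X : nat -> nat -> R) (I : R -> Prop) (d c : nat) (al : nat -> nat).
Hypothesis HI : is_ideal I.
Hypothesis Hgen : forall b, (forall i j, (i < j <= d)%N -> (b i < b j)%N) ->
  (forall k, (k <= d)%N -> (c <= b k <= al k)%N) -> I (gminor X d.+1 id b).

(** If more than j of the columns are at most [al j], then so is the one at position j after
    sorting. A repeated column makes the minor vanish. *)
Lemma gminor_in_generated (b : nat -> nat) :
  (forall t, (t <= d)%N -> (c <= b t)%N) ->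
  (forall j, (j <= d)%N -> (j < \sum_(t < d.+1) (b t <= al j))%N) ->
  I (gminor X d.+1 id b).
Proof.
move=> cb Hcount; pose s := [seq b t | t <- iota 0 d.+1].
have szs : size s = d.+1 by rewrite size_map size_iota.
have [us|/uniqPn] := boolP (uniq s); last first.
  case/(_ 0%N) => i [j [ij]]; rewrite szs => jd.
  rewrite !(nth_map 0%N) ?size_iota ?(ltn_trans ij) // !nth_iota ?(ltn_trans ij) // !add0n => e.
  by rewrite (@gminor_eq_cols _ _ _ _ _ i j) ?ij //; apply: ideal0.
pose s' := sort leq s; pose b' k := nth 0%N s' k.
have szs' : size s' = d.+1 by rewrite size_sort.
have us' : uniq s' by rewrite sort_uniq.
have srt : sorted leq s' := sort_sorted leq_total s.
have inb (t : 'I_d.+1) : b t \in s' by rewrite mem_sort; apply: map_f; rewrite mem_iota /= add0n.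
pose f (t : 'I_d.+1) : 'I_d.+1 := Ordinal (eq_ind _ (fun x => (index (b t) s' < x)%N)
  (etrans (index_mem _ _) (inb t)) _ szs').
have fE (t : 'I_d.+1) : b t = b' (f t) by rewrite /b' /= nth_index.
have fi : injective f.
  move=> x y e; have := fE x; rewrite e -fE => bxy.
  have nb z : (z < d.+1)%N -> nth 0%N s z = b z by move=> zd; rewrite (nth_map 0%N) ?size_iota // nth_iota.
  have : nth 0%N s x == nth 0%N s y by rewrite !nb // bxy.
  by rewrite nth_uniq ?szs // => /eqP /val_inj.
rewrite (@gminor_perm_cols _ _ _ (perm fi) _ b'); last by move=> k; rewrite permE.
apply: idealM => //; apply: Hgen.
  move=> i j /andP[ij jd]; have iN : (i <= d)%N by lia.
  rewrite ltn_neqAle /b' nth_uniq ?szs' // (ltn_eqF ij) /=.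
  by apply: (sorted_leq_nth leq_trans leqnn) => //; rewrite ?inE ?szs' // ltnW.
rewrite /b' => k kd; apply/andP; split.
  have /(mem_nth 0%N) : (k < size s')%N by rewrite szs'.
  by rewrite mem_sort => /mapP[t]; rewrite mem_iota => /andP[_ td] ->; apply: cb.
rewrite leqNgt; apply/negP => lt; have := Hcount k kd; rewrite ltnNge => /negP; apply.
have -> : (\sum_(t < d.+1) (b t <= al k) = count (fun x => x <= al k) s')%N.
  rewrite (seq.permP (permEl (perm_sort leq s))) -sum1_count big_map [RHS]big_mkcond.
  rewrite -[iota _ _]/(index_iota 0 d.+1) big_mkord; apply: eq_bigr => t _ /=.
  by case: (_ <= _)%N.
rewrite -(cat_take_drop k s') count_cat.
have -> : count (fun x => x <= al k)%N (drop k s') = 0%N.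
  apply/eqP; rewrite -leqn0 leqNgt -has_count; apply/negP => /hasP[x /(nthP 0%N)[i]].
  rewrite size_drop nth_drop szs' => id <-; apply/negP; rewrite -ltnNge.
  apply: leq_trans lt _.
  by apply: (sorted_leq_nth leq_trans leqnn) => //; rewrite ?inE ?szs'; lia.
by rewrite addn0; apply: leq_trans (count_size _ _) _; rewrite size_takel ?szs' //; lia.
Qed.

(** In a Laplace expansion along the rows of [U], row i can only use up a column t with
    [be i < del t]. Of the columns with [del t <= j], at most as many are used as there are rows
    with [be i < j], so more than j remain in the final maximal minor. *)
Lemma block_expansion_ideal q (U : 'M[R]_(q, q + d.+1)) (kap del : 'I_(q + d.+1) -> nat)
    (be : 'I_q -> nat) :
  (forall i t, U i t != 0 -> (be i < del t)%N) ->
  (forall t, (c <= kap t)%N) ->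
  (forall t j, (j <= d)%N -> (del t <= j)%N -> (kap t <= al j)%N) ->
  (forall j, (j <= d)%N -> (j + (\sum_i (be i < j)%N) < (\sum_t (del t <= j)%N)%N)%N) ->
  I (\det (col_mx U (\matrix_(k < d.+1, t < _) X k (kap t)))).
Proof.
elim: q U kap del be => [|q IH] U kap del be HU ck Hk Hc.
  rewrite (_ : \det _ = gminor X d.+1 id (fun k => kap (inord k))).
    apply: gminor_in_generated => [t _|j jd]; first exact: ck.
    have := Hc j jd; rewrite big_ord0 addn0 => /leq_trans; apply.
    by apply: leq_sum => t _; case: (leqP (del t) j) => // /(Hk _ _ jd); rewrite inord_val => ->.
  congr determinant; apply/matrixP => i j; rewrite !mxE inord_val.
  by case: splitP => [[]//|k e]; rewrite mxE e.
pose M : 'M[R]_((q + d.+1).+1) := col_mx U (\matrix_(k < d.+1, t < _) X k (kap t)).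
rewrite -[col_mx _ _]/M (expand_det_row M ord0); apply: ideal_sum => // t _.
have [e|nz] := eqVneq (M ord0 t) 0; first by rewrite e mul0r; apply: ideal0.
have {}nz : (be ord0 < del t)%N.
  apply: HU; move: nz; rewrite /M -(col_mxEu U (\matrix_(k < d.+1, t0 < _) X k (kap t0)) ord0 t).
  by congr (col_mx _ _ _ _ != 0); apply: val_inj.
apply: idealM => //; rewrite /cofactor; apply: idealM => //.
pose U1 : 'M[R]_(q, q + d.+1) := \matrix_(i, t') U (lift ord0 i) (lift t t').
pose V1 : 'M[R]_(d.+1, q + d.+1) := \matrix_(k, t') X k (kap (lift t t')).
have -> : (row' ord0 (col' t M) : 'M[R]_(q + d.+1)) = col_mx U1 V1.
  apply/matrixP => i j; rewrite !mxE.
  case: splitP => k ik; case: splitP => l /= il; rewrite !mxE.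
  - by congr (U _ _); apply: val_inj; move: ik il; rewrite /= /bump /=; lia.
  - by have := ltn_ord k; move: ik il; rewrite /= /bump; lia.
  - by have := ltn_ord l; move: ik il; rewrite /= /bump; lia.
  - by congr (X _ _); move: ik il; rewrite /= /bump /=; lia.
apply: (IH U1 (fun x => kap (lift t x)) (fun x => del (lift t x)) (fun i => be (lift ord0 i))).
- by move=> i t'; rewrite mxE; apply: HU.
- by move=> t'; apply: ck.
- by move=> t' j; apply: Hk.
move=> j jd; have := Hc j jd; rewrite big_ord_recl (bigD1_ord t) //=.
have : ((del t <= j) <= (be ord0 < j))%N by case: (leqP (del t) j) => // h; rewrite (leq_trans nz h).
lia.
Qed.

(** An index s stands for a box in row [rho s] and column [kap s]; [del s] and [be s] will be the
    first and the last of the chains through it. The last d+1 indices will be those of the longest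
    chain. *)
Definition block_mx_of q (rho kap be del : 'I_(q + d.+1) -> nat) : 'M[R]_(q + d.+1) :=
  \matrix_(s, t) ((del t <= be s)%N%:R * X (rho s) (kap t)).

(* Subtracting a full row from a truncated one turns a truncation to the left
   columns into a truncation to the right ones. *)
Lemma block_mx_ideal q (rho kap be del : 'I_(q + d.+1) -> nat) :
  (forall s, (rho s <= d)%N) -> (forall t, (del t <= d)%N) ->
  (forall k, rho (rshift q k) = k) -> (forall k, be (rshift q k) = d) ->
  (forall t, (c <= kap t)%N) ->
  (forall t j, (j <= d)%N -> (del t <= j)%N -> (kap t <= al j)%N) ->
  (forall j, (j <= d)%N ->
     (j + (\sum_(i < q) (be (lshift d.+1 i) < j)%N)%N < (\sum_t (del t <= j)%N)%N)%N) ->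
  I (\det (block_mx_of rho kap be del)).
Proof.
move=> rd dd rhoK beK ck Hk Hc.
pose V : 'M[R]_(d.+1, q + d.+1) := \matrix_(k, t) X k (kap t).
pose U : 'M[R]_(q, q + d.+1) := \matrix_(i, t) ((del t <= be (lshift d.+1 i))%N%:R * X (rho (lshift d.+1 i)) (kap t)).
pose P : 'M[R]_(q, d.+1) := \matrix_(i, k) (rho (lshift d.+1 i) == k)%:R.
have WE : block_mx_of rho kap be del = col_mx U V.
  apply/matrixP => s t; rewrite -(splitK s); case: (split s) => k /=.
    by rewrite col_mxEu !mxE.
  by rewrite col_mxEd !mxE rhoK beK dd mul1r.
have <- : \det (block_mx 1%:M (- P) 0 1%:M *m col_mx U V) = \det (block_mx_of rho kap be del).
  by rewrite det_mulmx det_ublock !det1 !mul1r WE.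
rewrite mul_block_col !mul1mx mul0mx add0r.
apply: (block_expansion_ideal (del := del) (be := fun i => be (lshift d.+1 i))) => // i t.
rewrite !mxE (bigD1 (inord (rho (lshift d.+1 i)))) //= !mxE inordK ?ltnS // eqxx.
rewrite big1 ?addr0; last first.
  move=> k nk; rewrite !mxE (_ : (_ == _) = false) ?oppr0 ?mul0r //.
  by apply: contraNF nk => /eqP e; apply/eqP/val_inj; rewrite /= inordK ?ltnS.
by rewrite mulr1n mulN1r; case: (leqP (del t)) => // _; rewrite mul1r subrr eqxx.
Qed.

End BlockDeterminant.

(** * Initial monomial of the block determinant *)

Section BlockLead.
Variables (K : fieldType) (N : nat) (le : rel 'X_{1..N}).
Hypothesis Hle : term_order le.
Variables (d n : nat) (vx : nat -> nat -> 'I_N) (w : 'I_N -> nat) (B : nat).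
Hypothesis wE : forall i y, (i <= d)%N -> (y < n)%N -> w (vx i y) = (y * B ^ i)%N.

Definition mnm_weight (m : 'X_{1..N}) : nat := (\sum_k w k * m k)%N.
Hypothesis le_weight : forall u v, (mnm_weight u < mnm_weight v)%N -> le u v.

Lemma mnm_weight0 : mnm_weight 0%MM = 0%N.
Proof. by rewrite /mnm_weight big1 // => k _; rewrite mnm0E muln0. Qed.

Lemma mnm_weightD u v : mnm_weight (u + v)%MM = (mnm_weight u + mnm_weight v)%N.
Proof. by rewrite /mnm_weight -big_split; apply: eq_bigr => k _; rewrite mnmDE mulnDr. Qed.

Lemma mnm_weight_sum t (F : 'I_t -> 'X_{1..N}) :
  mnm_weight (\sum_s F s)%MM = (\sum_s mnm_weight (F s))%N.
Proof. exact: (big_morph _ mnm_weightD mnm_weight0). Qed.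

Lemma mnm_weightU k : mnm_weight U_(k)%MM = w k.
Proof.
rewrite /mnm_weight (bigD1 k) //= mnm1E eqxx muln1 big1 ?addn0 // => l lk.
by rewrite mnm1E eq_sym (negPf lk) muln0.
Qed.

(** Let r be the largest row of an index moved by the permutation. In the rows from r on, columns
    can only decrease, which costs a weight of at least B^r; the rows before r contribute less than
    B^r. *)
Lemma monic_at_block q (rho kap be del : 'I_(q + d.+1) -> nat) :
  ((q + d.+1) * n < B)%N ->
  (forall s, (rho s <= d)%N) -> (forall s, (kap s < n)%N) -> (forall s, (del s <= be s)%N) ->
  (forall s t, (del t <= be s)%N -> (rho t <= rho s)%N -> (kap t <= kap s)%N) ->
  (forall s t, (del t <= be s)%N -> (rho t <= rho s)%N -> kap t = kap s -> t = s) ->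
  monic_at le (\det (block_mx_of (gridX K vx) rho kap be del))
    (\sum_s U_(vx (rho s) (kap s)))%MM.
Proof.
move=> HB rd kn db Hk Hk'.
have -> : block_mx_of (gridX K vx) rho kap be del =
   \matrix_(s, t) (((del t <= be s)%N)%:R *: 'X_[U_(vx (rho s) (kap t))]).
  by apply/matrixP => s t; rewrite !mxE; case: leqP => _; rewrite ?mul1r ?mul0r ?scale1r ?scale0r.
apply: monic_at_det => // s s1 al.
suff lt : (mnm_weight (\sum_i U_(vx (rho i) (kap (s i))))%MM <
           mnm_weight (\sum_i U_(vx (rho i) (kap i)))%MM)%N.
  by split; [apply: le_weight|move=> e; rewrite e ltnn in lt].
rewrite !mnm_weight_sum.
rewrite (eq_bigr (fun i => kap (s i) * B ^ rho i)%N); last by move=> i _; rewrite mnm_weightU wE.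
rewrite [X in (_ < X)%N](eq_bigr (fun i => kap i * B ^ rho i)%N); last by move=> i _; rewrite mnm_weightU wE.
have [i0 ni0] : exists i, s i != i.
  apply/existsP; apply: contraNT s1; rewrite negb_exists => /forallP H.
  by apply/eqP/permP => i; rewrite perm1; apply/eqP/negPn/H.
have [i ni imax] := @arg_maxnP _ i0 (fun i => s i != i) rho ni0.
set r := rho i in imax.
(* If s j differs from j, then s j is moved as well, so its row is at most r. *)
have row j : (r <= rho j)%N -> (rho (s j) <= rho j)%N.
  move=> rj; rewrite leqNgt; apply/negP => l.
  have [e|ne] := eqVneq (s j) j; first by rewrite e ltnn in l.
  have e : s (s j) = s j by apply/eqP/negPn/negP => /imax /=; rewrite leqNgt (leq_ltn_trans rj l).
  by move/perm_inj: e ne => ->; rewrite eqxx.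
have kle j : (r <= rho j)%N -> (kap (s j) <= kap j)%N by move=> rj; apply: Hk; [apply: al|apply: row].
have klt : (kap (s i) < kap i)%N.
  rewrite ltn_neqAle kle // andbT; apply: contraNneq ni => e; apply/eqP.
  by apply: Hk' e; [apply: al|apply: row].
rewrite (bigID (fun j => r <= rho j)%N) [X in (_ < X)%N](bigID (fun j => r <= rho j)%N) /=.
have h1 : (\sum_(j | r <= rho j) kap (s j) * B ^ rho j + B ^ r <= \sum_(j | r <= rho j) kap j * B ^ rho j)%N.
  rewrite (bigD1 i) //= [X in (_ <= X)%N](bigD1 i) //= addnAC leq_add //.
    by rewrite -/r addnC -mulSn leq_mul2r klt orbT.
  by apply: leq_sum => j /andP[rj _]; rewrite leq_mul2r kle ?orbT.
have h2 : (\sum_(j | ~~ (r <= rho j)) kap (s j) * B ^ rho j < B ^ r)%N.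
  have B0 : (0 < B)%N by lia.
  case: r => [|r] in imax row kle h1 *.
    by rewrite big_pred0 ?expn0 // => j; rewrite leq0n.
  apply: (@leq_ltn_trans (\sum_(j < q + d.+1) n * B ^ r)%N).
    rewrite [X in (X <= _)%N]big_mkcond; apply: leq_sum => j _ /=.
    case: ifP => //; rewrite -ltnNge ltnS => jr.
    by apply: leq_mul; [apply: ltnW|rewrite leq_pexp2l].
  by rewrite sum_nat_const card_ord mulnA expnS ltn_mul2r expn_gt0 B0.
by apply: leq_trans (leq_trans h1 (leq_addr _ _)); rewrite ltn_add2l.
Qed.

End BlockLead.

(** * Levels of boxes and chains through them *)

Section Levels.
Local Open Scope nat_scope.
Variables (B : pred (nat * nat)) (c : nat).

(** The chain that ends in [x] has v+1 boxes. Thus [level v] consists of the elements of height v in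
    the poset of the boxes of [B] from column [c] on. *)
Fixpoint chain_end v (x : nat * nat) : Prop :=
  [/\ B x, c <= x.2 &
      if v is v'.+1 then exists2 x', box_lt x' x & chain_end v' x' else True].

Definition level v x : Prop := chain_end v x /\ ~ chain_end v.+1 x.

Lemma chain_end_box v x : chain_end v x -> B x /\ c <= x.2.
Proof. by case: v => [|v] []. Qed.

Lemma chain_endW v x : chain_end v.+1 x -> chain_end v x.
Proof.
elim: v x => [|v IH] x [Bx cx [x' lt H]]; first by [].
by split=> //; exists x' => //; apply: IH.
Qed.

Lemma chain_end_le v v' x : v' <= v -> chain_end v x -> chain_end v' x.
Proof.
elim: v => [|v IH]; first by rewrite leqn0 => /eqP->.
by rewrite leq_eqVlt => /orP[/eqP->//|/IH H /chain_endW].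
Qed.

Lemma level_antichain v x x' : level v x -> level v x' -> ~ box_lt x x'.
Proof.
move=> [cx _] [cx' n] lt; apply: n; have [b1 b2] := chain_end_box cx'.
by split=> //; exists x.
Qed.

Lemma level_pred v x : level v.+1 x -> exists2 x', box_lt x' x & level v x'.
Proof.
move=> [[Bx cx [x' lt H]] n]; exists x' => //; split=> // H'.
by apply: n; split=> //; exists x'.
Qed.

Lemma level_inj v v' x : level v x -> level v' x -> v = v'.
Proof.
move=> [a na] [b nb]; case: (ltngtP v v') => // l; exfalso.
  by apply: na; apply: chain_end_le b.
by apply: nb; apply: chain_end_le a.
Qed.

Lemma has_chain_end v e : has_chain B v.+1 c e -> exists2 x, chain_end v x & x.2 < e.
Proof.
case=> s hs; have [sz pw al] := hs.
exists (nth (0, 0) s v); last by have /(is_chain_nth hs) /and3P[] : v < v.+1 by [].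
suff H : forall k, k < v.+1 -> chain_end k (nth (0, 0) s k) by apply: H.
elim=> [|k IH] kv; have /and3P[b1 b2 _] := is_chain_nth hs kv; first by [].
split=> //; exists (nth (0, 0) s k); last by apply: IH; lia.
by apply: box_lt_pairwise => //; rewrite sz leqnn.
Qed.

Definition has_level v y : Prop := exists i, level v (i, y).

Lemma exists_prev_level v y : exists y0, (exists2 y', y' < y & has_level v y') ->
  [/\ y0 < y, has_level v y0 & forall y', y' < y -> has_level v y' -> y' <= y0].
Proof.
have [H|[y0 [lt /asboolP H max]]] := last_or_none (fun y' => `[< has_level v y' >]) y.
  by exists 0 => -[y' /H /asboolP n h]; case: n.
exists y0 => _; split=> // y' lt' h; rewrite leqNgt; apply/negP => l.
by move: (max y'); rewrite l lt' => /(_ isT) /asboolP.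
Qed.

Variables (d : nat) (al : nat -> nat).
Hypothesis Hal : forall k, k <= d -> has_chain B k.+1 c (al k).+1.

(** The k-th chain starts in the leftmost column that meets level k and goes down the levels, moving
    each time to the nearest column on the left that meets the next level. This greedy choice orders
    the chains by columns on each level. Since a level is an antichain, their rows are ordered the
    other way round. *)
Lemma level_pattern : exists (kap rho : nat -> nat -> nat),
 [/\ forall k v, v <= k <= d -> B (rho v (kap k v), kap k v) /\ c <= kap k v,
     forall k v, v < k <= d ->
       kap k v < kap k v.+1 /\ rho v (kap k v) < rho v.+1 (kap k v.+1),
     forall k v, v <= k < d ->
       kap k v <= kap k.+1 v /\ rho v (kap k.+1 v) <= rho v (kap k v),
     forall k, k <= d -> kap k k <= al k
   & forall k v k' v', v <= k <= d -> v' <= k' <= d ->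
       rho v (kap k v) = rho v' (kap k' v') -> kap k v = kap k' v' -> v = v'].
Proof.
(* In the leftmost column where a chain of k+1 boxes can end, no longer chain ends: the box before
   its last one would be further left. *)
have /choice[tau tauP] : forall k, exists y, k <= d ->
    [/\ y <= al k, has_level k y & forall y', has_level k y' -> y <= y'].
  move=> k; have [kd|kd] := leqP k d; last by exists 0; lia.
  have [x hx lt] := has_chain_end (Hal kd).
  have [y [[i hi] ymin]] := @exists_min_nat (fun y => exists i, chain_end k (i, y)) x.2
    (ex_intro _ x.1 (eq_ind _ (chain_end k) hx _ (surjective_pairing x))).
  exists y => _; split.
  - by apply: leq_trans (ymin x.2 _) _; [exists x.1; rewrite -surjective_pairing|].
  - exists i; split=> // -[_ _ [[i' y'] /andP[_ /= l] h]].
    by have := ymin y' (ex_intro _ i' h); rewrite leqNgt l.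
  - by move=> y' [i' [h _]]; apply: ymin; exists i'.
have /choice[nxt nxtP'] : forall vy : nat * nat, exists y0, (exists2 y', y' < vy.2 & has_level vy.1 y') ->
    [/\ y0 < vy.2, has_level vy.1 y0 & forall y', y' < vy.2 -> has_level vy.1 y' -> y' <= y0].
  by move=> [v y]; apply: exists_prev_level.
have nxtP v y : has_level v.+1 y -> [/\ nxt (v, y) < y, has_level v (nxt (v, y)) &
   forall y', y' < y -> has_level v y' -> y' <= nxt (v, y)].
  move=> [i /level_pred[[i' y'] /andP[_ /= l] h]].
  by apply: (nxtP' (v, y)); exists y' => //; exists i'.
have /choice[rho rhoP'] : forall vy : nat * nat, exists i, has_level vy.1 vy.2 ->
    level vy.1 (i, vy.2) /\ forall i', level vy.1 (i', vy.2) -> i <= i'.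
  move=> [v y] /=; have [[i h]|n] := pselect (has_level v y); last by exists 0.
  by have [m H] := @exists_min_nat (fun i => level v (i, y)) i h; exists m.
have rhoP v y : has_level v y -> level v (rho (v, y), y) /\
    forall i', level v (i', y) -> rho (v, y) <= i' by apply: (rhoP' (v, y)).
have rho_anti v y y' : has_level v y -> has_level v y' -> y <= y' -> rho (v, y') <= rho (v, y).
  move=> h h'; rewrite leq_eqVlt => /orP[/eqP->//|l].
  have [a _] := rhoP _ _ h; have [a' _] := rhoP _ _ h'.
  by rewrite leqNgt; apply/negP => l'; apply: (level_antichain a a'); rewrite /box_lt /= l' l.
(* The recursion descends from level k, so [Kk k u] is a column at level k - u. *)
pose Kk k := fix F u := if u is u'.+1 then nxt (k - u, F u') else tau k.
have KS k u : Kk k u.+1 = nxt (k - u.+1, Kk k u) by [].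
have Klev k u : k <= d -> u <= k -> has_level (k - u) (Kk k u).
  move=> kd; elim: u => [|u IH] uk; first by rewrite subn0; case: (tauP k kd).
  rewrite KS; have := IH (ltnW uk); have -> : k - u = (k - u.+1).+1 by lia.
  by case/nxtP.
have Kdec k u : k <= d -> u < k -> Kk k u.+1 < Kk k u.
  move=> kd uk; have := Klev k u kd (ltnW uk); have -> : k - u = (k - u.+1).+1 by lia.
  by case/nxtP.
have Kmon k u : k < d -> u <= k -> Kk k u <= Kk k.+1 u.+1.
  move=> kd; elim: u => [|u IH] uk.
    have [_ _] := tauP k (ltnW kd); apply.
    by have := Klev k.+1 1 kd isT; rewrite subSS subn0.
  rewrite !KS subSS.
  have h := Klev k u (ltnW kd) (ltnW uk); have h' := Klev k.+1 u.+1 kd (ltnW uk).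
  have e : k - u = (k - u.+1).+1 by lia.
  rewrite subSS in h'; rewrite e in h h'.
  have [a b _] := nxtP _ _ h; have [_ _ H'] := nxtP _ _ h'.
  by apply: H' => //; apply: leq_trans a (IH (ltnW uk)).
pose kap k v := Kk k (k - v).
have kaplev k v : v <= k <= d -> has_level v (kap k v).
  by move=> /andP[vk kd]; have := Klev k (k - v) kd (leq_subr _ _); rewrite subKn.
exists kap, (fun v y => rho (v, y)); split.
- move=> k v H; have [[h _] _] := rhoP _ _ (kaplev k v H).
  by have [] := chain_end_box h.
- move=> k v /andP[vk kd].
  have lt : kap k v < kap k v.+1.
    by rewrite /kap (_ : k - v = (k - v.+1).+1); [apply: Kdec => //|]; lia.
  split=> //.
  have h : has_level v.+1 (kap k v.+1) by apply: kaplev; rewrite vk.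
  have h0 : has_level v (kap k v) by apply: kaplev; rewrite kd ltnW.
  (* A predecessor of the box at level v+1 lies in some column y' at most [kap k v]. By the
     antichain property, the box chosen in column [kap k v] has a row no larger than that
     predecessor's. *)
  have [l1 _] := rhoP _ _ h; have [[i' y'] /andP[/= a b] lv] := level_pred l1.
  apply: leq_ltn_trans a; have hy : has_level v y' by exists i'.
  have le' : y' <= kap k v.
    rewrite /kap (_ : k - v = (k - v.+1).+1); last by lia.
    rewrite KS (_ : k - (k - v.+1).+1 = v); last by lia.
    by have [_ _ H] := nxtP v (Kk k (k - v.+1)) h; apply: H.
  apply: leq_trans (rho_anti _ _ _ hy h0 le') _.
  by have [_ H] := rhoP _ _ hy; apply: H.
- move=> k v /andP[vk kd].
  have le' : kap k v <= kap k.+1 v by rewrite /kap subSn //; apply: Kmon => //; lia.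
  by split=> //; apply: rho_anti le'; apply: kaplev; lia.
- by move=> k kd; rewrite /kap subnn; case: (tauP k kd).
- move=> k v k' v' H H'; have [l _] := rhoP _ _ (kaplev k v H).
  have [l' _] := rhoP _ _ (kaplev k' v' H') => e1 e2.
  by rewrite e1 e2 in l; apply: level_inj l l'.
Qed.

End Levels.

(** * Stability of the ideal of the bounded maximal minors *)

Section SchubertIdeal.
Variables (K : fieldType) (p : nat) (piK : K -> K) (N : nat).
Hypotheses (pK : p \in [pchar K]) (HpiK : frob_retract p piK).
Variables (le : rel 'X_{1..N}) (d n : nat) (vx : nat -> nat -> 'I_N).
Hypothesis Hle : term_order le.
Hypothesis wf_le : well_founded (fun u v => le u v && (u != v)).
Hypothesis vx_inj : forall i y i' y', (i <= d)%N -> (y < n)%N -> (i' <= d)%N -> (y' < n)%N ->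
  vx i y = vx i' y' -> i = i' /\ y = y'.
Hypothesis Hdiag : diagonal_pairs le d n vx.
Local Notation S := {mpoly K[N]}.
Local Notation gm := (gminor (gridX K vx)).
Variable f : S.
Hypothesis Hf : monic_at le f (ones_mnm N).
Hypothesis f_div : forall j, (j + d < n)%N -> exists q, f = q * gm d.+1 id (addn j).
Variables (w : 'I_N -> nat) (B : nat).
Hypothesis wE : forall i y, (i <= d)%N -> (y < n)%N -> w (vx i y) = (y * B ^ i)%N.
Hypothesis le_weight : forall u v, (mnm_weight w u < mnm_weight w v)%N -> le u v.
Hypothesis HB : (d.+1 * d.+1 * n < B)%N.
Local Notation compat := (compat p piK (f ^+ p.-1)).
Local Notation monic := (monic_at le).
Local Notation inI := (@initial_in K N le).

Variables (c : nat) (al : nat -> nat).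
Hypothesis al_mono : forall i j, (i <= j)%N -> (al i <= al j)%N.

Definition column_bounded (b : nat -> nat) : Prop :=
  (forall i j, (i < j <= d)%N -> (b i < b j)%N) /\
  (forall k, (k <= d)%N -> (c <= b k <= al k)%N).

(** The generated ideal, as the intersection of all ideals containing the generators: an inclusion
    in another ideal is a single application. *)
Definition schubert_ideal : S -> Prop := fun h =>
  forall I : S -> Prop, is_ideal I ->
    (forall b, column_bounded b -> I (gm d.+1 id b)) -> I h.

Lemma schubert_ideal_ideal : is_ideal schubert_ideal.
Proof.
split; first by move=> I iI _; apply: ideal0.
  by move=> u v Hu Hv I iI H; apply: idealD => //; [apply: Hu|apply: Hv].
by move=> a u Hu I iI H; apply: idealM => //; apply: Hu.
Qed.

Lemma schubert_ideal_gen b : column_bounded b -> schubert_ideal (gm d.+1 id b).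
Proof. by move=> Hb I iI; apply. Qed.

Hypothesis al_n : forall k, (k <= d)%N -> (al k < n)%N.

(** The witness is the determinant of [block_mx_of] on all the boxes of the chains of
    [level_pattern]. These are distinct boxes of [m], so the product of the diagonal divides [m]. *)
Lemma schubert_leading m :
  (forall k, (k <= d)%N -> has_chain (mnm_boxes d n vx m) k.+1 c (al k).+1) ->
  exists2 g, schubert_ideal g & exists2 m', monic g m' & (m' <= m)%MM.
Proof.
move=> Hch.
have Bd x : mnm_boxes d n vx m x -> (x.1 <= d)%N by case/and3P.
have [kap [rho [inB inc mon diag sep]]] := level_pattern Hch.
have kmon k k' v : (v <= k)%N -> (k <= k' <= d)%N -> (kap k v <= kap k' v)%N.
  move=> vk; elim: k' => [|k' IH] /andP[kk kd]; first by have -> : k = 0%N by lia.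
  move: kk; rewrite leq_eqVlt => /orP[/eqP->//|kk].
  have h : (v <= k' < d)%N by lia.
  by apply: leq_trans (IH _) (mon _ _ h).1; lia.
have rmon k k' v : (v <= k)%N -> (k <= k' <= d)%N -> (rho v (kap k' v) <= rho v (kap k v))%N.
  move=> vk; elim: k' => [|k' IH] /andP[kk kd]; first by have -> : k = 0%N by lia.
  move: kk; rewrite leq_eqVlt => /orP[/eqP->//|kk].
  have h : (v <= k' < d)%N by lia.
  by apply: leq_trans (mon _ _ h).2 (IH _); lia.
have kinc k v v' : (v < v')%N -> (v' <= k <= d)%N ->
    (kap k v < kap k v')%N /\ (rho v (kap k v) + (v' - v) <= rho v' (kap k v'))%N.
  elim: v' => // v' IH; rewrite ltnS leq_eqVlt => /orP[/eqP->|lt] h.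
    by have [] := inc k v' h; split=> //; lia.
  have [a b] := inc k v' h; have [] := IH lt _; first lia.
  by split; lia.
have box k v : (v <= k <= d)%N -> (rho v (kap k v) <= d)%N /\ (kap k v < n)%N.
  by move=> /inB [/and3P[]].
(* The chain number d has d+1 boxes and so meets every row; it supplies the untruncated rows of the
   matrix. *)
have rhoD v : (v <= d)%N -> rho v (kap d v) = v.
  move=> vd.
  have up : (v <= rho v (kap d v))%N.
    have [v0|v0] := posnP v; first by rewrite {1}v0.
    by have [|_] := kinc d 0%N v v0; [rewrite vd leqnn|lia].
  have [e|vd'] := eqVneq v d.
    by apply/eqP; rewrite eqn_leq up andbT {3}e; apply: (box d v _).1; lia.
  have [||_] := kinc d v d; try lia.
  have := (box d d); rewrite leqnn => /(_ isT) [].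
  lia.
(* A box at level v shared by several chains is recorded under the last of them. The boxes of chain
   d are left out, as they occupy the last d+1 indices. *)
pose L := [seq x <- [seq (k, v) | k <- iota 0 d, v <- iota 0 d.+1] |
  (x.2 <= x.1)%N && (kap x.1 x.2 < kap x.1.+1 x.2)%N].
have LP (x : nat * nat) : x \in L = [&& (x.1 < d)%N, (x.2 <= x.1)%N & (kap x.1 x.2 < kap x.1.+1 x.2)%N].
  rewrite mem_filter; case: x => k v.
  apply/andP/and3P => [[/andP[-> ->]]|[kd vk lt]].
    by move=> /allpairsP[[k' v'] /= [+ _ [-> _]]]; rewrite mem_iota.
  rewrite vk lt; split=> //; apply: allpairs_f; rewrite mem_iota add0n leq0n ?ltnS //.
  by apply: leq_trans vk _; apply: ltnW.
have uL : uniq L.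
  by apply: filter_uniq; apply: allpairs_uniq; rewrite ?iota_uniq // => -[? ?] [? ?] _ _ [-> ->].
pose q := size L.
have qd : (q <= d * d.+1)%N.
  by apply: leq_trans (size_subseq (filter_subseq _ _)) _; rewrite size_allpairs !size_iota.
pose pr (s : 'I_(q + d.+1)) : nat * nat :=
  match split s with inl i => nth (0, 0)%N L i | inr k => (d, nat_of_ord k) end.
have prL i : pr (lshift d.+1 i) = nth (0, 0)%N L i by rewrite /pr (unsplitK (inl _ i)).
have prR (k : 'I_d.+1) : pr (rshift q k) = (d, nat_of_ord k) by rewrite /pr (unsplitK (inr _ k)).
have inL i : (i < q)%N -> nth (0, 0)%N L i \in L by apply: mem_nth.
have pr_ok s : ((pr s).2 <= (pr s).1 <= d)%N.
  rewrite /pr; case: (split s) => i /=; last by have := ltn_ord i; lia.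
  by have := inL i (ltn_ord i); rewrite LP => /and3P[a b _]; rewrite b ltnW.
have pr_inj : injective pr.
  move=> s t; rewrite /pr -{2}(splitK s) -{2}(splitK t).
  case: (split s) => i; case: (split t) => j /=.
  - by move/eqP; rewrite nth_uniq ?ltn_ord // => /eqP e; congr lshift; apply: val_inj.
  - by move=> e; have := inL i (ltn_ord i); rewrite e LP /= ltnn.
  - by move=> e; have := inL j (ltn_ord j); rewrite -e LP /= ltnn.
  - by case=> e; congr rshift; apply: val_inj.
have pr_max s k : ((pr s).1 < k <= d)%N -> (kap (pr s).1 (pr s).2 < kap k (pr s).2)%N.
  move=> h; have : pr s \in L.
    by move: h; rewrite /pr; case: (split s) => i /=; [move=> _; apply: inL|case/andP => a b; move: (leq_trans a b); rewrite ltnn].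
  rewrite LP => /and3P[a b lt]; apply: leq_trans lt _; apply: kmon; lia.
have pr_eq s t : (pr s).2 = (pr t).2 -> kap (pr s).1 (pr s).2 = kap (pr t).1 (pr t).2 -> s = t.
  move=> e2 e; apply: pr_inj; apply/eqP; rewrite -pair_eqE /= e2 eqxx andbT.
  have := pr_ok s; have := pr_ok t; case: (ltngtP (pr s).1 (pr t).1) => // l hs ht.
    by have := pr_max s (pr t).1; rewrite l e e2 ltnn; lia.
  by have := pr_max t (pr s).1; rewrite l -e -e2 ltnn; lia.
have pr_ex j v : (v <= j <= d)%N -> exists2 s, pr s = ((pr s).1, v) &
    (j <= (pr s).1)%N /\ kap (pr s).1 v = kap j v.
  move=> /andP[vj jd].
  have [H|[k [kd /andP[jk /eqP e] max]]] :=
    last_or_none (fun k => (j <= k)%N && (kap k v == kap j v)) d.+1.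
    by have /negP[] := H j jd; rewrite leqnn eqxx.
  rewrite ltnS in kd; have vd : (v < d.+1)%N by lia.
  have [ed|kd'] := eqVneq k d.
    by exists (rshift q (Ordinal vd)); rewrite prR //=; split=> //; rewrite -ed.
  have kL : (k, v) \in L.
    rewrite LP /=; apply/and3P; split; [lia|lia|].
    rewrite ltn_neqAle kmon ?andbT; [|lia|lia].
    by have := max k.+1; rewrite ltnSn /= e (leqW jk) /= eq_sym; apply; lia.
  have iq : (index (k, v) L < q)%N by rewrite index_mem.
  by exists (lshift d.+1 (Ordinal iq)); rewrite prL /= nth_index.
(* By the choice of [L], [be s] is the last chain through the box s; [del s] will be the first. *)
pose be s := (pr s).1; pose lv s := (pr s).2.
pose kp s := kap (be s) (lv s); pose rh s := rho (lv s) (kp s).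
have /choice[del delP] : forall s, exists j, ((lv s <= j <= be s)%N /\ kap j (lv s) = kp s).
  by move=> s; exists (be s); have := pr_ok s; rewrite /be /lv; split=> //; lia.
have del_min : exists del, forall s, ((lv s <= del s <= be s)%N /\ kap (del s) (lv s) = kp s) /\
   forall j, ((lv s <= j <= be s)%N /\ kap j (lv s) = kp s) -> (del s <= j)%N.
  have /choice[g Hg] : forall s, exists j, ((lv s <= j <= be s)%N /\ kap j (lv s) = kp s) /\
     forall j', ((lv s <= j' <= be s)%N /\ kap j' (lv s) = kp s) -> (j <= j')%N.
    by move=> s; apply: (@exists_min_nat (fun j => (lv s <= j <= be s)%N /\ kap j (lv s) = kp s) (del s)).
  by exists g.
case: del_min => {del delP} del delP.
have del_ok s : (lv s <= del s <= be s)%N by case: (delP s) => -[].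
have del_kap s : kap (del s) (lv s) = kp s by case: (delP s) => -[].
have bed s : (be s <= d)%N by have := pr_ok s; rewrite /be; lia.
(* The chain [be s] passes through s, and at the level of t it has a box whose row is at most, and
   whose column at least, that of t. The bound on rows then excludes [lv s < lv t], and the columns
   of this chain give [kp t <= kp s]. *)
have greedy s t : (del t <= be s)%N -> (rh t <= rh s)%N ->
    (kp t <= kp s)%N /\ (kp t = kp s -> t = s).
  move=> dts rts; have := pr_ok s; have := pr_ok t; rewrite -/(be s) -/(be t) -/(lv s) -/(lv t) => ht hs.
  have dt := del_ok t; have ds := bed s.
  have vv : (lv t <= lv s)%N.
    rewrite leqNgt; apply/negP => l.
    have h1 := @rmon (del t) (be s) (lv t) _ _.
    have {}h1 : (rho (lv t) (kap (be s) (lv t)) <= rh t)%N.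
      by rewrite /rh -del_kap; apply: rmon; lia.
    have [|_ h2] := kinc (be s) _ _ l; first lia.
    by move: rts; rewrite {2}/rh {1}/kp; lia.
  have m1 : (kp t <= kap (be s) (lv t))%N by rewrite -del_kap; apply: kmon; lia.
  move: vv; rewrite leq_eqVlt => /orP[/eqP vv|l]; last first.
    by have [|h _] := kinc (be s) _ _ l; [lia|rewrite {2 4}/kp; split=> [|e]; lia].
  rewrite vv -/(kp s) in m1; split=> // e.
  by apply: pr_eq.
have kE s : kp s = kap (pr s).1 (pr s).2 by [].
exists (\det (block_mx_of (gridX K vx) rh kp be del)).
  move=> I iI HI; apply: (@block_mx_ideal _ _ _ d c al) => //.
  - by move=> b Hb Hb'; apply: HI.
  - by move=> s; apply: (box _ _ (pr_ok s)).1.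
  - by move=> t; apply: leq_trans (bed t); have := del_ok t; lia.
  - by move=> k; rewrite /rh /lv /kp /be /lv !prR /=; apply: rhoD; rewrite -ltnS.
  - by move=> k; rewrite /be prR.
  - by move=> t; have [] := inB _ _ (pr_ok t).
  - move=> t j jd dj; have dt := del_ok t; have bt := bed t; rewrite -del_kap.
    have [e|ne] := eqVneq (lv t) (del t).
      by rewrite e; apply: leq_trans (diag _ _) (al_mono dj); lia.
    have [||h _] := kinc (del t) (lv t) (del t); try lia.
    by apply: leq_trans (ltnW h) _; apply: leq_trans (diag _ _) (al_mono dj); lia.
  move=> j jd.
  (* The difference of the two counts is the number of boxes with [del t <= j <= be t]. Among them
     are the j+1 boxes of chain j, one at each level. *)
  have -> : (\sum_t (del t <= j) = \sum_t (be t < j) + \sum_t (del t <= j <= be t))%N.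
    rewrite -big_split; apply: eq_bigr => t _ /=; have := del_ok t.
    by case: (ltnP (be t) j); case: (leqP (del t) j); lia.
  rewrite big_split_ord /= [X in (_ < _ + X + _)%N]big1 ?addn0; last first.
    by move=> k _; rewrite /be prR /= ltnNge jd.
  rewrite addnC ltn_add2l.
  have /choice[g Hg] : forall v : 'I_j.+1, exists s, pr s = ((pr s).1, nat_of_ord v) /\
      ((j <= (pr s).1)%N /\ kap (pr s).1 v = kap j v).
    move=> v; have vj := ltn_ord v; have [s h1 h2] := pr_ex j v ltac:(lia).
    by exists s.
  have gi : injective g.
    by move=> x y e; apply: val_inj; have [h _] := Hg x; have [h' _] := Hg y;
       move: h h'; rewrite e => -> [].
  rewrite -[j.+1]card_ord -(card_image gi) -sum1_card big_mkcond /=.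
  rewrite -[X in (X <= _)%N]big_mkcond big_mkcond /=; apply: leq_sum => t _.
  case: ifP => // /imageP[v _ ->]; have [h [h1 h2]] := Hg v.
  have -> : (del (g v) <= j)%N.
    have [_ H] := delP (g v); apply: H; rewrite kE /lv /be h /=; split=> //.
    by have vj := ltn_ord v; lia.
  by rewrite /be h1.
exists (\sum_s U_(vx (rh s) (kp s)))%MM.
  apply: (monic_at_block _ Hle wE le_weight) => //.
  - apply: leq_ltn_trans HB; rewrite leq_mul2r; apply/orP; right; nia.
  - by move=> s; apply: (box _ _ (pr_ok s)).1.
  - by move=> s; apply: (box _ _ (pr_ok s)).2.
  - by move=> s; have := del_ok s; lia.
  - by move=> s t h1 h2; have [] := greedy s t h1 h2.
  - by move=> s t h1 h2; have [_] := greedy s t h1 h2.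
apply/mnm_lepP => x; rewrite mnm_sumE.
have [[s0 s0x]|none] := pselect (exists s, vx (rh s) (kp s) = x); last first.
  by rewrite big1 // => s _; rewrite mnm1E; case: eqP => // e; case: none; exists s.
rewrite (bigD1 s0) //= mnm1E s0x eqxx big1 ?addn0.
  rewrite lt0n -s0x.
  by have [/and3P[]] := inB _ _ (pr_ok s0).
move=> s ne; rewrite mnm1E; case: eqP => // e; case/eqP: ne.
have [h1 h2] := box _ _ (pr_ok s); have [h3 h4] := box _ _ (pr_ok s0).
have [er ek] := vx_inj h1 h2 h3 h4 (etrans e (esym s0x)).
by apply: pr_eq => //; apply: sep er ek; apply: pr_ok.
Qed.

(** The ideal is the intersection [Q] of the rank ideals given by its bounds. For the hard
    inclusion, an initial monomial of [Q] has all the chains required by [schubert_leading];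
    subtracting a multiple of the element found there lowers it, and the division ends by
    well-foundedness. *)
Lemma schubert_psi h : (d <= c)%N -> (al d + d < n)%N ->
  schubert_ideal h -> schubert_ideal (psi p piK (f ^+ p.-1) h).
Proof.
move=> dc ad Hh.
(* Quantifying over all rank ideals avoids choosing one for each k. *)
pose Q (h : S) := forall k, (k <= d)%N -> forall P,
  rank_ideal p piK le d n vx f k.+1 c (al k).+1 P -> P h.
have exP k : (k <= d)%N -> exists P, rank_ideal p piK le d n vx f k.+1 c (al k).+1 P.
  move=> kd; apply: (exists_rank_ideal pK HpiK Hle wf_le vx_inj Hdiag Hf f_div); [lia|lia|].
  by have := al_mono kd; lia.
have iQ : is_ideal Q.
  split; first by move=> k _ P [[iP _] _ _]; apply: ideal0.
    by move=> u v Hu Hv k kd P HP; have [[iP _] _ _] := HP; apply: idealD => //; [apply: (Hu k)|apply: (Hv k)].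
  by move=> a u Hu k kd P HP; have [[iP _] _ _] := HP; apply: idealM => //; apply: (Hu k).
have SQ g : schubert_ideal g -> Q g.
  apply=> // b [binc bb] k kd P [[iP _] mP _].
  (* The first k+1 columns of b are at most [b k], hence at most [al k]. *)
  apply: (gminor_ideal_up (Q := fun i => (i <= d)%N) (V := fun v => (c <= v < (al k).+1)%N) iP mP) => //.
  move=> i ik; have ikd : (i <= k)%N by [].
  have [c1 _] := andP (bb i (leq_trans ikd kd)); rewrite c1 ltnS /=.
  have [_ c2] := andP (bb k kd); apply: leq_trans c2.
  move: ikd; rewrite leq_eqVlt => /orP[/eqP->//|ikd]; apply: ltnW; apply: binc; lia.
have QS g : Q g -> schubert_ideal g.
  have [->|g0] := eqVneq g 0; first by move=> _; apply: (ideal0 schubert_ideal_ideal).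
  have [u ug] : exists u, u = init_mon le g by eexists.
  elim/(well_founded_ind wf_le): u g g0 ug => u IH g g0 ug Qg.
  have gu : g@_u != 0 by rewrite ug init_mon_supp.
  have gle m : g@_m != 0 -> le m u by rewrite ug; apply: init_mon_max.
  have [|g1 Sg1 [m' g1m' m'u]] := @schubert_leading u.
    move=> k kd; have [P HP] := exP k kd; have [[iP _] _ lP] := HP; apply: lP.
    by apply: (initial_in_scale iP (Qg k kd P HP) gu gle).
  pose r := (g@_u)%:MP * 'X_[u - m'] * g1.
  have Sr : schubert_ideal r by apply: (idealM schubert_ideal_ideal).
  have ru : r@_u = g@_u.
    rewrite /r -mulrA mcoeffCM mcoeffXM lem_subr.
    by rewrite (_ : (u - (u - m') = m')%MM) ?g1m'.1 ?mulr1 // -{1}(submK m'u) addmC addmK.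
  have rle m : r@_m != 0 -> le m u.
    rewrite /r -mulrA mcoeffCM mulf_eq0 negb_or => /andP[_ /mcoeffM_neq0[a [b [+ /g1m'.2 bm ->]]]].
    rewrite mcoeffX; case: (_ =P a) => [<- _|_]; last by rewrite eqxx.
    by rewrite -{2}(submK m'u); apply: tle_add2l.
  have gE : g = (g - r) + r by rewrite subrK.
  rewrite gE; apply: (idealD schubert_ideal_ideal) => //.
  have [->|d0] := eqVneq (g - r) 0; first exact: (ideal0 schubert_ideal_ideal).
  apply: (IH (init_mon le (g - r))) => //; last by apply: (idealB iQ) => //; apply: SQ.
  have nz := init_mon_supp le d0; apply/andP; split.
    move: nz; rewrite mcoeffB; have [->|/gle //] := eqVneq (g@_(init_mon le (g - r))) 0.
    by rewrite sub0r oppr_eq0 => /rle.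
  by apply: contraNneq nz => ->; rewrite mcoeffB ru subrr.
apply: QS => k kd P HP; have [[iP cP] _ _] := HP.
by apply: cP; apply: (SQ _ Hh k kd P HP).
Qed.

End SchubertIdeal.

(** * The Frobenius splitting *)

Section WeightOrder.
Variables (N : nat) (w : 'I_N -> nat).
Implicit Types u v m : 'X_{1..N}.

(** Ties are broken by a well-founded term order, so this is one for every [w]. *)
Definition weight_order : rel 'X_{1..N} := fun u v =>
  (mnm_weight w u < mnm_weight w v)%N ||
  (mnm_weight w u == mnm_weight w v) && (u <= v)%O.

Lemma weight_order_term_order : term_order weight_order.
Proof.
split; split.
- by move=> u; rewrite /weight_order eqxx Order.POrderTheory.lexx orbT.
- move=> u v; rewrite /weight_order; case: (ltngtP (mnm_weight w u)) => //= _.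
  exact: Order.POrderTheory.le_anti.
- move=> v u t; rewrite /weight_order.
  case: (ltngtP (mnm_weight w u)) => //= [uv _|-> uv].
    by case: (ltngtP (mnm_weight w v)) => //= [vt _|<- _]; rewrite ?(ltn_trans uv vt) ?uv.
  by case: (ltngtP (mnm_weight w v)) => //= _; apply: Order.POrderTheory.le_trans.
- move=> u v; rewrite /weight_order; case: ltngtP => //= _.
  exact: Order.TotalTheory.le_total.
- move=> m; rewrite /weight_order mnm_weight0 le0m andbT orbC eq_sym; case: posnP => //.
- move=> m u v; rewrite /weight_order !mnm_weightD ltn_add2l eqn_add2l.
  by rewrite lemc_add2r.
Qed.

Lemma weight_order_wf : well_founded (fun u v => weight_order u v && (u != v)).
Proof.
move=> v; have [k] := ubnP (mnm_weight w v); elim: k v => [v|k IH v]; first by rewrite ltn0.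
elim/(@ltmwf N): v => v IHv lt; constructor=> u /andP[+ ne].
rewrite /weight_order => /orP[l|/andP[/eqP e l]].
  by apply: IH; apply: leq_trans l _; rewrite -ltnS.
by apply: IHv; rewrite ?e // Order.POrderTheory.lt_neqAle ne.
Qed.

Lemma weight_order_lt u v : (mnm_weight w u < mnm_weight w v)%N -> weight_order u v.
Proof. by rewrite /weight_order => ->. Qed.

End WeightOrder.

Section GridWeights.
Variables (N d n : nat) (vx : nat -> nat -> 'I_N) (F : nat -> nat -> nat).
Hypothesis vx_inj : forall i y i' y', (i <= d)%N -> (y < n)%N -> (i' <= d)%N -> (y' < n)%N ->
  vx i y = vx i' y' -> i = i' /\ y = y'.

Definition grid_weight (k : 'I_N) : nat :=
  if [pick x : 'I_d.+1 * 'I_n | vx x.1 x.2 == k] is Some x then F x.1 x.2 else 0%N.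

Lemma grid_weightE i y : (i <= d)%N -> (y < n)%N -> grid_weight (vx i y) = F i y.
Proof.
move=> id yn; rewrite /grid_weight; case: pickP => [[i' y'] /= /eqP /vx_inj|none].
  by case=> //; [rewrite -ltnS|move=> -> ->].
have id' : (i < d.+1)%N by [].
by have := none (Ordinal id', Ordinal yn); rewrite /= eqxx.
Qed.

Lemma diagonal_pairs_weight (le : rel 'X_{1..N}) (w : 'I_N -> nat) :
  (forall u v, (mnm_weight w u < mnm_weight w v)%N -> le u v) ->
  (forall i i' y y', (i < i' <= d)%N -> (y < y' < n)%N ->
     (w (vx i y') + w (vx i' y) < w (vx i y) + w (vx i' y'))%N) ->
  diagonal_pairs le d n vx.
Proof.
move=> Hle H i i' y y' hi hy; apply: Hle.
by rewrite !mnm_weightD !mnm_weightU; apply: H.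
Qed.

End GridWeights.

Section GridPolynomial.
Variables (K : fieldType) (N d n : nat) (vx : nat -> nat -> 'I_N).
Hypothesis vx_inj : forall i y i' y', (i <= d)%N -> (y < n)%N -> (i' <= d)%N -> (y' < n)%N ->
  vx i y = vx i' y' -> i = i' /\ y = y'.
Local Notation gm := (gminor (gridX K vx)).

Definition diagonals_mnm : 'X_{1..N} :=
  (\sum_(j < n - d) diag_mnm vx d.+1 id (addn j))%MM.

Lemma diagonals_mnm_le : (diagonals_mnm <= ones_mnm N)%MM.
Proof.
apply/mnm_lepP => x; rewrite mnmE mnm_sumE.
rewrite (eq_bigr (fun j : 'I_(n - d) => \sum_(k < d.+1) (vx k (j + k) == x)))%N; last first.
  by move=> j _; rewrite mnm_sumE; apply: eq_bigr => k _; rewrite mnm1E.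
rewrite pair_big /=.
have [[[j0 k0] /= /eqP e0]|none] :=
  pselect (exists z : 'I_(n - d) * 'I_d.+1, vx z.2 (z.1 + z.2)%N == x); last first.
  by rewrite big1 // => z _; case: eqP => // e; case: none; exists z; apply/eqP.
rewrite (bigD1 (j0, k0)) //= e0 eqxx big1 // => -[j k] /= ne.
case: eqP => // e; case/eqP: ne.
have hk := ltn_ord k; have hj := ltn_ord j; have hk0 := ltn_ord k0; have hj0 := ltn_ord j0.
have [|||| ek ej] := vx_inj _ _ _ _ (etrans e (esym e0)); try lia.
by congr (_, _); apply: val_inj => /=; lia.
Qed.

(* The product of the maximal minors of adjacent columns and of the variables
   on no full diagonal: its initial monomial is the product of all variables. *)
Definition grid_poly : {mpoly K[N]} :=
  \prod_(j < n - d) gm d.+1 id (addn j) * 'X_[ones_mnm N - diagonals_mnm].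

Lemma monic_at_grid_poly (le : rel 'X_{1..N}) : term_order le ->
  diagonal_pairs le d n vx -> monic_at le grid_poly (ones_mnm N).
Proof.
move=> Hle Hd; have -> : ones_mnm N = (diagonals_mnm + (ones_mnm N - diagonals_mnm))%MM.
  by rewrite addmC submK // diagonals_mnm_le.
apply: monic_atM => //; last exact: monic_atX.
apply: monic_at_prod => // j; have hj := ltn_ord j.
by apply: (monic_at_gminor _ _ vx_inj) => //; split=> [k kd|i i' ii]; lia.
Qed.

Lemma grid_poly_div j : (j + d < n)%N -> exists q, grid_poly = q * gm d.+1 id (addn j).
Proof.
move=> jd; have jn : (j < n - d)%N by lia.
rewrite /grid_poly (bigD1 (Ordinal jn)) //=.
exists (\prod_(i < n - d | i != Ordinal jn) gm d.+1 id (addn i) * 'X_[ones_mnm N - diagonals_mnm]).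
by rewrite -[LHS]mulrA [LHS]mulrC.
Qed.

End GridPolynomial.

Section SchubertPsi.
Variables (K : fieldType) (p : nat) (piK : K -> K) (N d n : nat) (vx : nat -> nat -> 'I_N).
Hypotheses (pK : p \in [pchar K]) (HpiK : frob_retract p piK).
Hypothesis vx_inj : forall i y i' y', (i <= d)%N -> (y < n)%N -> (i' <= d)%N -> (y' < n)%N ->
  vx i y = vx i' y' -> i = i' /\ y = y'.
Local Notation F := (grid_poly K d n vx ^+ p.-1).

(** The half-turn of the matrix: it keeps diagonals of minors diagonal and exchanges the two
    conditions of semi-closedness. *)
Definition grid_rev (i y : nat) : 'I_N := vx (d - i) (n.-1 - y).

Lemma grid_rev_inj i y i' y' : (i <= d)%N -> (y < n)%N -> (i' <= d)%N -> (y' < n)%N ->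
  grid_rev i y = grid_rev i' y' -> i = i' /\ y = y'.
Proof. by move=> h1 h2 h3 h4 /vx_inj[]; lia. Qed.

Lemma grid_revK i y : (i <= d)%N -> (y < n)%N -> grid_rev (d - i) (n.-1 - y) = vx i y.
Proof. by move=> h1 h2; rewrite /grid_rev subKn // subKn //; lia. Qed.

Lemma diagonal_pairs_rev le : diagonal_pairs le d n grid_rev -> diagonal_pairs le d n vx.
Proof.
move=> H i i' y y' hi hy.
have := H (d - i')%N (d - i)%N (n.-1 - y')%N (n.-1 - y)%N.
rewrite !grid_revK; [|lia..] => /(_ _ _).
rewrite ![(U_(vx i' _) + U_(vx i _))%MM]addmC.
by apply; lia.
Qed.

Let row_weight_pairs (vg : nat -> nat -> 'I_N) (B : nat) :
  (0 < n)%N -> (1 < B)%N ->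
  (forall i y, (i <= d)%N -> (y < n)%N -> grid_weight d n vg (fun i y => y * B ^ i)%N (vg i y) = (y * B ^ i)%N) ->
  diagonal_pairs (weight_order (grid_weight d n vg (fun i y => y * B ^ i)%N)) d n vg.
Proof.
move=> n0 B1 E; apply: diagonal_pairs_weight; first exact: weight_order_lt.
move=> i i' y y' /andP[ii id] /andP[yy yn].
rewrite !E; [|lia..].
have lt : (B ^ i < B ^ i')%N by rewrite ltn_exp2l.
nia.
Qed.

Lemma schubert_psi_grid c al h : (forall i j, (i <= j)%N -> (al i <= al j)%N) ->
  (d <= c)%N -> (al d + d < n)%N ->
  schubert_ideal d vx c al h -> schubert_ideal d vx c al (psi p piK F h).
Proof.
(* The block matrix has at most (d+1)^2 indices and columns below n; adding 2 also ensures B > 1. *)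
move=> alm dc ad; set B := (d.+1 * d.+1 * n).+2.
have E i y : (i <= d)%N -> (y < n)%N ->
    grid_weight d n vx (fun i y => y * B ^ i)%N (vx i y) = (y * B ^ i)%N.
  by move=> id yn; apply: (grid_weightE _ vx_inj).
have Hd : diagonal_pairs (weight_order (grid_weight d n vx (fun i y => y * B ^ i)%N)) d n vx.
  by apply: row_weight_pairs => //; lia.
have Ht := weight_order_term_order (grid_weight d n vx (fun i y => y * B ^ i)%N).
have HB : (d.+1 * d.+1 * n < B)%N by rewrite /B ltnW.
exact: (schubert_psi pK HpiK Ht (@weight_order_wf _ _) vx_inj Hd
  (monic_at_grid_poly K vx_inj Ht Hd) (@grid_poly_div _ _ _ _ _) E (@weight_order_lt _ _) HB alm dc ad).
Qed.

(** The trace map remains that of the unrotated grid. A maximal minor of adjacent columns goes to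
    another one up to a factor, and a diagonal order for one grid is diagonal for the other, so
    [grid_poly] keeps the properties required of it. *)
Lemma schubert_psi_grid_rev c al h : (forall i j, (i <= j)%N -> (al i <= al j)%N) ->
  (d <= c)%N -> (al d + d < n)%N ->
  schubert_ideal d grid_rev c al h -> schubert_ideal d grid_rev c al (psi p piK F h).
Proof.
move=> alm dc ad; set B := (d.+1 * d.+1 * n).+2.
have E i y : (i <= d)%N -> (y < n)%N ->
    grid_weight d n grid_rev (fun i y => y * B ^ i)%N (grid_rev i y) = (y * B ^ i)%N.
  by move=> id yn; apply: (grid_weightE _ grid_rev_inj).
have Hd : diagonal_pairs (weight_order (grid_weight d n grid_rev (fun i y => y * B ^ i)%N)) d n grid_rev.
  by apply: row_weight_pairs => //; lia.
have Ht := weight_order_term_order (grid_weight d n grid_rev (fun i y => y * B ^ i)%N).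
have HB : (d.+1 * d.+1 * n < B)%N by rewrite /B ltnW.
suff Hdiv j : (j + d < n)%N -> exists q, grid_poly K d n vx = q * gminor (gridX K grid_rev) d.+1 id (addn j).
  exact: (schubert_psi pK HpiK Ht (@weight_order_wf _ _) grid_rev_inj Hd
    (monic_at_grid_poly K vx_inj Ht (diagonal_pairs_rev Hd)) Hdiv E (@weight_order_lt _ _) HB alm dc ad).
move=> jd; have [|q ->] := @grid_poly_div K N d n vx (n.-1 - j - d); first by lia.
have -> : gminor (gridX K vx) d.+1 id (addn (n.-1 - j - d)) =
    gminor (gridX K grid_rev) d.+1 (fun k => d - k)%N (fun k => n.-1 - (n.-1 - j - d + k))%N.
  congr determinant; apply/matrixP => k l; rewrite !mxE /gridX grid_revK //.
    by rewrite -ltnS.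
  by have := ltn_ord l; lia.
have [||q' ->] := @gminor_full _ (gridX K grid_rev) d j (fun k => d - k)%N (fun k => n.-1 - (n.-1 - j - d + k))%N.
- by move=> k _; apply: leq_subr.
- by move=> k kd; lia.
by exists (q * q'); rewrite mulrA.
Qed.

End SchubertPsi.

Lemma gminor_rev (R : comNzRingType) (X : nat -> nat -> R) t a b :
  gminor X t (fun k => a (t.-1 - k)%N) (fun k => b (t.-1 - k)%N) = gminor X t a b.
Proof.
have rE (k : 'I_t) : (t.-1 - k)%N = perm (@rev_ord_inj t) k.
  by rewrite permE /=; have := ltn_ord k; lia.
rewrite (@gminor_perm_rows _ X t (perm (@rev_ord_inj t)) a); last by move=> k; rewrite rE.
rewrite (@gminor_perm_cols _ X t (perm (@rev_ord_inj t)) a b); last by move=> k; rewrite rE.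
by rewrite mulrA -signr_addb addbb mul1r.
Qed.

Lemma facet_ideal_is_ideal (K : fieldType) d n (Delta : {set {set 'I_n}}) :
  is_ideal (fun h => h \in facet_ideal K d Delta).
Proof.
split; first exact: (rpred0 (gen_submod _)).
  by move=> u v hu hv; apply: (rpredD (hu : _ \in gen_submod _) hv).
by move=> a u hu; apply: gen_idealMr.
Qed.

Lemma gen_ideal_sub (R : comNzRingType) (G : R -> Prop) (I : R -> Prop) : is_ideal I ->
  (forall g, G g -> I g) -> forall h, h \in gen_ideal G -> I h.
Proof.
move=> iI GI h /asboolP[s [Gs ->]]; rewrite big_seq; apply: ideal_sum => // x xs.
by apply: (idealM iI); apply/GI/Gs.
Qed.

Lemma gen_ideal_gen (R : comNzRingType) (G : R -> Prop) g : G g -> g \in gen_ideal G.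
Proof.
move=> Gg; apply/asboolP; exists [:: (1, g)]; split; first by move=> x; rewrite inE => /eqP->.
by rewrite big_seq1 scale1r.
Qed.

(** * Polynomials and orders on the padded matrix *)

Section Embedding.
Variables (K : fieldType) (N N' : nat) (emb : 'I_N -> 'I_N').
Hypothesis emb_inj : injective emb.
Local Notation S := {mpoly K[N]}.
Local Notation S' := {mpoly K[N']}.

Definition emb_mnm (m : 'X_{1..N}) : 'X_{1..N'} := (\sum_k U_(emb k) *+ m k)%MM.
Definition pull_mnm (u : 'X_{1..N'}) : 'X_{1..N} := [multinom u (emb k) | k < N].

Definition emb_poly (h : S) : S' := h \mPo [tuple 'X_(emb k) | k < N].
Definition pull_var (l : 'I_N') : S := if [pick k | emb k == l] is Some k then 'X_k else 0.
Definition pull_poly (g : S') : S := g \mPo [tuple pull_var l | l < N'].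

Lemma pull_var_emb k : pull_var (emb k) = 'X_k.
Proof.
rewrite /pull_var; case: pickP => [k' /eqP /emb_inj -> //|none].
by have := none k; rewrite eqxx.
Qed.

Lemma emb_mnmE m k : emb_mnm m (emb k) = m k.
Proof.
rewrite mnm_sumE (bigD1 k) //= mulmnE mnm1E eqxx mul1n big1 ?addn0 // => l lk.
rewrite mulmnE mnm1E; case: eqP => [/emb_inj e|]; last by rewrite mul0n.
by rewrite e eqxx in lk.
Qed.

Lemma emb_mnm_out m l : (forall k, emb k != l) -> emb_mnm m l = 0%N.
Proof.
by move=> H; rewrite mnm_sumE big1 // => k _; rewrite mulmnE mnm1E (negPf (H k)).
Qed.

Lemma pull_mnmK : cancel emb_mnm pull_mnm.
Proof. by move=> m; apply/mnmP => k; rewrite mnmE emb_mnmE. Qed.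

Lemma pull_mnmD u v : pull_mnm (u + v)%MM = (pull_mnm u + pull_mnm v)%MM.
Proof. by apply/mnmP => k; rewrite !(mnmE, mnmDE). Qed.

Lemma emb_mnmM m p : emb_mnm (m *+ p)%MM = (emb_mnm m *+ p)%MM.
Proof.
apply/mnmP => l; rewrite mulmnE.
have [[k <-]|H] := pselect (exists k, emb k = l); first by rewrite !emb_mnmE mulmnE.
by rewrite !emb_mnm_out // => k; apply/eqP => e; apply: H; exists k.
Qed.

Lemma emb_polyX m : emb_poly 'X_[m] = 'X_[emb_mnm m].
Proof.
rewrite /emb_poly comp_mpolyX /emb_mnm -mprodXE.
by apply: eq_bigr => k _; rewrite tnth_mktuple mpolyXn.
Qed.

Lemma emb_polyXU k : emb_poly 'X_k = 'X_(emb k).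
Proof.
rewrite emb_polyX; congr 'X_[_]; rewrite /emb_mnm (bigD1 k) //= mnm1E eqxx mulm1n.
rewrite big1 ?addm0 // => l lk.
by rewrite mnm1E eq_sym (negPf lk) mulm0n.
Qed.

Lemma pull_polyX_emb m : pull_poly 'X_[emb_mnm m] = 'X_[m].
Proof.
rewrite /emb_mnm -mprodXE /pull_poly rmorph_prod [RHS]mpolyXE_id.
apply: eq_bigr => k _; rewrite -mpolyXn rmorphXn /= comp_mpolyXU.
by rewrite -tnth_nth tnth_mktuple pull_var_emb.
Qed.

Lemma emb_mnm_pull (u : 'X_{1..N'}) : (forall l, u l != 0%N -> exists k, emb k = l) ->
  emb_mnm (pull_mnm u) = u.
Proof.
move=> H; apply/mnmP => l.
have [[k <-]|n] := pselect (exists k, emb k = l); first by rewrite emb_mnmE mnmE.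
rewrite emb_mnm_out; first by apply/eqP; rewrite eq_sym; apply/negPn/negP => /H.
by move=> k; apply/eqP => e; apply: n; exists k.
Qed.

Lemma pull_polyX (u : 'X_{1..N'}) m : (pull_poly 'X_[u])@_m = (u == emb_mnm m)%:R.
Proof.
have [H|/existsNP[l /not_implyP[ul nl]]] := pselect (forall l, u l != 0%N -> exists k, emb k = l).
  rewrite -{1}(emb_mnm_pull H) pull_polyX_emb mcoeffX.
  by rewrite -{2}(emb_mnm_pull H) (can_eq pull_mnmK).
rewrite /pull_poly comp_mpolyX (bigD1 l) //= tnth_mktuple.
have -> : pull_var l = 0.
  by rewrite /pull_var; case: pickP => // k /eqP e; case: nl; exists k.
rewrite expr0n (negPf ul) mul0r mcoeff0; case: eqP => // e; exfalso.
move/eqP: ul; apply; rewrite e; apply: emb_mnm_out => k; apply/eqP => ek.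
by apply: nl; exists k.
Qed.

Lemma pull_polyE g : pull_poly g = \sum_(u <- msupp g) g@_u *: pull_poly 'X_[u].
Proof.
by rewrite {1}(mpolyE g) /pull_poly raddf_sum; apply: eq_bigr => u _; apply: comp_mpolyZ.
Qed.

Lemma emb_polyE h : emb_poly h = \sum_(m <- msupp h) h@_m *: 'X_[emb_mnm m].
Proof.
rewrite {1}(mpolyE h) /emb_poly raddf_sum; apply: eq_bigr => m _.
by rewrite -emb_polyX; apply: comp_mpolyZ.
Qed.

Lemma mcoeff_pull g m : (pull_poly g)@_m = g@_(emb_mnm m).
Proof.
rewrite pull_polyE [in RHS](mpolyE g) !raddf_sum /=.
by apply: eq_bigr => u _; rewrite !mcoeffZ mcoeffX pull_polyX.
Qed.

Lemma mcoeff_emb h u : (emb_poly h)@_u != 0 -> exists2 m, u = emb_mnm m & h@_m != 0.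
Proof.
rewrite emb_polyE raddf_sum /= => nz.
have [m mh] : exists2 m, m \in msupp h & (h@_m *: 'X_[emb_mnm m] : S')@_u != 0.
  apply: contrapT => H; move/eqP: nz; apply; rewrite big_seq big1 // => m mh.
  by apply/eqP/negPn/negP => nm; apply: H; exists m.
rewrite mcoeffZ mcoeffX; case: (_ =P u) => [e _|_]; last by rewrite mulr0 eqxx.
by exists m => //; rewrite -mcoeff_msupp.
Qed.

Lemma pull_polyK : cancel emb_poly pull_poly.
Proof.
move=> h; apply/mpolyP => m; rewrite mcoeff_pull emb_polyE [in RHS](mpolyE h) !raddf_sum /=.
by apply: eq_bigr => u _; rewrite !mcoeffZ !mcoeffX (can_eq pull_mnmK).
Qed.

Lemma pull_polyM : {morph pull_poly : x y / x * y}.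
Proof. by move=> x y; rewrite /pull_poly rmorphM. Qed.

Lemma pull_polyD : {morph pull_poly : x y / x + y}.
Proof. by move=> x y; rewrite /pull_poly rmorphD. Qed.

Section ExtendedOrder.
Variables (le : rel 'X_{1..N}) (w : 'I_N' -> nat).
Hypotheses (Hle : term_order le) (w0 : forall k, w (emb k) = 0%N).

(** The old variables weigh nothing, so [le] decides between old monomials, while the weight can
    decide wherever a new column occurs. The default order only separates monomials with the same
    old part. *)
Definition extended_order : rel 'X_{1..N'} := fun u v =>
  (mnm_weight w u < mnm_weight w v)%N ||
  (mnm_weight w u == mnm_weight w v) &&
  (if pull_mnm u == pull_mnm v then (u <= v)%O else le (pull_mnm u) (pull_mnm v)).

Lemma extended_order_term_order : term_order extended_order.
Proof.
split; split.
- by move=> u; rewrite /extended_order !eqxx Order.POrderTheory.lexx orbT.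
- move=> u v; rewrite /extended_order; case: (ltngtP (mnm_weight w u)) => //= _.
  rewrite [pull_mnm v == _]eq_sym.
  case: (eqVneq (pull_mnm u) (pull_mnm v)) => [_|ne]; first exact: Order.POrderTheory.le_anti.
  by move=> /(tle_anti Hle) e; rewrite e eqxx in ne.
- move=> v u t; rewrite /extended_order.
  case: (ltngtP (mnm_weight w u)) => //= [uv _|-> uv].
    by case: (ltngtP (mnm_weight w v)) => //= [vt _|<- _]; rewrite ?(ltn_trans uv vt) ?uv.
  case: (ltngtP (mnm_weight w v)) => //= _; move: uv.
  case: (eqVneq (pull_mnm u) (pull_mnm v)) => [->|nuv].
    by case: eqVneq => // _; apply: Order.POrderTheory.le_trans.
  case: (eqVneq (pull_mnm v) (pull_mnm t)) => [<-|nvt] luv; first by rewrite (negPf nuv).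
  move=> lvt; case: eqVneq => [e|_]; last exact: (tle_trans Hle) luv lvt.
  by rewrite e in luv nvt nuv; case/eqP: nvt; apply: (tle_eq Hle).
- move=> u v; rewrite /extended_order; case: ltngtP => //= _.
  rewrite [pull_mnm v == _]eq_sym; case: eqP => _; last exact: (tle_total Hle).
  exact: Order.TotalTheory.le_total.
- move=> m; rewrite /extended_order mnm_weight0 le0m.
  have -> : pull_mnm 0%MM = 0%MM by apply/mnmP => k; rewrite mnmE !mnm0E.
  by rewrite (tle0 Hle) if_same andbT orbC eq_sym; case: posnP.
- move=> m u v; rewrite /extended_order !mnm_weightD ltn_add2l eqn_add2l.
  rewrite !pull_mnmD lemc_add2r eqm_add2l.
  by case/orP=> [->//|/andP[->]] /=; case: ifP => _ H; rewrite ?H ?(tle_add2l Hle) ?orbT.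
Qed.

Lemma mnm_weight_emb m : mnm_weight w (emb_mnm m) = 0%N.
Proof.
rewrite /mnm_weight big1 // => l _.
have [[k <-]|n] := pselect (exists k, emb k = l); first by rewrite w0.
by rewrite emb_mnm_out ?muln0 // => k; apply/eqP => e; apply: n; exists k.
Qed.

Lemma extended_order_emb a b : extended_order (emb_mnm a) (emb_mnm b) = le a b.
Proof.
rewrite /extended_order !mnm_weight_emb ltnn eqxx /= !pull_mnmK.
by case: eqP => [->|//]; rewrite Order.POrderTheory.lexx (tle_refl Hle).
Qed.

Lemma extended_order_lt u v : (mnm_weight w u < mnm_weight w v)%N -> extended_order u v.
Proof. by rewrite /extended_order => ->. Qed.

Lemma monic_at_emb h m : monic_at le h m -> monic_at extended_order (emb_poly h) (emb_mnm m).
Proof.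
move=> [c l]; split; first by rewrite -mcoeff_pull pull_polyK.
by move=> u /mcoeff_emb[m' -> /l]; rewrite extended_order_emb.
Qed.

Lemma monic_at_pull g m : monic_at extended_order g (emb_mnm m) -> monic_at le (pull_poly g) m.
Proof.
move=> [c l]; split; first by rewrite mcoeff_pull.
by move=> m'; rewrite mcoeff_pull => /l; rewrite extended_order_emb.
Qed.

End ExtendedOrder.

End Embedding.

Lemma mxvec_index_inj m n (i i' : 'I_m) (j j' : 'I_n) :
  mxvec_index i j = mxvec_index i' j' -> i = i' /\ j = j'.
Proof. by move=> /cast_ord_inj /enum_rank_inj []. Qed.

(** This form of diagonality mentions no field, so it can be carried from [K] to a prime field. *)
Definition two_by_two_diagonal d n (le : rel 'X_{1..d.+1 * n}) : Prop :=
  forall (i i' : 'I_d.+1) (y y' : 'I_n), (i < i')%N -> (y < y')%N ->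
  le (U_(mxvec_index i y') + U_(mxvec_index i' y))%MM
     (U_(mxvec_index i y) + U_(mxvec_index i' y'))%MM.

Section Padding.
Variables (d n : nat).

(** Lowering the size of the minors from d+1 to 1 takes d columns on each side; the successor lets
    [inord] be used on columns. *)
Definition padded_width : nat := (d + n + d).+1.
Definition padded_grid (i y : nat) : 'I_(d.+1 * padded_width) :=
  mxvec_index (inord i : 'I_d.+1) (inord y : 'I_padded_width).

Definition pad (k : 'I_(d.+1 * n)) : 'I_(d.+1 * padded_width) :=
  let x := enum_val (cast_ord (esym (mxvec_cast d.+1 n)) k) in padded_grid x.1 (d + x.2).

Lemma pad_index i j : pad (mxvec_index i j) = padded_grid i (d + j).
Proof. by rewrite /pad /mxvec_index cast_ordK enum_rankK. Qed.

Lemma padded_grid_inj i y i' y' : (i <= d)%N -> (y < padded_width)%N ->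
  (i' <= d)%N -> (y' < padded_width)%N -> padded_grid i y = padded_grid i' y' ->
  i = i' /\ y = y'.
Proof.
move=> h1 h2 h3 h4 /mxvec_index_inj[e1 e2]; split.
  by move/(congr1 (@nat_of_ord _)): e1; rewrite !inordK.
by move/(congr1 (@nat_of_ord _)): e2; rewrite !inordK.
Qed.

Lemma pad_inj : injective pad.
Proof.
move=> k k'; case/mxvec_indexP: k => i j; case/mxvec_indexP: k' => i' j'.
rewrite !pad_index => /padded_grid_inj[||||ei ej].
- by rewrite -ltnS.
- by have := ltn_ord j; rewrite /padded_width; lia.
- by rewrite -ltnS.
- by have := ltn_ord j'; rewrite /padded_width; lia.
by congr mxvec_index; apply: val_inj => //=; lia.
Qed.

(* Supermodular, and strictly so as soon as one of the columns is a new one. *)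
Definition pad_weight : 'I_(d.+1 * padded_width) -> nat :=
  grid_weight d padded_width padded_grid
    (fun i y => (d - i) * (d - y) + i * (y.+1 - (d + n)))%N.

Lemma pad_weightE i y : (i <= d)%N -> (y < padded_width)%N ->
  pad_weight (padded_grid i y) = ((d - i) * (d - y) + i * (y.+1 - (d + n)))%N.
Proof. by move=> id yn; apply: (grid_weightE _ padded_grid_inj). Qed.

Lemma pad_weight0 k : pad_weight (pad k) = 0%N.
Proof.
case/mxvec_indexP: k => i j; have hi := ltn_ord i; have hj := ltn_ord j.
rewrite pad_index pad_weightE; [|lia|rewrite /padded_width; lia].
have -> : (d - (d + j) = 0)%N by lia.
have -> : ((d + j).+1 - (d + n) = 0)%N by lia.
by rewrite !muln0.
Qed.

Lemma diagonal_pairs_padded (le : rel 'X_{1..d.+1 * n}) : term_order le ->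
  two_by_two_diagonal le ->
  diagonal_pairs (extended_order pad le pad_weight) d padded_width padded_grid.
Proof.
move=> Hle H i i' y y' /andP[ii id] /andP[yy yn].
have [yd|dy] := ltnP y d; last first.
  have [yr|ry] := ltnP y' (d + n).
    have UE i0 y0 : (i0 <= d)%N -> (d <= y0 < d + n)%N -> exists (i1 : 'I_d.+1) (y1 : 'I_n),
        [/\ nat_of_ord i1 = i0, (d + y1 = y0)%N & padded_grid i0 y0 = pad (mxvec_index i1 y1)].
      move=> h1 h2; have i1 : (i0 < d.+1)%N by [].
      have y1 : (y0 - d < n)%N by lia.
      exists (Ordinal i1), (Ordinal y1); rewrite pad_index /=; split=> //; first lia.
      by congr padded_grid; lia.
    have [i1 [y1 [ei1 ey1 _]]] := UE i y ltac:(lia) ltac:(lia).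
    have [i2 [y2 [ei2 ey2 _]]] := UE i' y' ltac:(lia) ltac:(lia).
    have gE i0 y0 (i1' : 'I_d.+1) (y1' : 'I_n) : nat_of_ord i1' = i0 -> (d + y1' = y0)%N ->
       U_(padded_grid i0 y0)%MM = emb_mnm pad U_(mxvec_index i1' y1')%MM.
      move=> <- <-; rewrite -pad_index /emb_mnm (bigD1 (mxvec_index i1' y1')) //= mnm1E eqxx mulm1n.
      rewrite big1 ?addm0 // => l lk.
      by rewrite mnm1E eq_sym (negPf lk) mulm0n.
    have addE u v : (emb_mnm pad u + emb_mnm pad v = emb_mnm pad (u + v))%MM.
      by rewrite /emb_mnm -big_split; apply: eq_bigr => k _; apply/mnmP => l; rewrite !mnmDE !mulmnE mulnDr.
    rewrite (gE _ _ _ _ ei1 ey1) (gE _ _ _ _ ei2 ey2) (gE _ _ _ _ ei1 ey2) (gE _ _ _ _ ei2 ey1).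
    rewrite !addE (extended_order_emb pad_inj Hle pad_weight0); apply: H; lia.
  apply: extended_order_lt; rewrite !mnm_weightD !mnm_weightU !pad_weightE; [|lia..].
  set u := (d - y)%N; set u' := (d - y')%N; set v := (y.+1 - _)%N; set v' := (y'.+1 - _)%N.
  have h1 : (u' <= u)%N by rewrite /u /u'; lia.
  have h2 : (v < v')%N by rewrite /v /v'; lia.
  have -> : (d - i = (d - i') + (i' - i))%N by lia.
  nia.
apply: extended_order_lt; rewrite !mnm_weightD !mnm_weightU !pad_weightE; [|lia..].
set u := (d - y)%N; set u' := (d - y')%N; set v := (y.+1 - _)%N; set v' := (y'.+1 - _)%N.
have h1 : (u' < u)%N by rewrite /u /u'; lia.
have h2 : (v <= v')%N by rewrite /v /v'; lia.
have -> : (d - i = (d - i') + (i' - i))%N by lia.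
nia.
Qed.

End Padding.

Definition rowwise_weight d n (k : 'I_(d.+1 * n)) : nat :=
  let x := enum_val (cast_ord (esym (mxvec_cast d.+1 n)) k) in (x.1 * x.2)%N.

Lemma rowwise_weight_diagonal d n : two_by_two_diagonal (weight_order (@rowwise_weight d n)).
Proof.
move=> i i' y y' ii yy; apply: weight_order_lt; rewrite !mnm_weightD !mnm_weightU.
rewrite /rowwise_weight /mxvec_index !cast_ordK !enum_rankK /=.
nia.
Qed.

(** * The splitting and the facet ideal *)

Section Splitting.
Variables (K : fieldType) (p : nat) (piK : K -> K) (d n : nat).
Hypotheses (pK : p \in [pchar K]) (HpiK : frob_retract p piK).
Local Notation S := {mpoly K[d.+1 * n]}.
Local Notation N' := (d.+1 * padded_width d n)%N.
Local Notation S' := {mpoly K[N']}.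
Local Notation vx := (@padded_grid d n).
Local Notation f := (grid_poly K d (padded_width d n) vx).
Local Notation psi' := (psi p piK (f ^+ p.-1)).
Local Notation io := (@emb_poly K _ _ (@pad d n)).
Local Notation pl := (@pull_poly K _ _ (@pad d n)).

(** Setting the new variables to zero is a ring morphism and a left inverse of the embedding, so the
    rule psi(a^p h) = a psi(h) is inherited. *)
Definition splitting (h : S) : S := pl (psi' (io h)).

Lemma splittingD : {morph splitting : x y / x + y}.
Proof.
move=> x y; rewrite /splitting /emb_poly rmorphD psiD //; exact: pull_polyD.
Qed.

Lemma splittingM a h : splitting (a ^+ p * h) = a * splitting h.
Proof.
rewrite /splitting /emb_poly rmorphM rmorphXn psiM // pull_polyM.
by congr (_ * _); apply: (pull_polyK (@pad_inj d n)).
Qed.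

Lemma monic_at_splitting le h m : term_order le -> two_by_two_diagonal le ->
  monic_at le h (m *+ p)%MM -> monic_at le (splitting h) m.
Proof.
move=> Hle H2 hm; apply: (monic_at_pull (@pad_inj d n) Hle (@pad_weight0 d n)).
have Ht := extended_order_term_order (@pad d n) (@pad_weight d n) Hle.
apply: (monic_at_psi pK HpiK Ht).
  apply: monic_at_grid_poly => //; first exact: padded_grid_inj.
  exact: diagonal_pairs_padded.
rewrite -emb_mnmM; last exact: pad_inj.
exact: (monic_at_emb (@pad_inj d n) Hle (@pad_weight0 d n)).
Qed.

(** For one diagonal order, the image of 1 has the trivial monomial as initial monomial, with
    coefficient 1; this monomial being the least, nothing else occurs. *)
Lemma splitting1 : splitting 1 = 1.
Proof.
have Hle := weight_order_term_order (@rowwise_weight d n).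
have H : monic_at (weight_order (@rowwise_weight d n)) (1 : S) (0 *+ p)%MM.
  have -> : (0 *+ p = 0 :> 'X_{1..d.+1 * n})%MM.
    by apply/mnmP => i; rewrite mulmnE mnm0E.
  exact: monic_at1.
have [c l] := monic_at_splitting Hle (@rowwise_weight_diagonal d n) H.
apply/mpolyP => m; rewrite mcoeff1; case: eqP => [->|ne] //.
apply/eqP; apply/negPn/negP => /l /(tle_eq Hle) /(_ (tle0 Hle m)).
exact: ne.
Qed.

Variable Delta : {set {set 'I_n}}.
Local Notation J := (facet_ideal K d Delta).

Lemma emb_minor (a : 'I_d.+1 -> 'I_n) :
  io (minor K id a) = gminor (gridX K vx) d.+1 id (fun k => d + a (inord k))%N.
Proof.
rewrite /minor /emb_poly -det_map_mx; congr determinant; apply/matrixP => i j.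
rewrite !mxE /xvar /gridX; apply: etrans (emb_polyXU K (@pad d n) _) _.
by rewrite pad_index inord_val.
Qed.

Lemma pull_minor (b : nat -> nat) (a : 'I_d.+1 -> 'I_n) :
  (forall k : 'I_d.+1, b k = (d + a k)%N) ->
  pl (gminor (gridX K vx) d.+1 id b) = minor K id a.
Proof.
move=> bE; rewrite (@eq_gminor _ _ _ id b id (fun k => d + a (inord k))%N) //.
  by rewrite -emb_minor (pull_polyK (@pad_inj d n)).
by move=> k kd; rewrite -bE inordK.
Qed.

Lemma pull_ideal : is_ideal (fun g : S' => pl g \in J).
Proof.
have [h0 hD hM] := facet_ideal_is_ideal K d Delta; split.
- by rewrite /pull_poly rmorph0.
- by move=> u v hu hv; rewrite pull_polyD; apply: hD.
- by move=> a u hu; rewrite pull_polyM; apply: hM.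
Qed.

Lemma facet_minor (a : 'I_d.+1 -> 'I_n) : increasing a -> vset a \in Delta ->
  minor K id a \in J.
Proof. by move=> ia aD; apply: gen_ideal_gen; exists a. Qed.

Lemma pull_schubert c al : (forall b, column_bounded d c al b -> exists a,
    [/\ increasing a, vset a \in Delta & forall k : 'I_d.+1, b k = (d + a k)%N]) ->
  forall g, schubert_ideal d vx c al g -> pl g \in J.
Proof.
move=> H g Hg; apply: (Hg _ pull_ideal) => b /H[a [ia aD bE]].
by rewrite (pull_minor bE); apply: facet_minor.
Qed.

Lemma gminor_grid_rev b : (forall k, (k <= d)%N -> (b k < padded_width d n)%N) ->
  gminor (gridX K (grid_rev d (padded_width d n) vx)) d.+1 id b =
  gminor (gridX K vx) d.+1 id (fun k => (padded_width d n).-1 - b (d - k))%N.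
Proof.
move=> Hb; rewrite -(gminor_rev (gridX K vx)) /=.
congr determinant; apply/matrixP => i j; rewrite !mxE /gridX /grid_rev.
by rewrite subKn // -ltnS.
Qed.

Lemma pull_schubert_rev c al :
  (forall k, (k <= d)%N -> (al k < padded_width d n)%N) ->
  (forall b, column_bounded d c al b -> exists a,
    [/\ increasing a, vset a \in Delta &
        forall k : 'I_d.+1, ((padded_width d n).-1 - b (d - k) = d + a k)%N]) ->
  forall g, schubert_ideal d (grid_rev d (padded_width d n) vx) c al g -> pl g \in J.
Proof.
move=> Hal H g Hg; apply: (Hg _ pull_ideal) => b Hb; have [a [ia aD bE]] := H b Hb.
rewrite gminor_grid_rev; last first.
  by move=> k kd; have [_ /(_ k kd) /andP[_ h]] := Hb; apply: leq_ltn_trans h (Hal k kd).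
by rewrite (pull_minor bE); apply: facet_minor.
Qed.

Hypothesis HDelta : semi_closed d Delta.

(** The minor of each facet lies in a stable ideal of bounded minors, and semi-closedness says
    exactly that this ideal is sent into [J] by [pull_poly]. *)
Lemma splitting_minor (a : 'I_d.+1 -> 'I_n) h : increasing a -> vset a \in Delta ->
  splitting (h * minor K id a) \in J.
Proof.
move=> ia aD.
have amono i j : (i <= j)%N -> (j <= d)%N -> (a (inord i) <= a (inord j))%N.
  rewrite leq_eqVlt => /orP[/eqP->//|ij] jd; apply/ltnW/ia.
  by rewrite !inordK //; lia.
have an k : (a k < n)%N by apply: ltn_ord.
have a0 : a (inord 0) = a ord0 by congr (a _); apply: val_inj; rewrite /= inordK.
have ad : a (inord d) = a ord_max by congr (a _); apply: val_inj; rewrite /= inordK.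
have ioE : io (h * minor K id a) = io h * io (minor K id a) by rewrite /emb_poly rmorphM.
have ext (b : nat -> nat) : (forall i j, (i < j <= d)%N -> (b i < b j)%N) ->
    (forall k, (k <= d)%N -> (d <= b k < d + n)%N) -> exists i : 'I_d.+1 -> 'I_n,
    increasing i /\ forall k : 'I_d.+1, b k = (d + i k)%N.
  move=> binc bb; have [n0|n0] := posnP n; first by have := bb 0%N isT; lia.
  have kd (k : 'I_d.+1) : (k <= d)%N by rewrite -ltnS.
  have bn (k : 'I_d.+1) : (b k - d < n)%N by have := bb k (kd k); lia.
  exists (fun k => Ordinal (bn k)); split.
    move=> i j ij /=; have := bb i (kd i); have := bb j (kd j).
    by have := binc i j; rewrite ij (kd j) => /(_ isT); lia.
  by move=> k /=; have := bb k (kd k); lia.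
case: (HDelta ia aD) => Hsc.
  (* Truncating at d makes [al] monotone on all naturals. As [al 0] equals the left bound, the first
     vertex is forced to be a_0. *)
  pose al k := (d + a (inord (minn k d)))%N.
  apply: (@pull_schubert (d + a ord0) al).
    move=> b [binc bb]; have [|i [ii iE]] := ext b binc.
      by move=> k kd; have := bb k kd; rewrite /al; have := an (inord (minn k d)); lia.
    exists i; split=> //; apply: Hsc => //.
      apply: val_inj => /=; have := iE ord0; rewrite /= => e0.
      by have := bb 0%N isT; rewrite /al min0n a0 e0; lia.
    move=> k; have kd : (k <= d)%N by rewrite -ltnS.
    by have := bb k kd; rewrite /al (minn_idPl kd) inord_val iE; lia.
  apply: (schubert_psi_grid pK HpiK (@padded_grid_inj d n)).
  - by move=> i j ij; rewrite /al leq_add2l; apply: amono; lia.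
  - lia.
  - by rewrite /al minnn /padded_width; have := an (inord d); lia.
  rewrite ioE emb_minor; apply: (idealM (schubert_ideal_ideal K d _ _ _)).
  apply: schubert_ideal_gen; split.
    by move=> i j /andP[ij jd]; rewrite ltn_add2l; apply: ia; rewrite !inordK //; lia.
  move=> k kd; rewrite /al (minn_idPl kd) leqnn andbT leq_add2l -a0.
  by apply: amono.
(* After the half-turn the facet is read from its last vertex, and the fixed a_d becomes the left
   bound [c]. *)
pose al k := ((padded_width d n).-1 - (d + a (inord (d - k))))%N.
pose c := ((padded_width d n).-1 - (d + a ord_max))%N.
apply: (@pull_schubert_rev c al).
- by move=> k kd; rewrite /al /padded_width; lia.
- move=> b [binc bb]; have [||i [ii iE]] := ext (fun k => (padded_width d n).-1 - b (d - k))%N.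
  + move=> i j ij; have := binc (d - j)%N (d - i)%N; have := bb (d - i)%N (leq_subr _ _).
    by rewrite /al /padded_width; lia.
  + move=> k kd; have := bb (d - k)%N (leq_subr _ _); rewrite /al /c /padded_width.
    by have := an ord_max; have := an (inord (d - (d - k))); lia.
  exists i; split=> //; apply: Hsc => //.
    apply: val_inj; have := iE ord_max => /=; have := bb 0%N isT.
    by rewrite /al /c subn0 ad subnn /padded_width; have := an ord_max; lia.
  move=> k; have kd : (k <= d)%N by rewrite -ltnS.
  have := iE k => /=; have := bb (d - k)%N (leq_subr _ _).
  by rewrite /al subKn // inord_val /padded_width; have := an k; lia.
apply: (schubert_psi_grid_rev pK HpiK (@padded_grid_inj d n)).
- by move=> i j ij; rewrite /al leq_sub2l // leq_add2l; apply: amono; lia.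
- by rewrite /c /padded_width; have := an ord_max; lia.
- by rewrite /al subnn /padded_width; lia.
have -> : io (h * minor K id a) = io h *
    gminor (gridX K (grid_rev d (padded_width d n) vx)) d.+1 id al.
  rewrite ioE emb_minor; congr (_ * _); rewrite gminor_grid_rev.
    apply: eq_gminor => // k kd; rewrite /al.
    have -> : (d - (d - k) = k)%N by lia.
    by rewrite subKn // /padded_width; have := an (inord k); lia.
  by move=> k kd; rewrite /al /padded_width; lia.
apply: (idealM (schubert_ideal_ideal K d _ _ _)).
apply: schubert_ideal_gen; split.
  move=> i j /andP[ij jd]; rewrite /al.
  have : (a (inord (d - j)) < a (inord (d - i)))%N by apply: ia; rewrite !inordK //; lia.
  by have := an (inord (d - i)); rewrite /padded_width; lia.
move=> k kd; rewrite leqnn andbT /c /al leq_sub2l // leq_add2l -ad.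
by apply: amono; lia.
Qed.

Lemma splitting_facet_ideal h : h \in J -> splitting h \in J.
Proof.
have [h0 hD hM] := facet_ideal_is_ideal K d Delta.
move=> /asboolP[s [Gs ->]].
have s0 : splitting 0 = 0 by apply: (addIr (splitting 0)); rewrite -splittingD !add0r.
rewrite (big_morph _ splittingD s0) big_seq.
apply: (ideal_sum (facet_ideal_is_ideal K d Delta)) => x /Gs[a [ia aD ->]].
exact: splitting_minor.
Qed.

End Splitting.

(** * F-purity *)

(** Zorn's lemma gives a maximal subspace H of [K], over the subfield of p-th powers, that avoids 1.
    It is a complement of this subfield, and the value at x is the c with x - c^p in H. *)
Lemma exists_frob_retract (K : fieldType) p : p \in [pchar K] ->
  exists piK : K -> K, frob_retract p piK.
Proof.
move=> pK.
have FD (a b : K) : (a + b) ^+ p = a ^+ p + b ^+ p.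
  by rewrite -!(pFrobenius_autE pK) rmorphD.
have FB (a b : K) : (a - b) ^+ p = a ^+ p - b ^+ p.
  by rewrite -!(pFrobenius_autE pK) rmorphB.
have p0 : (0 < p)%N by case/andP: pK => /prime_gt0.
have F0 : 0 ^+ p = 0 :> K by rewrite expr0n gtn_eqF.
pose P (H : K -> Prop) := [/\ forall a b, H a -> H b -> H (a + b),
  forall a h, H h -> H (a ^+ p * h) & ~ H 1].
have [H [[HD HM H1] Hmax]] : exists H, P H /\ forall H', classical_sets.proper H H' -> ~ P H'.
  apply: classical_sets.Zorn_bigcup => C CP tot; split.
  - move=> a b [X CX Xa] [Y CY Yb]; case: (tot X Y CX CY) => sub.
      by exists Y => //; have [YD _ _] := CP Y CY; apply: YD => //; apply: sub.
    by exists X => //; have [XD _ _] := CP X CX; apply: XD => //; apply: sub.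
  - by move=> a h [X CX Xh]; exists X => //; have [_ XM _] := CP X CX; apply: XM.
  - by case=> X CX X1; have [_ _ []] := CP X CX.
(* [P] does not ask for 0, so that the empty set, the union of the empty chain, satisfies it;
   maximality supplies 0. *)
have H0 : H 0.
  apply: contrapT => nH0; apply: (Hmax (fun x => x = 0 \/ H x)).
    split; first by move=> x Hx; right.
    by move=> sub; apply: nH0; apply: sub; left.
  split.
  - move=> a b [->|Ha] [->|Hb]; rewrite ?add0r ?addr0; [by left|by right|by right|].
    by right; apply: HD.
  - by move=> a h [->|Hh]; [left; rewrite mulr0|right; apply: HM].
  - by case=> [/eqP|//]; rewrite oner_eq0.
have HN h : H h -> H (- h).
  move=> Hh; have -> : - h = (-1) ^+ p * h; last exact: HM.
  by rewrite -[-1]sub0r FB F0 expr1n sub0r mulN1r.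
have ex x : exists c, H (x - c ^+ p).
  have [Hx|nHx] := pselect (H x); first by exists 0; rewrite F0 subr0.
  (* Otherwise the span of H and x would be a larger subspace avoiding 1. *)
  have [h [a [Hh e]]] : exists h a, H h /\ 1 = h + a ^+ p * x.
    apply: contrapT => none; apply: (Hmax (fun y => exists h a, H h /\ y = h + a ^+ p * x)).
      split; first by move=> y Hy; exists y, 0; rewrite F0 mul0r addr0.
      move=> sub; apply: nHx; apply: sub; exists 0, 1.
      by rewrite expr1n mul1r add0r.
    split=> //.
    - move=> _ _ [h [a [Hh ->]]] [h' [a' [Hh' ->]]]; exists (h + h'), (a + a').
      by split; [apply: HD|rewrite FD mulrDl addrACA].
    - move=> b _ [h [a [Hh ->]]]; exists (b ^+ p * h), (b * a).
      by split; [apply: HM|rewrite exprMn mulrDr mulrA].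
  have a0 : a != 0.
    by apply/eqP => a0; apply: H1; rewrite e a0 F0 mul0r addr0.
  exists (a^-1); have -> : x - a^-1 ^+ p = - (a^-1 ^+ p * h).
    have -> : h = 1 - a ^+ p * x by rewrite e addrK.
    rewrite mulrBr mulr1 mulrA -exprMn mulVf // expr1n mul1r.
    by rewrite opprB.
  by apply: HN; apply: HM.
have uniq x c e : H (x - c ^+ p) -> H (x - e ^+ p) -> c = e.
  move=> hc he; apply/eqP; rewrite -subr_eq0; apply/negPn/negP => ne.
  apply: H1; rewrite -(expr1n K p) -(mulVf ne) exprMn; apply: HM.
  have -> : (c - e) ^+ p = (x - e ^+ p) + - (x - c ^+ p).
    by rewrite FB opprB addrACA [- _ + _]addrC addrACA subrr add0r addrC.
  by apply: HD => //; apply: HN.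
have [piK pi_ok] := choice ex; exists piK; split.
- move=> a b; apply: (uniq (a + b)) => //.
  by rewrite FD opprD addrACA; apply: HD.
- move=> a b; apply: (uniq (a ^+ p * b)) => //.
  by rewrite exprMn -mulrBr; apply: HM.
- by apply: (uniq 1) => //; rewrite expr1n subrr.
Qed.

Module FreeModuleTheory.
Import finmap monalg.

Lemma free_module_lift (R : nzRingType) (T : choiceType) (V : lmodType R) (h : T -> V) :
  exists L : free_module R T -> V,
    (forall a u v, L (a *: u + v) = a *: L u + L v) /\ forall t, L (free_gen R t) = h t.
Proof.
pose L (g : {malg R[T]}) : V := \sum_(k <- msupp g) mcoeff k g *: h k.
(* Sums over different supports are compared over a common larger set. *)
have LE (D : {fset T}) (g : {malg R[T]}) : (msupp g `<=` D)%fset -> L g = \sum_(k <- D) mcoeff k g *: h k.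
  move=> sub; rewrite /L (big_fset_incl _ sub) // => k kD /mcoeff_outdom ->.
  by rewrite scale0r.
exists L; split.
  move=> a u v; pose D := (msupp u `|` msupp v `|` msupp (a *: u + v))%fset.
  have hu : (msupp u `<=` D)%fset by rewrite /D -fsetUA fsubsetUl.
  have hv : (msupp v `<=` D)%fset by rewrite /D [(msupp u `|` _)%fset]fsetUC -fsetUA fsubsetUl.
  have hw : (msupp (a *: u + v) `<=` D)%fset by rewrite /D fsubsetUr.
  rewrite (LE _ _ hu) (LE _ _ hv) (LE _ _ hw).
  rewrite scaler_sumr -big_split; apply: eq_bigr => k _ /=.
  by rewrite mcoeffD mcoeffZ scalerDl scalerA.
move=> t; rewrite (LE [fset t]%fset); last exact: msuppU_le.
by rewrite big_seq_fset1 mcoeffUU scale1r.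
Qed.

End FreeModuleTheory.

(** The map [phi] induces x tensor m |-> phi(x) m from the tensor product to [M], a left inverse of
    m |-> 1 tensor m. *)
Lemma F_pure_split (R : comNzRingType) p (phi : R -> R) : p \in [pchar R] ->
  {morph phi : x y / x + y} -> (forall x y, phi (x ^+ p * y) = x * phi y) -> phi 1 = 1 ->
  F_pure p R.
Proof.
move=> pR phiD phiM phi1; exists pR => M m m' /eqP.
rewrite /frob_tensor /tens tensor_piE => H.
have [L [Llin Lgen]] := FreeModuleTheory.free_module_lift
  (fun x : (Fstar pR * M)%type => phi (x.1 : R) *: x.2).
have L0 : L 0 = 0.
  by have := Llin (-1) 0 0; rewrite scaler0 addr0 scaleN1r addNr.
have LD u v : L (u + v) = L u + L v by have := Llin 1 u v; rewrite !scale1r.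
have LZ a u : L (a *: u) = a *: L u by have := Llin a u 0; rewrite !addr0 L0 addr0.
have LB u v : L (u - v) = L u - L v by rewrite LD -scaleN1r LZ scaleN1r.
have Lp a b : L (free_pair a b) = phi (a : R) *: b by rewrite /free_pair Lgen.
have Lrel g : bilinear_relation g -> L g = 0.
  case=> [a a' b|a b b'|r a b|r a b].
  - by rewrite LB LD !Lp phiD scalerDl subrr.
  - by rewrite LB LD !Lp scalerDr subrr.
  - rewrite LB LZ !Lp; have -> : phi (r *: a : Fstar pR) = r * phi a := phiM r a.
    by rewrite scalerA subrr.
  - by rewrite LB LZ !Lp !scalerA mulrC subrr.
have : L (free_pair (frob pR 1) m - free_pair (frob pR 1) m') = 0.
  case/asboolP: H => s [Gs ->]; elim: s Gs => [|x s IH] Gs; first by rewrite big_nil.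
  rewrite big_cons LD LZ Lrel ?scaler0 ?add0r; last by apply: Gs; rewrite mem_head.
  by apply: IH => y ys; apply: Gs; rewrite inE ys orbT.
rewrite LB !Lp (_ : phi _ = 1) ?scale1r; first by move/eqP; rewrite subr_eq0 => /eqP.
by rewrite /frob expr1n.
Qed.

(** * Reduction to positive characteristic *)

(** The transformations of the Smith normal form are invertible over the integers, hence over every
    field. Solvability then decouples: each coordinate of the right-hand side must vanish where its
    divisor does. *)
Lemma matrix_int_submx m n (A : 'M[int]_(m, n)) (e : 'rV[int]_n) :
  exists q : seq (int * int), forall F : fieldType,
    (map_mx intr e <= (map_mx intr A : 'M[F]_(m, n)))%MS <->
    forall y, y \in q -> y.1%:~R = 0 :> F -> y.2%:~R = 0 :> F.
Proof.
have [L uL [R uR [s _ AE]]] := int_Smith_normal_form A.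
have [b ->] : exists b, e = b *m R by exists (e *m invmx R); rewrite mulmxKV.
(* Past the last row there is no divisor, and the value 0 requires the coordinate itself to
   vanish. *)
exists [seq (if (j < m)%N then s`_j else 0, b 0 j) | j : 'I_n] => F.
have unit_map k (M : 'M[int]_k) : M \in unitmx -> (map_mx intr M : 'M[F]_k) \in unitmx.
  by rewrite !unitmxE det_map_mx; apply: rmorph_unit.
rewrite AE !map_mxM submxMfree; last by rewrite row_free_unit unit_map.
set D := map_mx _ (\matrix_(_, _) _).
have fullL : row_full (map_mx intr L : 'M[F]_m) by rewrite row_full_unit unit_map.
rewrite (eqmxMfull D fullL).
have DE i j : D i j = (s`_i)%:~R *+ (i == j :> nat) by rewrite !mxE; case: eqP.
split.
  case/submxP => x /matrixP bE _ /codomP[j ->] /= y0.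
  have := bE 0 j; rewrite !mxE => ->; apply: big1 => i _; rewrite DE.
  case: eqP => [ij|_]; last by rewrite mulr0.
  by move: y0; rewrite -ij ltn_ord mulr1n => ->; rewrite mulr0.
move=> H; apply/submxP.
(* Division by a divisor that vanishes in [F] gives 0, which is right because the coordinate then
   vanishes too. *)
exists (\row_i (if insub (i : nat) is Some j then (b 0 j)%:~R / (s`_i)%:~R else 0)).
apply/matrixP => i0 j; rewrite !mxE (ord1 i0).
rewrite [LHS](_ : _ = (b 0 j)%:~R) //.
have Hj := H _ (codom_f _ j); rewrite /= in Hj.
have [jm|mj] := ltnP j m; last first.
  rewrite (Hj _) ?big1 //; last by rewrite ltnNge mj.
  move=> i _; rewrite DE; case: eqP => [ij|_]; last by rewrite mulr0.
  by have := ltn_ord i; rewrite ij ltnNge mj.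
rewrite (bigD1 (Ordinal jm)) //= big1 ?addr0; last first.
  move=> i ij; rewrite DE; case: eqP => [e1|_]; last by rewrite mulr0.
  by case/eqP: ij; apply: val_inj.
rewrite DE /= eqxx mulr1n mxE (_ : insub _ = Some j); last exact: (valK j).
rewrite jm in Hj; have [s0|s0] := eqVneq (s`_j)%:~R (0 : F); last by rewrite divfK.
by rewrite s0 mulr0; apply: Hj.
Qed.

Lemma linear_system_int (T C : finType) (A : T -> C -> int) (e : C -> int) :
  exists q : seq (int * int), forall F : fieldType,
    (exists x : T -> F, forall c, \sum_t x t * (A t c)%:~R = (e c)%:~R) <->
    forall y, y \in q -> y.1%:~R = 0 :> F -> y.2%:~R = 0 :> F.
Proof.
have [q H] := matrix_int_submx (\matrix_(i < #|T|, j < #|C|) A (enum_val i) (enum_val j))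
  (\row_j e (enum_val j)).
exists q => F; rewrite -H; split.
  case=> x xE; apply/submxP; exists (\row_i x (enum_val i)).
  apply/matrixP => i0 j; rewrite !mxE -xE (reindex (@enum_val T T)) /=; last first.
    by apply: onW_bij; apply: enum_val_bij.
  by apply: eq_bigr => i _; rewrite !mxE.
case/submxP => x /matrixP xE; exists (fun t => x 0 (enum_rank t)) => c.
have := xE 0 (enum_rank c); rewrite !mxE enum_rankK => ->.
rewrite (reindex (@enum_val T T)) /=; last by apply: onW_bij; apply: enum_val_bij.
by apply: eq_bigr => i _; rewrite !mxE enum_valK enum_rankK.
Qed.

(** Beyond the sum of the absolute values of the integers involved, p divides none of the nonzero
    ones, so they vanish in the prime field exactly when they do in [K]. *)
Lemma linear_system_modp (K : fieldType) (T C : finType) (A : T -> C -> int) (e : C -> int) :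
  (forall p, p \notin [pchar K]) -> exists B, forall p, (B < p)%N -> prime p ->
    (exists x : T -> K, forall c, \sum_t x t * (A t c)%:~R = (e c)%:~R) <->
    (exists x : T -> 'F_p, forall c, \sum_t x t * (A t c)%:~R = (e c)%:~R).
Proof.
move=> K0; have [q H] := linear_system_int A e.
exists (\sum_(y <- q) (`|y.1| + `|y.2|))%N => p Bp pr; rewrite !H.
have intK (z : int) : z%:~R = 0 :> K -> z = 0.
  move=> z0; have : (`|z|%N)%:R == 0 :> K.
    by case: (intP z) z0 => [|k|k] //=; rewrite ?mulrNz ?abszN /= => /eqP; rewrite ?oppr_eq0.
  have h0 : has_char0 K by move=> l; rewrite inE; apply/negbTE/K0.
  by rewrite (iffLR (pcharf0P K) h0) absz_eq0 => /eqP.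
have intF (z : int) : (`|z| < p)%N -> z%:~R = 0 :> 'F_p -> z = 0.
  move=> zp z0; have : (`|z|%N)%:R == 0 :> 'F_p.
    by case: (intP z) z0 => [|k|k] //=; rewrite ?mulrNz ?abszN /= => /eqP; rewrite ?oppr_eq0.
  rewrite -(dvdn_pcharf (pchar_Fp pr)) => dv; apply/eqP; rewrite -absz_eq0.
  by apply: contraLR dv => z1; apply: contraTN zp => /dvdn_leq; rewrite -leqNgt; apply; rewrite lt0n.
have bd y : y \in q -> (`|y.1| < p)%N /\ (`|y.2| < p)%N.
  move=> yq; have : (`|y.1| + `|y.2| < p)%N.
    by apply: leq_ltn_trans Bp; rewrite (big_rem y yq) /= leq_addr.
  lia.
split=> Hy y yq y0; have [b1 b2] := bd y yq.
  by rewrite (intK y.2) // Hy // (intF _ b1 y0).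
by rewrite (intF y.2) // Hy // (intK _ y0).
Qed.

Section MinorCoefficients.
Variables (d n : nat).
Local Notation N := (d.+1 * n)%N.

Definition transversal_mnm (a : 'I_d.+1 -> 'I_n) (s : 'S_d.+1) : 'X_{1..N} :=
  (\sum_i U_(mxvec_index i (a (s i))))%MM.

Definition minor_coef (a : 'I_d.+1 -> 'I_n) (c : 'X_{1..N}) : int :=
  \sum_(s : 'S_d.+1) (-1) ^+ s *+ (transversal_mnm a s == c).

Lemma mdeg_transversal a s : mdeg (transversal_mnm a s) = d.+1.
Proof.
rewrite /transversal_mnm mdeg_sum (eq_bigr (fun=> 1%N)) ?sum1_card ?card_ord //.
by move=> i _; rewrite mdeg1.
Qed.

Lemma minor_coef_eq0 a c : mdeg c != d.+1 -> minor_coef a c = 0.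
Proof.
move=> cd; apply: big1 => s _; case: eqP => // e.
by rewrite -e mdeg_transversal eqxx in cd.
Qed.

Lemma mcoeff_minor (F : fieldType) a c : (minor F id a)@_c = (minor_coef a c)%:~R.
Proof.
rewrite /minor /determinant raddf_sum /= rmorph_sum; apply: eq_bigr => s _.
have -> : \prod_i mxsub id a (Xmx F d n) i (s i) = 'X_[transversal_mnm a s].
  rewrite /transversal_mnm (big_morph _ (@mpolyXD _ F) (@mpolyX0 _ F)).
  by apply: eq_bigr => i _; rewrite !mxE.
rewrite -[(-1) ^+ s](rmorph_sign (mpolyC N (R:=F))) mcoeffCM mcoeffX.
by rewrite rmorphMn rmorph_sign /= mulr_natr.
Qed.

End MinorCoefficients.

Section FacetSystem.
Variables (d n : nat) (Delta : {set {set 'I_n}}) (le : rel 'X_{1..d.+1 * n}).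
Variable m : 'X_{1..d.+1 * n}.
Local Notation N := (d.+1 * n)%N.
Local Notation C := 'X_{1..N < (mdeg m).+1}.
Local Notation T := (C * {ffun 'I_d.+1 -> 'I_n})%type.

(** The unknown of t = (u, a) is the coefficient of x^u [a]. Only products of the degree of [m]
    matter, because the generators are homogeneous; the other pairs get zero coefficients. *)
Definition valid_row (t : T) : bool :=
  [&& `[< increasing t.2 >], vset t.2 \in Delta & mdeg t.1 + d.+1 == mdeg m]%N.

Definition system_coef (t : T) (c : 'X_{1..N}) : int :=
  if valid_row t && (t.1 <= c)%MM then minor_coef t.2 (c - t.1)%MM else 0.

Definition system_row (t : T) (c : C) : int := if le m c then system_coef t c else 0.

Lemma mcoeff_row (F : fieldType) (t : T) c : valid_row t ->
  ('X_[t.1] * minor F id t.2)@_c = (system_coef t c)%:~R.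
Proof. by move=> vt; rewrite mcoeffXM /system_coef vt; case: ifP; rewrite ?mcoeff_minor. Qed.

Lemma system_coef_eq0 t c : mdeg c != mdeg m -> system_coef t c = 0.
Proof.
move=> cm; rewrite /system_coef; case: ifP => // /andP[/and3P[_ _ /eqP tm] tc].
apply: minor_coef_eq0; apply: contraNneq cm => e.
have <- : (mdeg t.1 + mdeg (c - t.1)%MM = mdeg c)%N by rewrite -mdegD addmC submK.
by rewrite e tm.
Qed.

Lemma facet_ideal_span (F : fieldType) f : f \in facet_ideal F d Delta ->
  exists x : T -> F, forall c, mdeg c = mdeg m -> f@_c = \sum_t x t * (system_coef t c)%:~R.
Proof.
pose Q (h : {mpoly F[N]}) := exists x : T -> F, forall c, mdeg c = mdeg m ->
  h@_c = \sum_t x t * (system_coef t c)%:~R.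
have Q0 : Q 0.
  by exists (fun=> 0) => c _; rewrite mcoeff0 big1 // => t _; rewrite mul0r.
have QD h h' : Q h -> Q h' -> Q (h + h').
  move=> [x xE] [y yE]; exists (fun t => x t + y t) => c cm.
  by rewrite mcoeffD xE // yE // -big_split; apply: eq_bigr => t _; rewrite mulrDl.
have QZ k h : Q h -> Q (k *: h).
  move=> [x xE]; exists (fun t => k * x t) => c cm.
  by rewrite mcoeffZ xE // mulr_sumr; apply: eq_bigr => t _; rewrite mulrA.
move=> /asboolP[s [Gs ->]]; rewrite big_seq.
elim/big_ind: _ => // -[g y] /Gs[a [ia aD /= ->]].
rewrite [_ *: _](_ : _ = g * minor F id a) // [g]mpolyE mulr_suml; elim/big_ind: _ => // u _.
rewrite -scalerAl; apply: QZ.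
have [um|um] := eqVneq (mdeg u + d.+1)%N (mdeg m); last first.
  exists (fun=> 0) => c cm; rewrite big1 => [|t _]; last by rewrite mul0r.
  rewrite mcoeffXM; case: ifP => // uc; rewrite mcoeff_minor minor_coef_eq0 //.
  apply: contraNneq um => e; have um : (mdeg u + mdeg (c - u)%MM = mdeg c)%N.
    by rewrite -mdegD addmC submK.
  by rewrite -cm -um e.
have ub : (mdeg u < (mdeg m).+1)%N by rewrite ltnS -um leq_addr.
pose t0 : T := (BMultinom ub, finfun a).
have aE : finfun a = a :> ('I_d.+1 -> 'I_n) by apply: funext => k; rewrite ffunE.
have vt : valid_row t0 by rewrite /valid_row /= aE aD um eqxx !andbT; apply/asboolP.
exists (fun t => (t == t0)%:R) => c cm.
rewrite (bigD1 t0) //= eqxx mul1r big1 ?addr0 => [|t /negPf->]; last by rewrite mul0r.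
by rewrite -mcoeff_row //= aE.
Qed.

(** The equations ask for the coefficient 1 at [m] and 0 at the larger monomials. Only the degree of
    [m] matters: an element of the ideal is replaced by its component of this degree, and a solution
    has no terms elsewhere. *)
Lemma initial_in_facet (F : fieldType) : term_order le ->
  initial_in le (fun h => h \in facet_ideal F d Delta) m <->
  exists x : T -> F, forall c : C,
    \sum_t x t * (system_row t c)%:~R = (Posz (c == m :> 'X_{1..N}))%:~R.
Proof.
move=> Hle; have HJ := facet_ideal_is_ideal F d Delta.
split; last first.
  case=> x xE; pose h := \sum_(t | valid_row t) x t *: ('X_[t.1] * minor F id t.2).
  have hE c : h@_c = \sum_t x t * (system_coef t c)%:~R.
    rewrite /h raddf_sum /= big_mkcond /=; apply: eq_bigr => t _.
    case: ifP => [vt|nv]; first by rewrite mcoeffZ mcoeff_row.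
    by rewrite /system_coef nv mulr0.
  have hh c : le m c -> h@_c = (c == m)%:R.
    move=> mc; have [cm|cm] := eqVneq (mdeg c) (mdeg m); last first.
      rewrite hE big1 => [|t _]; last by rewrite system_coef_eq0 ?mulr0.
      by case: (c =P m) cm => // ->; rewrite eqxx.
    have cb : (mdeg c < (mdeg m).+1)%N by rewrite cm.
    apply: etrans (xE (BMultinom cb)); rewrite hE.
    by apply: eq_bigr => t _; rewrite /system_row /= mc.
  exists h.
    apply: (ideal_sum HJ) => t vt; rewrite -mul_mpolyC; do 2!apply: (idealM HJ).
    by case/and3P: vt => /asboolP ia aD _; apply: facet_minor.
  split; first by rewrite hh ?eqxx ?(tle_refl Hle).
  move=> c; case/orP: (tle_total Hle c m) => // mc; rewrite hh //.
  by case: (c =P m) => [-> _|]; [apply: tle_refl|rewrite eqxx].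
case=> f fJ [fm fle].
have [x xE] := facet_ideal_span fJ.
exists x => c; have -> : (Posz (c == m :> 'X_{1..N}))%:~R = if le m c then f@_c else 0.
  case: eqP => [->|ne]; first by rewrite (tle_refl Hle) fm.
  case: ifP => // mc; have [->//|/fle /(tle_eq Hle) /(_ mc) e] := eqVneq f@_c 0.
  by case: ne.
rewrite /system_row; case: ifP => mc; last by apply: big1 => t _; rewrite mulr0.
have [cm|cm] := eqVneq (mdeg c) (mdeg m); first by rewrite xE.
rewrite big1 => [|t _]; last by rewrite system_coef_eq0 ?mulr0.
have [//|/fle /(tle_eq Hle) /(_ mc) e] := eqVneq f@_c 0.
by rewrite e eqxx in cm.
Qed.

End FacetSystem.

(** * Determinantal facet ideals *)

Definition squarefree_part N (m : 'X_{1..N}) : 'X_{1..N} := [multinom minn (m i) 1 | i < N].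

(** [m] divides the p^k-th power of its square-free part for k = [mdeg m], as p^k exceeds every
    exponent; then p-th roots are taken k times. *)
Lemma initial_in_squarefree_pchar (K : fieldType) p d n (Delta : {set {set 'I_n}})
    (le : rel 'X_{1..d.+1 * n}) m : p \in [pchar K] -> semi_closed d Delta ->
  term_order le -> two_by_two_diagonal le ->
  initial_in le (fun h => h \in facet_ideal K d Delta) m ->
  initial_in le (fun h => h \in facet_ideal K d Delta) (squarefree_part m).
Proof.
move=> pK HD Hle H2 Hm; have HJ := facet_ideal_is_ideal K d Delta.
have [piK HpiK] := exists_frob_retract pK.
have p1 : (1 < p)%N by case/andP: pK => /prime_gt1.
have root u : initial_in le (fun h => h \in facet_ideal K d Delta) (u *+ p)%MM ->
    initial_in le (fun h => h \in facet_ideal K d Delta) u.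
  case=> h hJ hu; exists (splitting p piK h); first exact: splitting_facet_ideal.
  exact: monic_at_splitting.
have rootk k u : initial_in le (fun h => h \in facet_ideal K d Delta) (u *+ p ^ k)%MM ->
    initial_in le (fun h => h \in facet_ideal K d Delta) u.
  elim: k u => [|k IH] u; first by rewrite expn0 mulm1n.
  have -> : (u *+ p ^ k.+1 = u *+ p ^ k *+ p)%MM.
    by apply/mnmP => i; rewrite !mulmnE expnSr mulnA.
  by move=> /root /IH.
apply: (rootk (mdeg m)); apply: (initial_in_le Hle HJ Hm).
apply/mnm_lepP => i; rewrite mulmnE mnmE.
have mi : (m i <= mdeg m)%N by rewrite mdegE (bigD1 i) //= leq_addr.
have := ltn_expl (mdeg m) p1; case: (m i) mi => [|k] ki // h.
by rewrite (minn_idPr _) // mul1n; lia.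
Qed.

(** In characteristic zero the result comes from one large prime field. The prime must suit two
    linear systems, that of [m] on the way there and that of its square-free part on the way
    back. *)
Lemma initial_in_squarefree (K : fieldType) d n (Delta : {set {set 'I_n}})
    (le : rel 'X_{1..d.+1 * n}) m : semi_closed d Delta ->
  term_order le -> two_by_two_diagonal le ->
  initial_in le (fun h => h \in facet_ideal K d Delta) m ->
  initial_in le (fun h => h \in facet_ideal K d Delta) (squarefree_part m).
Proof.
move=> HD Hle H2; have [[p pK]|K0] := pselect (exists p, p \in [pchar K]).
  exact: (initial_in_squarefree_pchar pK).
have {}K0 p : p \notin [pchar K] by apply/negP => pK; apply: K0; exists p.
rewrite !initial_in_facet //.
have [B1 H1] := linear_system_modp (system_row Delta le (m:=m))
  (fun c => Posz (c == m :> 'X_{1..d.+1 * n})) K0.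
have [B2 Hs] := linear_system_modp (system_row Delta le (m:=squarefree_part m))
  (fun c => Posz (c == squarefree_part m :> 'X_{1..d.+1 * n})) K0.
have [p] := prime_above (B1 + B2); move=> Bp pr.
rewrite (H1 p) ?(Hs p) //; [|lia|lia].
rewrite -!initial_in_facet //; apply: initial_in_squarefree_pchar => //.
exact: pchar_Fp.
Qed.

(** If f has the initial monomial m, then m^k is initial in the ideal, hence so is its square-free
    part, which divides m. Subtracting an element of the ideal with initial monomial m lowers f and
    keeps its k-th power in the ideal. *)
Lemma facet_ideal_radical (K : fieldType) d n (Delta : {set {set 'I_n}}) :
  semi_closed d Delta -> is_radical (facet_ideal K d Delta).
Proof.
move=> HD f k fk; have HJ := facet_ideal_is_ideal K d Delta.
pose w := @rowwise_weight d n; have Hle := weight_order_term_order w.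
have Hwf := weight_order_wf w.
have [f0|f0] := eqVneq f 0; first by rewrite f0; apply: (ideal0 HJ).
move: {2}(init_mon _ f) (erefl (init_mon (weight_order w) f)) => m.
elim/(well_founded_ind Hwf): m f fk f0 => m IH f fk f0 fm.
have [c c0 cf] : exists2 c, c != 0 & monic_at (weight_order w) (c *: f) m.
  exists (f@_m)^-1; first by rewrite invr_eq0 -fm init_mon_supp.
  by rewrite -fm; apply: monic_at_scale.
have [g gJ gm] : initial_in (weight_order w) (fun h => h \in facet_ideal K d Delta) m.
  have : initial_in (weight_order w) (fun h => h \in facet_ideal K d Delta) (m *+ k)%MM.
    exists ((c *: f) ^+ k); last exact: monic_at_exp.
    by rewrite exprZn -mul_mpolyC; apply: (idealM HJ).
  move/(initial_in_squarefree HD Hle (@rowwise_weight_diagonal d n)) => H.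
  apply: (initial_in_le Hle HJ H); apply/mnm_lepP => i; rewrite mnmE mulmnE.
  by case: (m i) => // j; rewrite geq_min orbC.
pose h := c *: f - g.
suff hJ : h \in facet_ideal K d Delta.
  have -> : f = c^-1%:MP * (h + g) by rewrite subrK mul_mpolyC scalerA mulVf // scale1r.
  by apply: (idealM HJ); apply: (idealD HJ).
have [->|h0] := eqVneq h 0; first exact: (ideal0 HJ).
have hm : init_mon (weight_order w) h != m.
  apply/eqP => e; have := init_mon_supp (weight_order w) h0.
  by rewrite e mcoeffB cf.1 gm.1 subrr eqxx.
apply: (IH _ _ h _ h0 erefl); last first.
  have -> : h ^+ k = (c *: f) ^+ k + (h ^+ k - (c *: f) ^+ k) by rewrite addrC subrK.
  apply: (idealD HJ); first by rewrite exprZn -mul_mpolyC; apply: (idealM HJ).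
  rewrite -[k]card_ord -!prodr_const.
  apply: (ideal_cong_prod HJ) => _; rewrite /h addrAC subrr add0r; exact: (idealN HJ).
rewrite hm andbT; have := init_mon_supp (weight_order w) h0; rewrite mcoeffB.
have [->|/cf.2 //] := eqVneq (c *: f)@_(init_mon (weight_order w) h) 0.
by rewrite sub0r oppr_eq0 => /gm.2.
Qed.

Local Open Scope quotient_scope.

Lemma facet_ideal_F_pure (K : fieldType) p d n (Delta : {set {set 'I_n}}) :
  semi_closed d Delta -> p \in [pchar K] -> F_pure p {ideal_quot (facet_ideal K d Delta)}.
Proof.
move=> HD pK; have [piK HpiK] := exists_frob_retract pK.
pose sigma := @splitting K p piK d n.
have sD : {morph sigma : x y / x + y} := splittingD pK HpiK.
have s0 : sigma 0 = 0 by apply: (addIr (sigma 0)); rewrite -sD !add0r.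
have sB x y : sigma (x - y) = sigma x - sigma y.
  by apply/eqP; rewrite eq_sym subr_eq -sD subrK.
pose R := {ideal_quot (facet_ideal K d Delta)}.
(* The choice of representative is harmless, since [sigma] is additive and preserves the ideal. *)
pose phi (x : R) : R := \pi_R (sigma (repr x)).
have phiE h : phi (\pi_R h) = \pi_R (sigma h).
  apply/eqP; rewrite /phi -Quotient.idealrBE -sB.
  by apply: (splitting_facet_ideal pK HpiK HD); rewrite Quotient.idealrBE reprK.
apply: (@F_pure_split _ p phi).
- exact: (rmorph_pchar \pi_R (pchar_mpoly _ pK)).
- by elim/quotW => x; elim/quotW => y; rewrite -rmorphD !phiE sD rmorphD.
- elim/quotW => x; elim/quotW => y; rewrite -rmorphXn -rmorphM !phiE /sigma.
  by rewrite (splittingM pK HpiK) rmorphM.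
- by rewrite -(rmorph1 \pi_R) phiE /sigma (splitting1 d n pK HpiK).
Qed.

(** The antidiagonal monomial occurs in the 2-minor, so it is at most the prescribed initial
    monomial. *)
Lemma diagonal_two_by_two (K : fieldType) d n (le : rel 'X_{1..d.+1 * n}) :
  term_order le -> diagonal K le -> two_by_two_diagonal le.
Proof.
move=> Hle Hdiag i i' y y' ii yy.
pose a (k : 'I_2) := if k == ord0 then i else i'.
pose b (k : 'I_2) := if k == ord0 then y else y'.
have pair_inc m (u v : 'I_m) : (u < v)%N ->
    increasing (fun k : 'I_2 => if k == ord0 then u else v).
  move=> uv [j hj] [k hk] /= jk.
  have -> : Ordinal hj == ord0 by apply/eqP/val_inj => /=; lia.
  by rewrite ifN //; apply/eqP => /(congr1 val) /=; lia.
have := Hdiag 1 a b (pair_inc _ _ _ ii) (pair_inc _ _ _ yy).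
rewrite !big_ord_recr big_ord0 /= mul1r /a /b /= /xvar -mpolyXD.
set f := minor _ _ _; set u := (U_(_) + _)%MM => fE.
have fV : f = 'X_[u] - 'X_[U_(mxvec_index i y') + U_(mxvec_index i' y)].
  rewrite /f /minor (expand_det_row _ ord0) !big_ord_recr big_ord0 /= add0r.
  rewrite /cofactor !det_mx11 !mxE /a /b /= !mpolyXD /xvar.
  by rewrite addn0 expr0 mul1r addn1 expr1 mulN1r mulrN.
set v := (U_(_) + U_(mxvec_index i' y))%MM in fV *.
have [->|vu] := eqVneq v u; first exact: tle_refl.
have fv : f@_v != 0.
  by rewrite fV mcoeffB !mcoeffX eqxx [u == v]eq_sym (negPf vu) sub0r oppr_eq0 oner_eq0.
suff <- : init_mon le f = u by apply: init_mon_max.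
have := congr1 (mcoeff u) fE; rewrite /init_term mcoeffZ !mcoeffX eqxx.
by case: eqP => // _ /eqP; rewrite mulr0 eq_sym oner_eq0.
Qed.

Theorem theorem6 (K : fieldType) (d n : nat) (Delta : {set {set 'I_n}}) :
  (1 <= d)%N ->
  simplicial_complex Delta -> pure_of_dim d Delta -> semi_closed d Delta ->
  [/\ is_radical (facet_ideal K d Delta),
      forall le : rel 'X_{1..d.+1 * n}, term_order le -> diagonal K le ->
        squarefree_monomial_ideal (init_ideal le (facet_ideal K d Delta))
    & forall p : nat, p \in [pchar K] ->
        F_pure p {ideal_quot (facet_ideal K d Delta)}].
Proof.
move=> _ _ _ HD; split; first exact: facet_ideal_radical.
  move=> le Hle /(diagonal_two_by_two Hle) H2; have HJ := facet_ideal_is_ideal K d Delta.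
  (* The square-free initial monomials generate: every initial monomial is a multiple of its
     square-free part, which is initial again. *)
  pose A m := initial_in le (fun h => h \in facet_ideal K d Delta) m /\ forall i, (m i <= 1)%N.
  have gen_is_ideal (G : {mpoly K[d.+1 * n]} -> Prop) : is_ideal (fun h => h \in gen_ideal G).
    split; first exact: (rpred0 (gen_submod _)).
      by move=> u v hu hv; apply: (rpredD (hu : _ \in gen_submod _) hv).
    by move=> a u; apply: gen_idealMr.
  exists A => [m []//|h]; apply/idP/idP.
    apply: (gen_ideal_sub (gen_is_ideal _)) => _ [f fJ ->].
    have [->|f0] := eqVneq f 0.
      by rewrite /init_term mcoeff0 scale0r; apply: (ideal0 (gen_is_ideal _)).
    set m := init_mon le f.
    have Hm : initial_in le (fun h => h \in facet_ideal K d Delta) m.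
      exists ((f@_m)^-1 *: f); last exact: monic_at_scale.
      by rewrite -mul_mpolyC; apply: (idealM HJ).
    have sm : (squarefree_part m <= m)%MM.
      by apply/mnm_lepP => i; rewrite mnmE geq_minl.
    rewrite /init_term -/m -(submK sm) mpolyXD scalerAl.
    apply: (idealM (gen_is_ideal _)); apply: gen_ideal_gen; exists (squarefree_part m) => //.
    split; first exact: initial_in_squarefree.
    by move=> i; rewrite mnmE geq_minr.
  apply: (gen_ideal_sub (gen_is_ideal _)) => _ [m [[f fJ fm] _] ->].
  apply: gen_ideal_gen; exists f => //.
  by rewrite /init_term (monic_at_init Hle fm) fm.1 scale1r.
by move=> p; apply: facet_ideal_F_pure.
Qed.
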